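(* For every $\varepsilon>0$, $\delta\in(0,1)$ and positive integers $m,T$, there is a randomized online algorithm using a rank parameter $r = \Theta(\varepsilon^{-2}\log(mT/\delta))$ which, in each round $t\in[T]$, having observed $v_1,\dots,v_t$, outputs a unit vector $u_t\in S^{r-1}$, such that for every sequence $v_1,\dots,v_T\in\mathbb{R}^m$ with $\|v_t\|_2\le 1$ fixed in advance (oblivious adversary), with probability at least $1-\delta$, $$\max_{t\in[T]}\max_{i\in[m]}\Big\|\sum_{s=1}^t (v_s)_i\,u_s\Big\|_2\le 1+\varepsilon.$$ The algorithm runs in time $O(m\varepsilon^{-2}\log(mT/\delta))$ per round.
   Context: $S^{r-1}$ denotes the unit sphere in $\mathbb{R}^r$; $(v_s)_i$ is the $i$-th coordinate of $v_s$. The notation $r=\Theta(\cdot)$ means $r$ is chosen between two universal constant multiples of $\varepsilon^{-2}\log(mT/\delta)$.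
   Formalization: The upper bounds on r and on the per-round time use max(1, ε⁻² log(mT/δ)) in place of ε⁻² log(mT/δ), because r must be a positive integer and for large ε no positive integer is at most a constant times that quantity. *)

(* Defs.v *)
(* MathComp / MathComp-Analysis *)
From HB Require Import structures.
From mathcomp Require Import all_boot all_order all_algebra.
From mathcomp Require Import all_classical all_reals all_analysis.

Set Implicit Arguments.
Unset Strict Implicit.
Unset Printing Implicit Defensive.

Import Order.TTheory GRing.Theory Num.Theory.
Local Open Scope classical_set_scope.
Local Open Scope ring_scope.

(* The norm that MathComp-Analysis puts on 'rV[R]_n is the sup norm. *)
Definition l2norm (R : realType) (n : nat) (x : 'rV[R]_n) : R :=
  Num.sqrt (\sum_(i < n) x 0 i ^+ 2).

(** ** A randomized real RAM

  Data are exact real numbers, stored in arrays; natural-number registers are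
  used for indexing and loop counting. Control structures are conditionals and
  counted loops, so every program terminates. There is no conversion from
  reals to naturals (no floor). One unit of time is charged for every node of
  an evaluated expression and for every executed instruction, draw, test and
  loop iteration. *)

Inductive iexp : Type :=
| INat of nat
| IReg of nat
| IAdd of iexp & iexp
| ISub of iexp & iexp
| IMul of iexp & iexp.

Inductive rexp : Type :=
| RNat of iexp
| RGet of nat & iexp (* [RGet k i] is the i-th cell of array k *)
| RAdd of rexp & rexp
| RSub of rexp & rexp
| RMul of rexp & rexp
| RDiv of rexp & rexp
| RSqrt of rexp
| RExp of rexp
| RLn of rexp.

Inductive bexp : Type :=
| ILe of iexp & iexp
| RLe of rexp & rexp.

(* The two kinds of random samples: uniform on [0, 1] and standard normal. *)
Inductive source : Type := Unif | Gauss.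

Definition source_to_bool (k : source) : bool :=
  if k is Gauss then true else false.
Definition source_of_bool (b : bool) : source := if b then Gauss else Unif.
Lemma source_to_boolK : cancel source_to_bool source_of_bool.
Proof. by case. Qed.
HB.instance Definition _ := Equality.copy source (can_type source_to_boolK).

Inductive cmd : Type :=
| Skip
| ISet of nat & iexp                 (* register := expression *)
| RSet of nat & iexp & rexp          (* array cell := expression *)
| Draw of source & nat & iexp        (* array cell := fresh random sample *)
| Seq of cmd & cmd
| If of bexp & cmd & cmd
| For of nat & iexp & cmd.
  (* [For x e c] evaluates e once, to n, and runs c for x = 0, ..., n - 1 *)

Record state (R : realType) : Type := State {
  ireg : nat -> nat;
  arr : nat -> nat -> R;
  drawn : source -> nat;  (* number of samples already consumed *)
  clock : nat }.

(* The k-th draw from source q returns [tape q k]. *)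
Definition tape (R : realType) : Type := source -> nat -> R.

Section Semantics.
Context {R : realType}.
Implicit Type s : state R.

Fixpoint isize (e : iexp) : nat :=
  match e with
  | INat _ | IReg _ => 1
  | IAdd a b | ISub a b | IMul a b => (isize a + isize b).+1
  end%N.

Fixpoint rsize (e : rexp) : nat :=
  match e with
  | RNat i | RGet _ i => (isize i).+1
  | RAdd a b | RSub a b | RMul a b | RDiv a b => (rsize a + rsize b).+1
  | RSqrt a | RExp a | RLn a => (rsize a).+1
  end%N.

Definition bsize (b : bexp) : nat :=
  match b with
  | ILe i j => (isize i + isize j).+1
  | RLe x y => (rsize x + rsize y).+1
  end%N.

Fixpoint ieval s (e : iexp) : nat :=
  match e with
  | INat n => n
  | IReg x => ireg s x
  | IAdd a b => ieval s a + ieval s b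
  | ISub a b => ieval s a - ieval s b
  | IMul a b => ieval s a * ieval s b
  end%N.

Fixpoint reval s (e : rexp) : R :=
  match e with
  | RNat i => (ieval s i)%:R
  | RGet k i => arr s k (ieval s i)
  | RAdd a b => reval s a + reval s b
  | RSub a b => reval s a - reval s b
  | RMul a b => reval s a * reval s b
  | RDiv a b => reval s a / reval s b
  | RSqrt a => Num.sqrt (reval s a)
  | RExp a => expR (reval s a)
  | RLn a => ln (reval s a)
  end.

Definition beval s (b : bexp) : bool :=
  match b with
  | ILe i j => (ieval s i <= ieval s j)%N
  | RLe x y => reval s x <= reval s y
  end.

Definition tick (n : nat) s : state R :=
  State (ireg s) (arr s) (drawn s) (clock s + n).

Definition set_ireg (x n : nat) s : state R :=
  State (fun y => if y == x then n else ireg s y) (arr s) (drawn s) (clock s).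

Definition set_arr (k i : nat) (a : R) s : state R :=
  State (ireg s)
        (fun k' i' => if (k' == k) && (i' == i) then a else arr s k' i')
        (drawn s) (clock s).

Definition consume (q : source) s : state R :=
  State (ireg s) (arr s)
        (fun q' => if q' == q then (drawn s q').+1 else drawn s q') (clock s).

Fixpoint exec (w : tape R) (c : cmd) s : state R :=
  match c with
  | Skip => tick 1 s
  | ISet x e => tick (isize e).+1 (set_ireg x (ieval s e) s)
  | RSet k i e =>
      tick (isize i + rsize e).+1 (set_arr k (ieval s i) (reval s e) s)
  | Draw q k i =>
      tick (isize i).+1
        (consume q (set_arr k (ieval s i) (w q (drawn s q)) s))
  | Seq c1 c2 => exec w c2 (exec w c1 s)
  | If b c1 c2 =>
      let s' := tick (bsize b).+1 s in
      if beval s b then exec w c1 s' else exec w c2 s'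
  | For x e c1 =>
      foldl (fun s' i => exec w c1 (tick 1 (set_ireg x i s')))
            (tick (isize e).+1 s) (iota 0 (ieval s e))
  end%N.

(** ** Running a program as an online algorithm

  The same program is run in every round and its memory persists between
  rounds. Initially, registers 0, 1, 2 hold m, T, r, the first two cells of
  array 2 hold eps and delta, and everything else is 0; in particular any
  preprocessing is charged to the first round. At the start of a round the
  new vector is placed in array 0 and the clock is reset; at the end of the
  round the answer is read off array 1. *)

Definition init_state (m T r : nat) (eps delta : R) : state R :=
  State (fun x => nth 0%N [:: m; T; r] x)
        (fun k i => if k == 2%N then nth 0 [:: eps; delta] i else 0)
        (fun=> 0%N) 0%N.

Definition receive (m : nat) (x : 'rV[R]_m) s : state R :=
  State (ireg s)
        (fun k i => if k == 0%N
                    then (if insub i is Some j then x 0 j else 0)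
                    else arr s k i)
        (drawn s) 0.

Definition play_round (w : tape R) (c : cmd) (m : nat) s (x : 'rV[R]_m) :
  state R := exec w c (receive x s).

Section Run.
Variables (c : cmd) (m T r : nat) (eps delta : R) (w : tape R).

(* Both depend only on the vectors [vs] received so far. *)
Definition final_state (vs : seq 'rV[R]_m) : state R :=
  foldl (play_round w c (m:=m)) (init_state m T r eps delta) vs.

Definition last_output (vs : seq 'rV[R]_m) : 'rV[R]_r :=
  \row_(j < r) arr (final_state vs) 1 j.

Definition last_round_time (vs : seq 'rV[R]_m) : nat := clock (final_state vs).

Variable v : T.-tuple 'rV[R]_m.

(* Rounds are numbered from 0: in round t the vectors received so far are the
   first t.+1 components of v. *)
Definition output (t : 'I_T) : 'rV[R]_r := last_output (take t.+1 v).

Definition round_time (t : 'I_T) : nat := last_round_time (take t.+1 v).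

Definition discrepancy : R :=
  \big[Num.max/0]_(t < T) \big[Num.max/0]_(i < m)
    l2norm (\sum_(s < T | (s <= t)%N) tnth v s 0 i *: output s).

End Run.
End Semantics.

(** ** Randomness *)

Definition mutually_independent (R : realType) (d : measure_display)
    (Omega : measurableType d) (P : probability Omega R) (I : eqType)
    (X : I -> {RV P >-> R}) : Prop :=
  forall (J : seq I) (B : I -> set R), uniq J ->
    (forall i, i \in J -> measurable (B i)) ->
    P (\bigcap_(i in [set` J]) (X i @^-1` B i)) =
    (\prod_(i <- J) P (X i @^-1` B i))%E.

Record random_source (R : realType) (d : measure_display)
    (Omega : measurableType d) (P : probability Omega R)
    (X : source -> nat -> {RV P >-> R}) : Prop := {
  unif_law : forall k (B : set R), measurable B ->
    distribution P (X Unif k) B = uniform_prob (@ltr01 R) B;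
  gauss_law : forall k (B : set R), measurable B ->
    distribution P (X Gauss k) B = normal_prob 0 1 B;
  source_indep :
    mutually_independent (fun qk : source * nat => X qk.1 qk.2) }.

Definition tape_of (R : realType) (d : measure_display)
    (Omega : measurableType d) (P : probability Omega R)
    (X : source -> nat -> {RV P >-> R}) (o : Omega) : tape R :=
  fun q k => X q k o.

(* The quantity eps^-2 log(mT/delta). *)
Definition rank_scale (R : realType) (m T : nat) (eps delta : R) : R :=
  eps ^- 2 * ln ((m * T)%:R / delta).

(* Main.v *)
(** Hide an m x r matrix Z with independent standard normal entries and let the
  output u_t steer it: Z_t = Z_(t-1) + b v_t u_t^T with b = 2 sqrt(r - 1).
  Then sum_(s <= t) v_s u_s^T = (Z_t - Z_0) / b, so it suffices that every row
  of every Z_t has length at most sqrt(r - 1) (1 + eps). The directions u_t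
  are chosen so that each step preserves the Gaussian law exactly; a
  chi-square tail bound and a union bound over rows and times conclude.

  By rotation invariance, one step only moves the single row y = v^T Z / |v|,
  by h = b |v| along u. Write t = |y|; the radial density of y is proportional
  to p(t) = t^(r-1) exp(-t^2/2). Either y is moved to another point of the
  same sphere (possible when h <= 2 t: add h u along a chord, i.e. rotate y by
  an angle depending only on t, through the complex structure on R^r, r even),
  or y is moved through the origin to radius |h - t|. For h/2 <= t < h the
  second move is taken with probability p(h - t) / p(t), for t < h/2 always,
  so the radii t and h - t exchange equal masses. That ratio is at most 1
  because h^2 <= 4 (r - 1). *)
Require Import Defs.
From HB Require Import structures.
From mathcomp Require Import all_boot all_order all_algebra.
From mathcomp Require Import all_classical all_reals all_analysis.
From mathcomp Require Import measurable_realfun ring lra zify.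

Set Implicit Arguments.
Unset Strict Implicit.
Unset Printing Implicit Defensive.

Import Order.TTheory GRing.Theory Num.Theory.
Import numFieldNormedType.Exports.
Local Open Scope classical_set_scope.
Local Open Scope ring_scope.

(** * Product sigma-algebra and resampling *)

(** The factor 2 in b is squeezed from both sides. Two vectors in a ball of radius rho may differ by
    2 rho, so the bound 1 + eps asks for b of at least 2 sqrt(r - 1); the ratio p(h - t) / p(t)
    stays at most 1 for h up to 2 sqrt(r - 1), and h <= b because |v| <= 1. This last bound on h is
    artanh y >= y in disguise, with y = (2t - h) / h.

    Neither a product measure on matrices nor a surface measure on spheres is constructed. The
    Gaussian law enters through the statement that resampling any one entry changes no integral;
    rotations of rows and of coordinate pairs reduce to plane rotations of two entries. Polar
    coordinates are replaced by averaging over the dilations of one row against da / a. As the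
    vectors are fixed in advance, the uniform sample of a round is independent of the matrix it acts
    on, so the invariance of a single step can be iterated. *)

Definition coordT (R : Type) (I : Type) := I -> R.

Section CoordinateSigmaAlgebra.
Context {R : realType} {I : eqType}.

(** The index type may be infinite: the same construction serves the tape, with infinitely many
    cells, and the matrices. *)
Definition coord_sets : set (set (I -> R)) :=
  [set A | exists i B, measurable B /\ A = (fun x : I -> R => x i) @^-1` B].

HB.instance Definition _ :=
  Measurable.copy (coordT R I) (g_sigma_algebraType coord_sets).

Lemma measurable_coord (i : I) :
  measurable_fun [set: coordT R I] (fun x : coordT R I => (x : I -> R) i).
Proof.
by move=> _ B mB; rewrite setTI; apply: sub_sigma_algebra; exists i, B.
Qed.

Lemma measurable_to_coord d (T : measurableType d) (f : T -> coordT R I) :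
  (forall i, measurable_fun [set: T] (fun t => (f t : I -> R) i)) ->
  measurable_fun [set: T] f.
Proof.
move=> mf; apply: (@measurability _ _ T (coordT R I) setT f coord_sets) => //.
by move=> _ [_ [i [B [mB ->]]] <-]; exact: mf.
Qed.

Definition upd (z : I -> R) (i : I) (x : R) : I -> R :=
  fun k => if k == i then x else z k.

Lemma measurable_upd i :
  measurable_fun [set: coordT R I * R] (fun p => upd p.1 i p.2 : coordT R I).
Proof.
apply: measurable_to_coord => k; rewrite /upd; case: (k == i).
  exact: (@measurable_snd _ _ (coordT R I) R).
have := measurableT_comp (measurable_coord k) (@measurable_fst _ _ (coordT R I) R).
exact.
Qed.

Lemma measurable_updl i (x : R) :
  measurable_fun [set: coordT R I] (fun z => upd z i x : coordT R I).
Proof.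
apply: measurable_to_coord => k; rewrite /upd; case: (k == i) => //.
exact: measurable_coord.
Qed.

End CoordinateSigmaAlgebra.

Lemma ge0_integral_pushT d1 d2 (X : measurableType d1) (Y : measurableType d2)
    (R : realType) (phi : X -> Y) (mphi : measurable_fun setT phi)
    (mu : {measure set X -> \bar R}) (f : Y -> \bar R) :
  measurable_fun setT f -> (forall y, 0 <= f y)%E ->
  (\int[pushforward mu phi]_y f y = \int[mu]_x f (phi x))%E.
Proof. by move=> mf f0; rewrite ge0_integral_pushforward. Qed.

Section Resampling.
Context {R : realType} {I : eqType}.
Local Open Scope ereal_scope.

(** For probabilities this says that coordinate i has law nu and is independent of the other ones.
    As an identity between integrals it can be iterated over several coordinates. *)
Definition resamples (mu : {measure set (coordT R I) -> \bar R}) (i : I)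
    (nu : {measure set R -> \bar R}) :=
  forall F : coordT R I -> \bar R, measurable_fun setT F ->
    (forall z, 0 <= F z) ->
    \int[mu]_z F z = \int[mu]_z \int[nu]_x F (upd z i x).

(** Finite-dimensional boxes. The sides C are given for all indices and are [setT] off J, so that
    two boxes intersect side by side: a pi-system generating the product sigma-algebra. *)
Definition cylinders : set (set (coordT R I)) :=
  [set A | exists (J : seq I) (C : I -> set R),
    [/\ forall k, measurable (C k), forall k, k \notin J -> C k = setT &
       A = [set x | forall k, C k ((x : I -> R) k)]]].

Lemma cylinders_setI : setI_closed cylinders.
Proof.
move=> _ _ [J [C [mC CT ->]]] [K [D [mD DT ->]]].
exists (J ++ K), (fun k => C k `&` D k); split.
- by move=> k; exact: measurableI.
- by move=> k; rewrite mem_cat negb_or => /andP[/CT -> /DT ->]; rewrite setIT.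
- apply/seteqP; split => [x [xC xD] k|x xCD]; first by split; [exact: xC|exact: xD].
  by split=> k; have [] := xCD k.
Qed.

Lemma measurable_cylinders :
  (measurable : set (set (coordT R I))) = <<s cylinders >>.
Proof.
apply/seteqP; split.
  apply: smallest_sub; first exact: smallest_sigma_algebra.
  move=> _ [i [B [mB ->]]]; apply: sub_sigma_algebra.
  exists [:: i], (fun k => if k == i then B else setT); split.
  - by move=> k; case: ifP.
  - by move=> k; rewrite inE => /negbTE ->.
  - apply/seteqP; split => [x xB k|x /(_ i)]; last by rewrite eqxx.
    by case: eqP => // ->.
apply: smallest_sub; first exact: sigma_algebra_measurable.
move=> _ [J [C [mC CT ->]]].
have -> : [set x : coordT R I | forall k, C k ((x : I -> R) k)] =
    \bigcap_(k in [set` J]) ((fun x : coordT R I => (x : I -> R) k) @^-1` C k).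
  apply/seteqP; split => [x xC k _|x xC k]; first exact: xC.
  by have [/xC //|/CT ->] := boolP (k \in J).
elim: J {CT} => [|k J IH]; first by rewrite set_nil bigcap_set0.
rewrite (_ : [set` k :: J] = k |` [set` J]) ?bigcap_setU1.
  apply: measurableI => //.
  by have := measurable_coord k measurableT (mC k); rewrite setTI.
apply/seteqP; split => j /=; rewrite inE.
  by move=> /orP[/eqP|]; [left|right].
by case=> [->|jJ]; [rewrite eqxx|rewrite jJ orbT].
Qed.

Context d (Omega : measurableType d) (P : probability Omega R).
Variable (X : I -> {RV P >-> R}).

Definition jointly (o : Omega) : coordT R I := fun i => X i o.

Lemma measurable_jointly : measurable_fun setT jointly.
Proof. by apply: measurable_to_coord => i; exact: measurable_funPT. Qed.

Hypothesis indep : mutually_independent X.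

(** All coordinates but i, kept in the same space by freezing coordinate i at 0. *)
Let Y i (o : Omega) : coordT R I := upd (jointly o) i 0%R.

Let mY i : measurable_fun setT (Y i).
Proof. exact: (measurableT_comp (measurable_updl i 0%R) measurable_jointly). Qed.

(** For fixed B both sides are finite measures in A. They agree on cylinders by mutual independence,
    hence everywhere. *)
Lemma indep_others i (A : set (coordT R I)) (B : set R) :
  measurable A -> measurable B ->
  P (Y i @^-1` A `&` X i @^-1` B) = P (Y i @^-1` A) * P (X i @^-1` B).
Proof.
move=> mA mB.
have mXB : measurable (X i @^-1` B) by exact: measurable_funPTI.
have PB : P (X i @^-1` B) \is a fin_num by exact: fin_num_measure.
pose c : {nonneg R} := NngNum (fine_ge0 (measure_ge0 P (X i @^-1` B))).
pose m1 : {measure set _ -> \bar R} := pushforward (mrestr P mXB) (Y i).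
pose m2 : {measure set _ -> \bar R} := mscale c (pushforward P (Y i)).
suff : m1 (mY i) A = m2 (mY i) A.
  by rewrite /m1/= /pushforward/= /mrestr/= /mscale/= fineK// muleC.
apply: (measure_unique cylinders (fun=> setT)) => //.
- exact: measurable_cylinders.
- exact: cylinders_setI.
- by move=> _; exists [::], (fun=> setT); split => //; apply/seteqP; split.
- by rewrite bigcup_const//; exists 0%N.
- move=> {mA}A [J [C [mC CT ->]]].
  rewrite /m1 /m2/= /mrestr/= /mscale/= fineK// /pushforward muleC.
  (* Coordinate i of [Y i] is constantly 0: a box whose i-th side misses 0 has empty preimage, and
     otherwise that side imposes nothing. *)
  have [Ci0|Ci0] := pselect (C i 0%R); last first.
    have -> : Y i @^-1` [set x | forall k, C k ((x : I -> R) k)] = set0.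
      by apply/seteqP; split => // w /(_ i); rewrite /Y /upd eqxx.
    by rewrite set0I measure0 mul0e.
  (* Independence is stated for duplicate-free lists, and i must be left free for the event on
     [X i]. *)
  pose K := rem i (undup J).
  have uK : uniq K by rewrite rem_uniq// undup_uniq.
  have iK : i \notin K by rewrite mem_rem_uniqF// undup_uniq.
  have YE : Y i @^-1` [set x | forall k, C k ((x : I -> R) k)] =
      \bigcap_(k in [set` K]) (X k @^-1` C k).
    apply/seteqP; split => [w wC k kK|w wC k].
      move: (wC k); rewrite /Y /upd /jointly; case: eqP => // ki.
      by move: kK iK; rewrite /= ki => ->.
    rewrite /Y /upd /jointly; have [->//|ki] := eqVneq k i.
    have [kJ|/CT -> //] := boolP (k \in J).
    by apply: wC; rewrite /= /K mem_rem_uniq ?undup_uniq// inE ki mem_undup.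
  pose D k := if k == i then B else C k.
  have DK k : k \in K -> D k = C k.
    by rewrite /D; case: eqP => // ->; rewrite (negbTE iK).
  have -> : Y i @^-1` [set x | forall k, C k ((x : I -> R) k)] `&` X i @^-1` B =
      \bigcap_(k in [set` i :: K]) (X k @^-1` D k).
    rewrite YE; apply/seteqP; split => [w [wC wB] k|w wC].
      rewrite /= inE => /orP[/eqP ->|kK]; first by rewrite /D eqxx.
      by rewrite DK//; exact: wC.
    split => [k kK|].
      by rewrite -DK//; apply: wC; rewrite /= inE (kK : k \in K) orbT.
    by have := wC i; rewrite /D /= eqxx; apply; rewrite inE eqxx.
  rewrite YE !indep//=; last 2 first.
  - by rewrite iK.
  - by move=> k _; rewrite /D; case: ifP.
  rewrite big_cons {1}/D eqxx muleC; congr (_ * _).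
  by rewrite big_seq [RHS]big_seq; apply: eq_bigr => k /DK ->.
- move=> _; rewrite /m1/= /pushforward/= /mrestr/= preimage_setT setTI.
  by rewrite (le_lt_trans (probability_le1 _ mXB))// ltry.
Qed.

Lemma jointly_resample i (F : coordT R I -> \bar R) :
  measurable_fun setT F -> (forall z, 0 <= F z) ->
  \int[P]_o F (jointly o) =
  \int[P]_o \int[distribution P (X i)]_x F (upd (jointly o) i x).
Proof.
move=> mF F0.
pose Yi : {RV P >-> coordT R I} :=
  HB.pack (Y i) (isMeasurableFun.Build _ _ _ _ _ (mY i)).
pose W o : coordT R I * R := (Y i o, X i o).
have mW : measurable_fun setT W by apply: measurable_fun_pair.
pose G (p : coordT R I * R) := F (upd p.1 i p.2).
have mG : measurable_fun setT G by exact: measurableT_comp (measurable_upd i).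
have G0 p : 0 <= G p by exact: F0.
have updK (z : I -> R) a b : upd (upd z i a) i b = upd z i b.
  by apply/funext => k; rewrite /upd; case: eqP.
transitivity (\int[pushforward P W]_p G p).
  rewrite ge0_integral_pushT//; apply: eq_integral => o _.
  rewrite /= /G /W /Y/= updK; congr F.
  by apply/funext => k; rewrite /upd; case: eqP => // ->.
transitivity (\int[(distribution P Yi) \x (distribution P (X i))]_p G p).
  apply: eq_measure_integral => A mA _.
  apply/esym.
  apply: (@product_measure_unique _ _ _ _ _ (distribution P Yi) (distribution P (X i)) (pushforward P W)) => // B C mB mC.
  exact: indep_others.
rewrite (fubini_tonelli1 G)//; rewrite (ge0_integral_pushT (mY i)); last 2 first.
- exact: measurable_fun_fubini_tonelli_F.
- by move=> z; exact: integral_ge0.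
apply: eq_integral => o _; apply: eq_integral => x _.
by rewrite /G /Y/= updK.
Qed.

End Resampling.

(** * Gaussian integrals *)

Section Tonelli.
Context d1 d2 (T1 : measurableType d1) (T2 : measurableType d2) (R : realType).
Variable m2 : {sigma_finite_measure set T2 -> \bar R}.
Variables (f : T1 -> T2 -> \bar R).
Hypotheses (mf : measurable_fun setT (fun p => f p.1 p.2))
  (f0 : forall x y, (0 <= f x y)%E).
Local Open Scope ereal_scope.

Lemma measurable_ge0_integral2 :
  measurable_fun setT (fun x => \int[m2]_y f x y).
Proof. exact: (measurable_fun_fubini_tonelli_F _ mf). Qed.

Lemma ge0_integral_swap (m1 : {sigma_finite_measure set T1 -> \bar R}) :
  \int[m1]_x \int[m2]_y f x y = \int[m2]_y \int[m1]_x f x y.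
Proof. exact: (fubini_tonelli _ mf). Qed.

End Tonelli.
Arguments measurable_ge0_integral2 {d1 d2 T1 T2 R m2} f.
Arguments ge0_integral_swap {d1 d2 T1 T2 R m2} f mf f0 {m1}.

(* The library's Lebesgue measure lives on [measurableTypeR R] rather than on
   the canonical measurable structure of [R]; the aliases below avoid mixing
   the two (convertible) structures. *)
Section MeasuresOnReals.
Context {R : realType}.

Definition leb : set R -> \bar R := @lebesgue_measure R.

Let leb0 : leb set0 = 0%E. Proof. exact: measure0. Qed.

Let leb_ge0 A : (0 <= leb A)%E. Proof. exact: measure_ge0. Qed.

Let leb_sigma_additive : semi_sigma_additive leb.
Proof. exact: (@measure_semi_sigma_additive _ _ _ (@lebesgue_measure R)). Qed.

HB.instance Definition _ := isMeasure.Build _ _ _ leb leb0 leb_ge0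
  leb_sigma_additive.

Let leb_sigma_finite : sigma_finite setT leb.
Proof. exact: (@sigma_finiteT _ _ _ (@lebesgue_measure R)). Qed.

HB.instance Definition _ := Measure_isSigmaFinite.Build _ _ _ leb
  leb_sigma_finite.

Definition std_normal : set R -> \bar R := normal_prob 0 1.

Let std_normal0 : std_normal set0 = 0%E. Proof. exact: measure0. Qed.

Let std_normal_ge0 A : (0 <= std_normal A)%E. Proof. exact: measure_ge0. Qed.

Let std_normal_sigma_additive : semi_sigma_additive std_normal.
Proof. exact: (@measure_semi_sigma_additive _ _ _ (normal_prob 0 1)). Qed.

HB.instance Definition _ := isMeasure.Build _ _ _ std_normal std_normal0
  std_normal_ge0 std_normal_sigma_additive.

Let std_normal_setT : std_normal setT = 1%E.
Proof. exact: (@probability_setT _ _ _ (normal_prob 0 1)). Qed.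

HB.instance Definition _ := Measure_isProbability.Build _ _ _ std_normal
  std_normal_setT.

Definition std_uniform : set R -> \bar R := uniform_prob (@ltr01 R).

Let std_uniform0 : std_uniform set0 = 0%E. Proof. exact: measure0. Qed.

Let std_uniform_ge0 A : (0 <= std_uniform A)%E. Proof. exact: measure_ge0. Qed.

Let std_uniform_sigma_additive : semi_sigma_additive std_uniform.
Proof. exact: (@measure_semi_sigma_additive _ _ _ (uniform_prob (@ltr01 R))). Qed.

HB.instance Definition _ := isMeasure.Build _ _ _ std_uniform std_uniform0
  std_uniform_ge0 std_uniform_sigma_additive.

Let std_uniform_setT : std_uniform setT = 1%E.
Proof. exact: (@probability_setT _ _ _ (uniform_prob (@ltr01 R))). Qed.

HB.instance Definition _ := Measure_isProbability.Build _ _ _ std_uniform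
  std_uniform_setT.

Let measurable_toR : measurable_fun setT (id : measurableTypeR R -> R).
Proof. by []. Qed.

Lemma lebE (f : R -> \bar R) : measurable_fun setT f ->
  (forall x, 0 <= f x)%E ->
  (\int[leb]_x f x = \int[lebesgue_measure]_x f x)%E.
Proof. exact: (ge0_integral_pushT measurable_toR). Qed.

Lemma std_normalE (f : R -> \bar R) : measurable_fun setT f ->
  (forall x, 0 <= f x)%E ->
  (\int[std_normal]_x f x = \int[normal_prob 0 1]_x f x)%E.
Proof. exact: (ge0_integral_pushT measurable_toR). Qed.

End MeasuresOnReals.

(** * Affine substitutions and plane rotations under Lebesgue measure *)

Section AffineSubstitution.
Context {R : realType}.
Local Open Scope ereal_scope.
Notation mu := (@leb R).

Let affine (a b x : R) : R := (a * x + b)%R.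

Let measurable_affine a b : measurable_fun setT (affine a b).
Proof. by apply: measurable_funD => //; apply: measurable_funM. Qed.

(** Uniqueness of Lebesgue measure: the rescaled pushforward gives half-open intervals their
    length. *)
Let leb_affine (a b : R) (A : set R) : (0 < a)%R -> measurable A ->
  mu A = a%:E * mu (affine a b @^-1` A).
Proof.
move=> a0 mA.
pose h : measurableTypeR R -> measurableTypeR R := affine a b.
have mh : measurable_fun setT h by exact: measurable_affine.
pose nu : {measure set (measurableTypeR R) -> \bar R} :=
  mscale (NngNum (ltW a0)) (pushforward lebesgue_measure h).
have -> : a%:E * mu (affine a b @^-1` A) = nu mh A by [].
apply: lebesgue_measure_unique => // _ [[c d] _ <-] /=.
rewrite /nu/= /mscale/= /pushforward.
have -> : h @^-1` `]c, d] = `]((c - b) / a)%R, ((d - b) / a)%R]%classic.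
  apply/seteqP; split => x /=; rewrite !in_itv/= /h /affine.
    by rewrite ltr_pdivrMr// ler_pdivlMr// ltrBlDr lerBrDr ![(x * a)%R]mulrC.
  by rewrite ltr_pdivrMr// ler_pdivlMr// ltrBlDr lerBrDr ![(x * a)%R]mulrC.
rewrite !lebesgue_measure_itv/= !lte_fin ltr_pM2r ?invr_gt0// ltrD2r.
case: ifP => _; last by rewrite mule0.
rewrite -!EFinB -EFinM; congr EFin.
by field; rewrite gt_eqF.
Qed.

Lemma ge0_integral_opp (f : R -> \bar R) : measurable_fun setT f ->
  (forall x, 0 <= f x) -> \int[mu]_x f x = \int[mu]_x f (- x)%R.
Proof.
move=> mf f0.
have mN : measurable_fun setT (@GRing.opp R).
  exact: oppr_measurable.
rewrite -(@ge0_integral_pushT _ _ (R) (R) _ _ mN mu f mf f0).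
by apply: eq_measure_integral => A mA _; exact/esym/lebesgue_measureN.
Qed.

(** A negative slope is a positive one composed with the reflection x -> -x. *)
Lemma ge0_integral_affine (a b : R) (f : R -> \bar R) : a != 0%R ->
  measurable_fun setT f -> (forall x, 0 <= f x) ->
  \int[mu]_x f x = `|a|%:E * \int[mu]_x f (a * x + b)%R.
Proof.
have pos c : (0 < c)%R -> measurable_fun setT f -> (forall x, 0 <= f x) ->
    \int[mu]_x f x = c%:E * \int[mu]_x f (c * x + b)%R.
  move=> c0 mf f0.
  rewrite -(@ge0_integral_pushT _ _ (R) (R) _ _ (measurable_affine c b) mu f mf f0).
  rewrite -(ge0_integral_mscale _ measurableT (NngNum (ltW c0)))//.
  apply: eq_measure_integral => A mA _.
  by rewrite /= /mscale/= (leb_affine b c0 mA).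
move=> a0 mf f0; have [a1|a1] := ltP 0%R a; first by rewrite gtr0_norm// -pos.
have {a0 a1}a0 : (a < 0)%R by rewrite lt_neqAle a0.
rewrite (pos (- a)%R) ?oppr_gt0// ltr0_norm//; congr (_ * _).
rewrite ge0_integral_opp//.
  by apply: eq_integral => x _; rewrite mulrNN.
by apply: (measurableT_comp mf); exact: measurable_affine.
Qed.

End AffineSubstitution.

Section PlaneRotation.
Context {R : realType}.
Local Open Scope ereal_scope.
Notation mu := (@leb R).

(* A rotation is a product of two substitutions, each affine in one variable:
   first y is replaced by the new abscissa u, then x by the new ordinate. *)
Lemma ge0_integral_leb_rotate (c s : R) (g : R * R -> \bar R) :
  (c ^+ 2 + s ^+ 2 = 1)%R -> measurable_fun setT g -> (forall p, 0 <= g p) ->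
  \int[mu]_x \int[mu]_y g (c * x - s * y, s * x + c * y)%R =
  \int[mu]_x \int[mu]_y g (x, y).
Proof.
move=> cs mg g0.
have mpair (u v : R * R -> R) : measurable_fun setT u -> measurable_fun setT v ->
    measurable_fun setT (fun p => g (u p, v p)).
  by move=> mu mv; apply: (measurableT_comp mg); exact: measurable_fun_pair.
have mpair1 (u v : R -> R) : measurable_fun setT u -> measurable_fun setT v ->
    measurable_fun setT (fun p => g (u p, v p)).
  by move=> mu mv; apply: (measurableT_comp mg); exact: measurable_fun_pair.
have maff (a b : R) : measurable_fun setT (fun y : R => a * y + b)%R.
  by apply: measurable_funD => //; apply: measurable_funM.
have mfst : measurable_fun [set: R * R] (fun p => p.1) by exact: measurable_fst.
have msnd : measurable_fun [set: R * R] (fun p => p.2) by exact: measurable_snd.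
have mswap : measurable_fun setT (fun p => g (p.1, p.2)) by exact: mpair.
have norm1 (a : R) : (a ^+ 2 = 1 -> a != 0)%R /\ (a ^+ 2 = 1 -> `|a| = 1)%R.
  split=> a2.
    by apply/eqP => a0; move: a2; rewrite a0 expr0n/= => /esym/eqP; rewrite oner_eq0.
  by apply/eqP; rewrite -(@eqrXn2 _ 2)// real_normK ?num_real// a2 expr1n.
(* The general substitutions divide by s. If s = 0 then c is 1 or -1 and each variable is treated on
   its own. *)
have [s0|s0] := eqVneq s 0%R.
  have c1 : (c ^+ 2 = 1)%R by rewrite -cs s0 expr0n/= addr0.
  have [/(_ c1)cn0 /(_ c1)c1n] := norm1 c.
  rewrite s0.
  transitivity (\int[mu]_x \int[mu]_y g (c * x, c * y)%R).
    by apply: eq_integral => x _; apply: eq_integral => y _; rewrite !mul0r subr0 add0r.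
  transitivity (\int[mu]_x \int[mu]_y g (c * x, y)%R).
    apply: eq_integral => x _.
    have my : measurable_fun setT (fun y => g (c * x, y)%R) by exact: mpair1.
    rewrite [RHS](ge0_integral_affine 0 cn0 my (fun=> g0 _)).
    by rewrite c1n mul1e; apply: eq_integral => y _; rewrite addr0.
  have mG : measurable_fun setT (fun x => \int[mu]_y g (x, y)).
    exact: (measurable_ge0_integral2 (fun x y => g (x, y)) mswap (fun _ _ => g0 _)).
  have G0 x : 0 <= \int[mu]_y g (x, y) by exact: integral_ge0.
  rewrite [RHS](ge0_integral_affine 0 cn0 mG G0).
  by rewrite c1n mul1e; apply: eq_integral => y _; rewrite addr0.
have mk : measurable_fun [set: R * R] (fun p => g (p.2, (p.1 - c * p.2) / s)%R).
  apply: mpair => //.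
  by apply: measurable_funM => //; apply: measurable_funB => //; apply: measurable_funM.
have mk' : measurable_fun [set: R * R] (fun p => g (p.1, (p.2 - c * p.1) / s)%R).
  apply: mpair => //.
  by apply: measurable_funM => //; apply: measurable_funB => //; apply: measurable_funM.
have mK : measurable_fun setT (fun x : R => \int[mu]_u g (u, (x - c * u) / s)%R).
  by apply: (measurable_ge0_integral2 (fun x u : R => g (u, (x - c * u) / s)%R)).
have mK' : measurable_fun setT (fun u : R => \int[mu]_x g (u, (x - c * u) / s)%R).
  by apply: (measurable_ge0_integral2 (fun u x : R => g (u, (x - c * u) / s)%R)).
have si0 : (- s^-1 != 0)%R by rewrite oppr_eq0 invr_eq0.
have int0 (h : R -> \bar R) : (forall x, 0 <= h x) -> 0 <= \int[mu]_x h x.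
  by move=> h0; exact: integral_ge0.
(* With u = c x - s y, the ordinate s x + c y equals (x - c u) / s because c^2 + s^2 = 1. The
   Jacobian 1/|s| is cancelled by the factor |s| of the later substitution in x. *)
transitivity (`|s^-1|%:E * \int[mu]_x \int[mu]_u g (u, (x - c * u) / s)%R).
  rewrite -(ge0_integralZl _ measurableT mK); last 2 first.
  - by move=> x _; exact: int0.
  - by rewrite lee_fin.
  apply: eq_integral => x _.
  have mrot : measurable_fun setT (fun y => g (c * x - s * y, s * x + c * y)%R).
    by apply: mpair1; [apply: measurable_funB|apply: measurable_funD] => //;
      apply: measurable_funM.
  rewrite (ge0_integral_affine (c * x / s)%R si0 mrot (fun=> g0 _)) normrN.
  congr (_ * _); apply: eq_integral => u _; congr (g (_, _)); first by field.
  have -> : (s * x = (1 - c ^+ 2) / s * x)%R by rewrite -cs; field.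
  by field.
rewrite (ge0_integral_swap (fun x u : R => g (u, (x - c * u) / s)%R) mk (fun _ _ => g0 _)).
rewrite -(ge0_integralZl _ measurableT mK'); last 2 first.
- by move=> u _; exact: int0.
- by rewrite lee_fin.
apply: eq_integral => u _.
have mx : measurable_fun setT (fun x : R => g ((u : R), (x - c * u) / s)%R).
  by apply: mpair1 => //; apply: measurable_funM => //; apply: measurable_funB.
rewrite (ge0_integral_affine (c * u)%R s0 mx (fun=> g0 _)).
rewrite muleA -EFinM -normrM mulVf// normr1 mul1e.
by apply: eq_integral => x _; congr (g (_, _)); field.
Qed.

End PlaneRotation.

(** * The standard normal law: density, dilations, rotations *)

Section StandardNormal.
Context {R : realType}.
Local Open Scope ereal_scope.
Notation mu := (@leb R).
Notation phi := (normal_pdf (0 : R) 1).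
Notation N01 := (@std_normal R).

Lemma std_pdfE x : phi x = (normal_peak 1 * expR (- (x ^+ 2 / 2)))%R.
Proof.
rewrite normal_pdfE ?oner_eq0// /normal_fun subr0 expr1n mulNr.
by rewrite -[in LHS]mulr_natr mul1r.
Qed.

(** Change of variables holds with the Radon-Nikodym derivative, which equals the density almost
    everywhere since both have the same integral over every measurable set. *)
Lemma ge0_integral_normal (f : R -> \bar R) : measurable_fun setT f ->
  (forall x, 0 <= f x) -> \int[N01]_x f x = \int[mu]_x (f x * (phi x)%:E).
Proof.
move=> mf f0; have dom := normal_prob_dominates (0 : R) 1.
have mf' : @measurable_fun _ _ (measurableTypeR R) _ setT f by [].
have H := Radon_Nikodym_SigmaFinite.change_of_variables dom f0 measurableT mf'.
have mg : measurable_fun setT (fun x => f x * (phi x)%:E).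
  by apply: emeasurable_funM => //; apply/measurable_EFinP; exact: measurable_normal_pdf.
have g0 x : 0 <= f x * (phi x)%:E by rewrite mule_ge0// lee_fin normal_pdf_ge0.
rewrite std_normalE// lebE// -H.
have mphi : measurable_fun setT (EFin \o phi).
  by apply/measurable_EFinP; exact: measurable_normal_pdf.
have iRN := Radon_Nikodym_SigmaFinite.f_integrable dom.
apply: ae_eq_integral => //.
- by apply: emeasurable_funM => //; exact: measurable_int iRN.
- apply: ae_eqe_mul2l; apply: integral_ae_eq => // E _ mE.
  by rewrite -Radon_Nikodym_SigmaFinite.f_integral.
Qed.

(** The weight is a phi(a x) / phi(x), with phi the standard normal density. *)
Lemma ge0_integral_normal_scale (a : R) (f : R -> \bar R) : (0 < a)%R ->
  measurable_fun setT f -> (forall x, 0 <= f x) ->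
  \int[N01]_x f x =
  \int[N01]_x (f (a * x)%R * (a * expR (- ((a ^+ 2 - 1) * x ^+ 2 / 2)))%:E).
Proof.
move=> a0 mf f0.
have mfa : measurable_fun setT (fun x => f (a * x)%R).
  by apply: (measurableT_comp mf); exact: measurable_funM.
have mphi : measurable_fun setT (EFin \o phi).
  by apply/measurable_EFinP; exact: measurable_normal_pdf.
have me : measurable_fun setT
    (fun x : R => (a * expR (- ((a ^+ 2 - 1) * x ^+ 2 / 2)))%:E).
  apply/measurable_EFinP; apply: measurable_funM => //.
  apply: measurableT_comp => //; apply: measurableT_comp => //.
  by apply: measurable_funM => //; apply: measurable_funM.
have e0 x : 0 <= (a * expR (- ((a ^+ 2 - 1) * x ^+ 2 / 2)))%:E.
  by rewrite lee_fin mulr_ge0 ?expR_ge0// ltW.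
rewrite !ge0_integral_normal//; last 2 first.
- exact: emeasurable_funM.
- by move=> x; rewrite mule_ge0.
rewrite (@ge0_integral_affine _ a 0)//; last 3 first.
- by rewrite gt_eqF.
- exact: emeasurable_funM.
- by move=> x; rewrite mule_ge0// lee_fin normal_pdf_ge0.
rewrite -ge0_integralZl//; last 2 first.
- by under eq_fun do rewrite addr0; apply: emeasurable_funM => //;
    apply: (measurableT_comp mphi); exact: measurable_funM.
- by move=> x _; rewrite mule_ge0// lee_fin normal_pdf_ge0.
apply: eq_integral => x _; rewrite addr0 muleC -!muleA; congr (_ * _).
rewrite -!EFinM !std_pdfE gtr0_norm//; congr EFin.
rewrite [RHS]mulrAC -!mulrA [in RHS]mulrCA; congr (_ * _)%R.
rewrite mulrC -expRD; congr (_ * expR _)%R.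
by field.
Qed.

(** The joint density depends on x^2 + y^2 only, so the planar Lebesgue case carries over. *)
Lemma ge0_integral_normal_rotate (c s : R) (f : R * R -> \bar R) :
  (c ^+ 2 + s ^+ 2 = 1)%R -> measurable_fun setT f -> (forall p, 0 <= f p) ->
  \int[N01]_x \int[N01]_y f (c * x - s * y, s * x + c * y)%R =
  \int[N01]_x \int[N01]_y f (x, y).
Proof.
move=> cs mf f0.
have mphi : measurable_fun setT (EFin \o phi).
  by apply/measurable_EFinP; exact: measurable_normal_pdf.
have phi0 x : 0 <= (phi x)%:E by rewrite lee_fin normal_pdf_ge0.
have mpair (g h : R * R -> R) : measurable_fun setT g -> measurable_fun setT h ->
    measurable_fun setT (fun p => f (g p, h p)).
  by move=> mg mh; apply: (measurableT_comp mf); exact: measurable_fun_pair.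
have mfst : measurable_fun [set: R * R] (fun p => p.1) by exact: measurable_fst.
have msnd : measurable_fun [set: R * R] (fun p => p.2) by exact: measurable_snd.
have m1 (g : R * R -> \bar R) x : measurable_fun setT g ->
    measurable_fun setT (fun y => g (x, y)).
  by move=> mg; apply: (measurableT_comp mg); exact: measurable_fun_pair.
have toleb (g : R * R -> \bar R) : measurable_fun setT g -> (forall p, 0 <= g p) ->
    \int[N01]_x \int[N01]_y g (x, y) =
    \int[mu]_x \int[mu]_y (g (x, y) * (phi x * phi y)%:E).
  move=> mg g0; rewrite ge0_integral_normal//; last 2 first.
  - apply: (measurable_ge0_integral2 (fun x y => g (x, y))) => //.
    by rewrite (_ : (fun p => _) = g)//; apply/funext => -[].
  - by move=> x; exact: integral_ge0.
  apply: eq_integral => x _; rewrite ge0_integral_normal//; last exact: m1.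
  rewrite -ge0_integralZr//; last 2 first.
  - by apply: emeasurable_funM => //; exact: m1.
  - by move=> y _; rewrite mule_ge0.
  by apply: eq_integral => y _; rewrite -muleA -EFinM [(phi y * _)%R]mulrC.
pose g p := f p * (phi p.1 * phi p.2)%:E.
have mg : measurable_fun setT g.
  apply: emeasurable_funM => //; apply/measurable_EFinP; apply: measurable_funM.
    by apply: measurableT_comp => //; exact: measurable_normal_pdf.
  by apply: measurableT_comp => //; exact: measurable_normal_pdf.
have g0 p : 0 <= g p by rewrite mule_ge0// lee_fin mulr_ge0// normal_pdf_ge0.
have mfr : measurable_fun setT
    (fun p => f (c * p.1 - s * p.2, s * p.1 + c * p.2)%R).
  by apply: mpair; [apply: measurable_funB|apply: measurable_funD];
    apply: measurable_funM.
rewrite (toleb _ mf f0) (toleb _ mfr (fun=> f0 _)).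
transitivity (\int[mu]_x \int[mu]_y g (c * x - s * y, s * x + c * y)%R).
  apply: eq_integral => x _; apply: eq_integral => y _.
  rewrite /g/= !std_pdfE; congr (_ * EFin _).
  rewrite !mulrA ![(_ * normal_peak 1)%R]mulrC -!mulrA; congr (_ * (_ * _))%R.
  rewrite -!expRD; congr expR.
  have E : ((c * x - s * y) ^+ 2 + (s * x + c * y) ^+ 2 = x ^+ 2 + y ^+ 2)%R.
    rewrite -[RHS]mul1r -cs; ring.
  by transitivity (- ((x ^+ 2 + y ^+ 2) / 2))%R; [field|rewrite -E; field].
exact: ge0_integral_leb_rotate.
Qed.

End StandardNormal.

(** * Gaussian matrices *)

Section MeasurePreserving.
Context {R : realType} {I : eqType}.
Variable mu : {measure set (coordT R I) -> \bar R}.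
Local Open Scope ereal_scope.

Definition preserves (T : coordT R I -> coordT R I) :=
  measurable_fun setT T /\
  forall F : coordT R I -> \bar R, measurable_fun setT F -> (forall z, 0 <= F z) ->
    \int[mu]_z F (T z) = \int[mu]_z F z.

Lemma preserves_id : preserves id.
Proof. by split. Qed.

Lemma preserves_comp T U : preserves T -> preserves U -> preserves (T \o U).
Proof.
move=> [mT pT] [mU pU]; split; first exact: measurableT_comp.
move=> F mF F0.
exact: etrans (pU (F \o T) (measurableT_comp mF mT) (fun=> F0 _)) (pT F mF F0).
Qed.

Definition givens (i j : I) (c s : R) (z : coordT R I) : coordT R I :=
  upd (upd z i (c * z i - s * z j)%R) j (s * z i + c * z j)%R.

Lemma measurable_givens i j c s : measurable_fun setT (givens i j c s).
Proof.
have mi := @measurable_coord R I.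
apply: measurable_to_coord => k; rewrite /givens /upd.
case: (k == j); first by apply: measurable_funD; apply: measurable_funM.
case: (k == i) => //; first by apply: measurable_funB; apply: measurable_funM.
Qed.

(** For a probability on finitely many coordinates this means independent standard normals:
    resampling all of them in turn forgets the point of departure. *)
Definition gaussian := forall k, resamples mu k (@std_normal R).

Hypothesis gmu : gaussian.

Lemma gaussian_pair i j (F : coordT R I -> \bar R) :
  measurable_fun setT F -> (forall z, 0 <= F z) ->
  \int[mu]_z F z = \int[mu]_z \int[std_normal]_x \int[std_normal]_y
    F (upd (upd z i x) j y).
Proof.
move=> mF F0; rewrite (gmu j mF F0) (gmu i)//.
  apply: (measurable_ge0_integral2 (fun (z : coordT R I) (x : R) => F (upd z j x))) => //.
  exact: (measurableT_comp mF (measurable_upd j)).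
by move=> z; exact: integral_ge0.
Qed.

(** Once both entries are resampled, the rotation acts inside a double normal integral. *)
Lemma preserves_givens i j c s : i != j -> (c ^+ 2 + s ^+ 2 = 1)%R ->
  preserves (givens i j c s).
Proof.
move=> ij cs; split; first exact: measurable_givens.
move=> F mF F0.
rewrite (gaussian_pair i j mF F0).
rewrite (gaussian_pair i j (measurableT_comp mF (measurable_givens i j c s)) (fun=> F0 _)).
apply: eq_integral => z _.
pose f (p : R * R) := F (upd (upd z i p.1) j p.2).
have mf : measurable_fun setT f.
  apply: (measurableT_comp mF); apply: measurable_to_coord => k; rewrite /upd.
  case: (k == j); first exact: measurable_snd.
  by case: (k == i) => //; exact: measurable_fst.
rewrite -(ge0_integral_normal_rotate cs mf (fun=> F0 _)).
apply: eq_integral => x _; apply: eq_integral => y _.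
rewrite /f /=; congr F; apply/funext => k; rewrite /givens /upd !eqxx (negbTE ij).
by case: (k == j) => //; case: (k == i).
Qed.

Lemma gaussian_scale k (a : R) (F : coordT R I -> \bar R) : (0 < a)%R ->
  measurable_fun setT F -> (forall z, 0 <= F z) ->
  \int[mu]_z F z = \int[mu]_z
    (F (upd z k (a * z k)%R) * (a * expR (- ((a ^+ 2 - 1) * z k ^+ 2 / 2)))%:E).
Proof.
move=> a0 mF F0; rewrite (gmu k mF F0).
have mk := @measurable_coord R I k.
rewrite [RHS](gmu k).
- apply: eq_integral => z _.
  have mFz : measurable_fun setT (fun x => F (upd z k x)).
    apply: (measurableT_comp mF); apply: measurable_to_coord => l; rewrite /upd.
    by case: (l == k).
  rewrite (ge0_integral_normal_scale a0 mFz (fun=> F0 _)).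
  apply: eq_integral => x _; rewrite /upd eqxx; congr (F _ * _).
  by apply/funext => l; case: (l == k).
- apply: emeasurable_funM.
    apply: (measurableT_comp mF); apply: measurable_to_coord => l; rewrite /upd.
    by case: (l == k); [apply: measurable_funM|exact: measurable_coord].
  apply/measurable_EFinP; apply: measurable_funM => //.
  apply: measurableT_comp => //; apply: measurableT_comp => //.
  by apply: measurable_funM => //; apply: measurable_funM => //; apply: measurable_funX.
- by move=> z; rewrite mule_ge0// lee_fin mulr_ge0 ?expR_ge0// ltW.
Qed.

End MeasurePreserving.

Section GaussianMatrix.
Context {R : realType} {m r : nat}.
Notation I := ('I_m * 'I_r)%type.
Variable mu : {measure set (coordT R I) -> \bar R}.
Hypothesis gmu : gaussian mu.
Local Open Scope ereal_scope.

Definition row2 (i : 'I_m) (z : coordT R I) : R := (\sum_(j < r) z (i, j) ^+ 2)%R.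

Lemma row2_ge0 i z : (0 <= row2 i z)%R.
Proof. by apply: sumr_ge0 => j _; exact: sqr_ge0. Qed.

Lemma measurable_row2 i : measurable_fun setT (row2 i).
Proof.
apply: measurable_sum => j; apply: measurable_funX; exact: measurable_coord.
Qed.

Definition scale_row (i : 'I_m) (a : R) (z : coordT R I) : coordT R I :=
  fun k => if k.1 == i then (a * z k)%R else z k.

(** Interpolates between the identity, n = 0, and [scale_row], n = r, so that entries are scaled one
    at a time. *)
Let scale_first i n a (z : coordT R I) : coordT R I :=
  fun k => if (k.1 == i) && (k.2 < n)%N then (a * z k)%R else z k.

Let measurable_scale_first i n a : measurable_fun setT (scale_first i n a).
Proof.
have mi := @measurable_coord R I.
apply: measurable_to_coord => k; rewrite /scale_first.
by case: (_ && _) => //; apply: measurable_funM.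
Qed.

(** The weight is the Jacobian a^r times the ratio of the Gaussian densities. Both the polar
    coordinates and the tail bound rest on this change of measure. *)
Lemma gaussian_scale_row i (a : R) (F : coordT R I -> \bar R) : (0 < a)%R ->
  measurable_fun setT F -> (forall z, 0 <= F z) ->
  \int[mu]_z F z = \int[mu]_z (F (scale_row i a z) *
    (a ^+ r * expR (- ((a ^+ 2 - 1) * row2 i z / 2)))%:E).
Proof.
move=> a0 mF F0.
pose S n (z : coordT R I) : R := (\sum_(j < r | (j < n)%N) z (i, j) ^+ 2)%R.
pose w n (z : coordT R I) := (a ^+ n * expR (- ((a ^+ 2 - 1) * S n z / 2)))%R.
have mS n : measurable_fun setT (S n).
  have -> : S n = fun z => (\sum_(j < r) if (j < n)%N then z (i, j) ^+ 2 else 0)%R.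
    by apply/funext => z; rewrite /S big_mkcond.
  apply: measurable_sum => j; case: (j < n)%N => //.
  by apply: measurable_funX; exact: measurable_coord.
have mw n : measurable_fun setT (w n).
  apply: measurable_funM => //.
  apply: measurableT_comp => //; apply: measurableT_comp => //.
  by apply: measurable_funM => //; apply: measurable_funM.
have w0 n z : (0 <= w n z)%R by rewrite mulr_ge0 ?expR_ge0// exprn_ge0// ltW.
suff H n : (n <= r)%N -> \int[mu]_z F z =
    \int[mu]_z (F (scale_first i n a z) * (w n z)%:E).
  rewrite (H r (leqnn r)); apply: eq_integral => z _.
  have -> : scale_row i a z = scale_first i r a z.
    by apply/funext => k; rewrite /scale_first ltn_ord andbT.
  have -> : row2 i z = S r z by apply: eq_bigl => j; rewrite ltn_ord.
  by [].
elim: n => [_|n IH nr].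
  apply: eq_integral => z _.
  rewrite /w /S big_pred0// mulr0 mul0r oppr0 expR0 mulr1 expr0 mule1; congr F.
  by apply/funext => k; rewrite /scale_first andbF.
rewrite (IH (ltnW nr)); pose k : I := (i, Ordinal nr).
have mG : measurable_fun setT (fun z => F (scale_first i n a z) * (w n z)%:E).
  by apply: emeasurable_funM; [exact: measurableT_comp|exact/measurable_EFinP].
have G0 z : 0 <= F (scale_first i n a z) * (w n z)%:E.
  by rewrite mule_ge0// lee_fin.
rewrite (gaussian_scale gmu k a0 mG G0).
apply: eq_integral => z _; rewrite -muleA; congr (F _ * _).
  apply/funext => -[i' j]; rewrite /scale_first /upd /k xpair_eqE /=.
  have [->|_] /= := eqVneq i' i; last by [].
  rewrite [in RHS]ltnS [in RHS]leq_eqVlt -val_eqE /=.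
  have [jn|jn] /= := eqVneq (j : nat) n; last by [].
  by rewrite jn ltnn; congr (a * z (_, _))%R; exact: val_inj.
rewrite -EFinM; congr EFin; rewrite /w.
have -> : S n (upd z k (a * z k)%R) = S n z.
  apply: eq_bigr => j jn; rewrite /upd /k xpair_eqE eqxx -val_eqE /=.
  by rewrite ltn_eqF.
have -> : S n.+1 z = (S n z + z k ^+ 2)%R.
  rewrite /S (bigD1 (Ordinal nr))//= addrC; congr (_ + _)%R.
  by apply: eq_bigl => j; rewrite ltnS -val_eqE /= ltn_neqAle andbC.
have -> : expR (- ((a ^+ 2 - 1) * (S n z + z k ^+ 2) / 2)) =
    (expR (- ((a ^+ 2 - 1) * S n z / 2)) * expR (- ((a ^+ 2 - 1) * z k ^+ 2 / 2)))%R.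
  by rewrite -expRD; congr expR; field.
by rewrite (exprSr a n); ring.
Qed.

Definition row_mix (a b : 'I_m) (c s : R) (z : coordT R I) : coordT R I :=
  fun k => if k.1 == a then (c * z (a, k.2) - s * z (b, k.2))%R
           else if k.1 == b then (s * z (a, k.2) + c * z (b, k.2))%R else z k.

(** Rotating two rows is one Givens rotation per column, and these act on disjoint entries. *)
Lemma preserves_row_mix a b c s : a != b -> (c ^+ 2 + s ^+ 2 = 1)%R ->
  preserves mu (row_mix a b c s).
Proof.
move=> ab cs.
pose M n z : coordT R I := fun k : I => if (k.2 < n)%N then row_mix a b c s z k else z k.
suff H n : (n <= r)%N -> preserves mu (M n).
  have := H r (leqnn r); congr preserves; apply/funext => z; apply/funext => k.
  by rewrite /M ltn_ord.
elim: n => [_|n IH nr].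
  by rewrite (_ : M 0%N = id); [exact: preserves_id|apply/funext => z; exact/funext].
have := preserves_comp (preserves_givens gmu (i := (a, Ordinal nr))
  (j := (b, Ordinal nr)) _ cs) (IH (ltnW nr)).
rewrite xpair_eqE negb_and ab => /(_ isT); congr preserves.
apply/funext => z; apply/funext => -[i j].
rewrite /M /row_mix /givens /upd /= !ltnn !xpair_eqE -!(val_eqE j) /= [in RHS]ltnS [in RHS]leq_eqVlt.
have [jn|jn] /= := eqVneq (j : nat) n; last by rewrite !andbF.
have -> : j = Ordinal nr by exact: val_inj.
rewrite !andbT ltnn; have [->|ib] := eqVneq i b; last by [].
by rewrite eq_sym (negbTE ab).
Qed.

(** Pairs 2 l with 2 l + 1. The default of [insubd] is reached only at the last index of an odd
    r. *)
Definition twin (j : 'I_r) : 'I_r := insubd j (if odd j then j.-1 else j.+1).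

(** For even r, multiplication by the imaginary unit when coordinates 2 l and 2 l + 1 are read as
    real and imaginary parts: a vector orthogonal to y, of the same length, computable in linear
    time. *)
Definition Jrow (y : 'I_r -> R) (j : 'I_r) : R :=
  if odd j then y (twin j) else (- y (twin j))%R.

Definition row_rot (i : 'I_m) (c s : R) (z : coordT R I) : coordT R I :=
  fun k => if k.1 == i then (c * z k + s * Jrow (fun j => z (i, j)) k.2)%R
           else z k.

Hypothesis r_even : ~~ odd r.

Lemma val_twin j : twin j = (if odd j then j.-1 else j.+1) :> nat.
Proof.
rewrite /twin val_insubd; case: ifP => // /negbT; rewrite -leqNgt.
case: ifP => jo; first by move=> rj; have := ltn_ord j; rewrite -ltnS; lia.
rewrite leq_eqVlt ltnNge ltn_ord orbF => /eqP rj.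
have : odd r = odd j.+1 by congr odd.
by rewrite /= jo (negbTE r_even).
Qed.

(** One Givens rotation of the same angle in each coordinate pair; as r is even, no coordinate stays
    alone. *)
Lemma preserves_row_rot i c s : (c ^+ 2 + s ^+ 2 = 1)%R ->
  preserves mu (row_rot i c s).
Proof.
move=> cs.
pose M n z : coordT R I := fun k : I => if (k.2 < n.*2)%N then row_rot i c s z k else z k.
suff H n : (n.*2 <= r)%N -> preserves mu (M n).
  have := H r./2; rewrite even_halfK// => /(_ (leqnn r)).
  congr preserves; apply/funext => z; apply/funext => k.
  by rewrite /M even_halfK// ltn_ord.
elim: n => [_|n IH nr].
  by rewrite (_ : M 0%N = id); [exact: preserves_id|apply/funext => z; exact/funext].
have n1r : (n.*2 < r)%N by rewrite (leq_trans _ nr)// doubleS ltnS.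
have n2r : (n.*2.+1 < r)%N by rewrite (leq_trans _ nr)// doubleS.
have := preserves_comp (preserves_givens gmu (i := (i, Ordinal n1r))
  (j := (i, Ordinal n2r)) _ cs) (IH (ltnW n1r)).
rewrite xpair_eqE negb_and eqxx /= -val_eqE /= neq_ltn ltnSn => /(_ isT); congr preserves.
apply/funext => z; apply/funext => -[i' j].
rewrite /M /row_rot /givens /upd /= !ltnn !xpair_eqE -!(val_eqE j) /=.
rewrite [(_.+1 < _)%N]ltnNge leqnSn /=.
have [->|ii'] /= := eqVneq i' i; last by case: ifP; case: ifP.
have [jn|jn] := eqVneq (j : nat) n.*2.+1.
  have -> : (j < n.+1.*2)%N by rewrite jn doubleS ltnS.
  have -> : j = Ordinal n2r by exact: val_inj.
  rewrite /Jrow /= odd_double /= addrC; congr (_ + _ * z (_, _))%R.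
  by apply: ord_inj; rewrite val_twin /= odd_double.
have [jn'|jn'] := eqVneq (j : nat) n.*2.
  have -> : (j < n.+1.*2)%N by rewrite jn' doubleS ltnS ltnW.
  have -> : j = Ordinal n1r by exact: val_inj.
  rewrite /Jrow /= odd_double /= mulrN; congr (_ - _ * z (_, _))%R.
  by apply: ord_inj; rewrite val_twin /= odd_double.
have -> : (j < n.+1.*2)%N = (j < n.*2)%N.
  by rewrite doubleS; move/eqP: jn; move/eqP: jn'; lia.
by [].
Qed.

End GaussianMatrix.

(** * Measurability of real arithmetic *)

Section MeasurableArithmetic.
Context d (T : measurableType d) (R : realType).
Implicit Types f g : T -> R.

(** Inversion is discontinuous at 0; it is expressed by the measurable power function on each
    half-line. *)
Lemma measurable_inv : measurable_fun setT (@GRing.inv R).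
Proof.
rewrite (_ : @GRing.inv R =
  fun x => if 0 <= x then x `^ (- 1) else - ((- x) `^ (- 1))).
  apply: measurable_fun_ifT; first exact: measurable_fun_ler.
    exact: measurable_powR.
  apply: measurableT_comp => //.
  have mN : measurable_fun setT (fun x : R => - x) by exact: oppr_measurable.
  rewrite (_ : (fun x => (- x) `^ (- 1)) = (@powR R ^~ (- 1)) \o (fun x => - x))//.
  by have := measurableT_comp (@measurable_powR R (- 1)) mN; exact.
apply/funext => x; have [x0|x0] := leP 0 x; first by rewrite powR_inv1.
by rewrite powR_inv1 ?oppr_ge0 ?ltW// invrN opprK.
Qed.

Lemma measurable_funV f : measurable_fun setT f ->
  measurable_fun setT (fun x => (f x)^-1).
Proof. exact: measurableT_comp measurable_inv. Qed.

Lemma measurable_fun_sqrt f : measurable_fun setT f ->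
  measurable_fun setT (fun x => Num.sqrt (f x)).
Proof.
move=> mf; suff : measurable_fun setT (@Num.sqrt R) by move/measurableT_comp; apply.
rewrite (_ : @Num.sqrt R = fun x => if 0 <= x then x `^ 2^-1 else 0).
  by apply: measurable_fun_ifT => //; exact: measurable_fun_ler.
apply/funext => x; have [x0|x0] := leP 0 x; first by rewrite powR12_sqrt.
by rewrite ler0_sqrtr// ltW.
Qed.

Lemma measurable_fun_exp f : measurable_fun setT f ->
  measurable_fun setT (fun x => expR (f x)).
Proof. exact: measurableT_comp. Qed.

Lemma measurable_fun_log f : measurable_fun setT f ->
  measurable_fun setT (fun x => ln (f x)).
Proof. by move=> mf; apply: measurableT_comp => //; exact: measurable_ln. Qed.

Lemma measurable_fun_opp f : measurable_fun setT f ->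
  measurable_fun setT (fun x => - f x).
Proof. exact: measurableT_comp. Qed.

Lemma measurable_fun_of_bool (b : T -> bool) : measurable_fun setT b ->
  measurable_fun setT (fun x => (b x)%:R : R).
Proof.
move=> mb; rewrite (_ : (fun x => _) = fun x => if b x then 1 else 0 : R).
  exact: measurable_fun_ifT.
by apply/funext => x; case: (b x).
Qed.

End MeasurableArithmetic.

Ltac meas := first
  [ assumption
  | lazymatch goal with
    | |- measurable_fun _ (fun _ => ?c) => exact: measurable_cst
    | |- measurable_fun _ (fun x => x) => exact: measurable_id
    | |- measurable_fun _ (fun x => x.1) => exact: measurable_fst
    | |- measurable_fun _ (fun x => x.2) => exact: measurable_snd
    | |- measurable_fun _ (fun x => (@?f x - @?g x)%R) =>
        apply: measurable_funB; meas
    | |- measurable_fun _ (fun x => (@?f x + @?g x)%R) =>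
        apply: measurable_funD; meas
    | |- measurable_fun _ (fun x => (- @?f x)%R) =>
        apply: measurable_fun_opp; meas
    | |- measurable_fun _ (fun x => (@?f x * @?g x)%R) =>
        apply: measurable_funM; meas
    | |- measurable_fun _ (fun x => ((@?f x)^-1)%R) =>
        apply: measurable_funV; meas
    | |- measurable_fun _ (fun x => (@?f x ^+ _)%R) =>
        apply: measurable_funX; meas
    | |- measurable_fun _ (fun x => Num.sqrt (@?f x)) =>
        apply: measurable_fun_sqrt; meas
    | |- measurable_fun _ (fun x => expR (@?f x)) =>
        apply: measurable_fun_exp; meas
    | |- measurable_fun _ (fun x => ln (@?f x)) =>
        apply: measurable_fun_log; meas
    | |- measurable_fun _ (fun x => @?b x && @?c x) =>
        apply: measurable_and; meas
    | |- measurable_fun _ (fun x => (@?f x <= @?g x)%R) =>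
        apply: measurable_fun_ler; meas
    | |- measurable_fun _ (fun x => (@?f x < @?g x)%R) =>
        apply: measurable_fun_ltr; meas
    | |- measurable_fun _ (fun x => (nat_of_bool (@?b x))%:R%R) =>
        apply: measurable_fun_of_bool; meas
    | |- measurable_fun _ fst => exact: measurable_fst
    | |- measurable_fun _ snd => exact: measurable_snd
    | |- measurable_fun _ GRing.inv => exact: measurable_inv
    | |- measurable_fun _ (GRing.mul _) => apply: measurable_funM; meas
    | |- measurable_fun _ (Order.le _) => apply: measurable_fun_ler; meas
    | |- measurable_fun _ (Order.lt _) => apply: measurable_fun_ltr; meas
    | _ => first [ exact: measurable_coord
                 | apply: measurable_fun_ifT; meas
                 | idtac ]
    end ].

Lemma integral_leb_itv (R : realType) (a b : R) : a <= b ->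
  (\int[leb]_x ((a <= x <= b)%R%:R)%:E = (b - a)%:E)%E.
Proof.
move=> ab; rewrite (eq_integral (fun x => (\1_(`[a, b]%classic : set R) x)%:E)).
  rewrite integral_indic// setIT.
  transitivity (lebesgue_measure (`[a, b]%classic : set R)); first by [].
  rewrite lebesgue_measure_itv/= lte_fin; case: ltP => // ba.
  by have -> : a = b; [apply/eqP; rewrite eq_le ab|rewrite subrr].
by move=> x _; rewrite indicE mem_setE in_itv.
Qed.

(** * Polar coordinates for a single row *)

Section Polar.
Context {R : realType} {m r : nat}.
Notation I := ('I_m * 'I_r)%type.
Variable mu : probability (coordT R I) R.
Hypothesis gmu : gaussian mu.
Hypothesis r_gt0 : (0 < r)%N.
Variable i : 'I_m.
Local Open Scope ereal_scope.

Definition row_norm (i : 'I_m) (z : coordT R I) : R := Num.sqrt (row2 i z).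
Notation N := (row_norm i).

Lemma measurable_row_norm : measurable_fun setT N.
Proof. apply: measurable_fun_sqrt; exact: measurable_row2. Qed.

Lemma row_norm_ge0 z : (0 <= N z)%R.
Proof. exact: sqrtr_ge0. Qed.

Lemma sqr_row_norm z : (N z ^+ 2 = row2 i z)%R.
Proof. by rewrite sqr_sqrtr ?row2_ge0. Qed.

Lemma row2_scale_row a (z : coordT R I) : row2 i (scale_row i a z) = (a ^+ 2 * row2 i z)%R.
Proof.
rewrite /row2 mulr_sumr; apply: eq_bigr => j _.
by rewrite /scale_row eqxx exprMn.
Qed.

Lemma row_norm_scale_row a z : (0 <= a)%R -> N (scale_row i a z) = (a * N z)%R.
Proof.
by move=> a0; rewrite /row_norm row2_scale_row sqrtrM ?sqr_ge0// sqrtr_sqr ger0_norm.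
Qed.

(** A negative t reverses the row: for t < h, the signed radius t - h denotes the point at radius h
    - t beyond the origin. *)
Definition set_row (t : R) (z : coordT R I) : coordT R I := scale_row i (t / N z) z.

Lemma measurable_scale_row :
  measurable_fun setT (fun p : coordT R I * R => scale_row i p.2 p.1).
Proof.
have m1 k : measurable_fun setT (fun p : coordT R I * R => p.1 k).
  have := measurableT_comp (measurable_coord k) (@measurable_fst _ _ (coordT R I) R).
  exact.
apply: measurable_to_coord => k; rewrite /scale_row.
by case: (k.1 == i); meas; exact: m1.
Qed.

Lemma measurable_set_row :
  measurable_fun setT (fun p : coordT R I * R => set_row p.2 p.1).
Proof.
have mN : measurable_fun setT (fun p : coordT R I * R => N p.1).
  have := measurableT_comp measurable_row_norm (@measurable_fst _ _ (coordT R I) R).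
  exact.
have mp : measurable_fun setT
    (fun p : coordT R I * R => (p.1, (p.2 / N p.1)%R) : coordT R I * R).
  by apply: measurable_fun_pair; meas.
exact: (measurableT_comp measurable_scale_row mp).
Qed.

Definition radial (t : R) : R := (t ^+ r.-1 * expR (- (t ^+ 2 / 2)))%R.

Lemma measurable_radial : measurable_fun setT radial.
Proof. by rewrite /radial; meas. Qed.

Lemma radial_ge0 t : (0 <= t)%R -> (0 <= radial t)%R.
Proof. by move=> t0; rewrite mulr_ge0 ?exprn_ge0 ?expR_ge0. Qed.

(** A row of length 0 has first entry 0, and resampling that entry shows the event to be null. *)
Lemma row_norm_neq0_ae (F : coordT R I -> \bar R) : measurable_fun setT F ->
  (forall z, 0 <= F z) ->
  \int[mu]_z F z = \int[mu]_z (F z * ((0 < N z)%R)%:R%:E).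
Proof.
move=> mF F0; have mN := measurable_row_norm.
have mb : measurable_fun setT (fun z => ((0 < N z)%R)%:R : R) by meas.
apply: ae_eq_integral => //.
  by apply: emeasurable_funM => //; exact/measurable_EFinP.
pose k : I := (i, Ordinal r_gt0).
have mZ : measurable [set z : coordT R I | z k = 0%R].
  have := measurable_coord (R := R) k measurableT (measurable_set1 0%R).
  by rewrite setTI.
exists [set z : coordT R I | z k = 0%R]; split => //.
  rewrite -(setIT [set z | _]) -integral_indic// (gmu k)//; last first.
    by apply/measurable_EFinP; exact: measurable_indic.
  rewrite integral0_eq// => z _.
  rewrite (eq_integral (fun x => (\1_[set 0%R : R] x)%:E)); last first.
    move=> x _; rewrite !indicE.
    suff -> : (upd z k x \in [set w : coordT R I | w k = 0%R]) = (x \in [set 0%R]) by [].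
    by apply/idP/idP; rewrite !in_setE /upd /= eqxx.
  rewrite integral_indic// setIT.
  rewrite /std_normal; have /null_content_dominatesP := normal_prob_dominates (0 : R) 1.
  by apply => //; exact: lebesgue_measure_set1.
move=> z /= H; apply: contrapT => zk; apply: H => _.
suff -> : (0 < N z)%R by rewrite mule1.
rewrite sqrtr_gt0 /row2 (bigD1 (Ordinal r_gt0))//=.
rewrite ltr_pwDl ?sumr_ge0// => [|j _]; last exact: sqr_ge0.
by rewrite exprn_even_gt0//=; apply/eqP.
Qed.

(** On the annulus 1 <= N <= 2 the exponential cancels the Gaussian density of the row and N^-r
    makes the result scale-invariant, which leaves an average over the direction of the row. *)
Definition polar_weight (z : coordT R I) : R :=
  (((1 <= N z <= 2)%R)%:R * expR (N z ^+ 2 / 2) * N z ^- r)%R.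

Lemma measurable_polar_weight : measurable_fun setT polar_weight.
Proof. by have mN := measurable_row_norm; rewrite /polar_weight; meas. Qed.

Lemma polar_weight_ge0 z : (0 <= polar_weight z)%R.
Proof.
by rewrite !mulr_ge0 ?expR_ge0 ?ler0n// invr_ge0 exprn_ge0// row_norm_ge0.
Qed.

(** Its value is ln 2, the da / a mass of the dilations relating a nonzero row to the annulus. It
    will be cancelled, hence the lemmas on its positivity and finiteness. *)
Definition polar_const : \bar R :=
  \int[@leb R]_b ((2^-1 <= b <= 1)%R%:R * b^-1)%R%:E.

Lemma polar_const_gt0 : 0 < polar_const.
Proof.
apply: (@lt_le_trans _ _ (\int[@leb R]_b ((2^-1 <= b <= 1)%R%:R)%:E)).
  by rewrite integral_leb_itv ?lte_fin; lra.
apply: ge0_le_integral => //.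
- by apply/measurable_EFinP; meas.
- by apply/measurable_EFinP; meas.
- move=> b _; rewrite lee_fin; case: (boolP (2^-1 <= b <= 1)%R) => [/andP[b2 b1]|_].
    by rewrite mul1r invf_ge1//; lra.
  by rewrite mul0r.
Qed.

Lemma polar_const_fin : polar_const \is a fin_num.
Proof.
rewrite ge0_fin_numE ?ltW ?polar_const_gt0//.
apply: (@le_lt_trans _ _ (\int[@leb R]_b (2%:E * ((2^-1 <= b <= 1)%R%:R)%:E))).
  apply: ge0_le_integral => //.
  - move=> b _; rewrite lee_fin; case: (boolP (2^-1 <= b <= 1)%R) => [/andP[b2 b1]|_].
      by rewrite mul1r invr_ge0; lra.
    by rewrite mul0r.
  - by apply/measurable_EFinP; meas.
  - by apply: emeasurable_funM => //; apply/measurable_EFinP; meas.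
  - move=> b _; rewrite -EFinM lee_fin; case: (boolP (2^-1 <= b <= 1)%R) => [/andP[b2 b1]|_].
      by rewrite mul1r mulr1 -[leRHS]invrK lef_pV2// ?posrE; lra.
    by rewrite mul0r mulr0.
have mI : measurable_fun setT (fun b : R => ((2^-1 <= b <= 1)%R%:R : R)%:E).
  by apply/measurable_EFinP; meas.
rewrite (ge0_integralZl _ measurableT mI)//.
by rewrite integral_leb_itv; [rewrite -EFinM ltry|lra].
Qed.

Let annulus (t : R) : R := ((1 <= t <= 2)%R)%:R.

Let m_norm1 : measurable_fun setT (fun p : coordT R I * R => N p.1).
Proof.
have := measurableT_comp measurable_row_norm (@measurable_fst _ _ (coordT R I) R).
exact.
Qed.

Let m_fst (G : coordT R I -> \bar R) : measurable_fun setT G ->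
  measurable_fun setT (fun p : coordT R I * R => G p.1).
Proof.
move=> mG; have := measurableT_comp mG (@measurable_fst _ _ (coordT R I) R).
exact.
Qed.

(** Invariance of da / a: substituting a = b [N z] removes the dependence on the length. *)
Let dilation_mass z :
  \int[@leb R]_a ((0 < a)%R%:R * annulus (N z / a) / a)%:E =
  ((0 < N z)%R)%:R%:E * polar_const.
Proof.
have [N0|] := ltP 0%R (N z); last first.
  move=> N0; have -> : N z = 0%R by apply/eqP; rewrite eq_le N0 row_norm_ge0.
  rewrite mul0e integral0_eq// => a _.
  by rewrite mul0r /annulus ler10 /= mulr0 mul0r.
rewrite mul1e.
have mg : measurable_fun setT
    (fun a : R => ((0 < a)%R%:R * annulus (N z / a) / a)%:E).
  by apply/measurable_EFinP; rewrite /annulus; meas.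
have g0 a : 0 <= ((0 < a)%R%:R * annulus (N z / a) / a)%:E.
  rewrite lee_fin; case: (ltP 0%R a) => a0; last by rewrite !mul0r.
  by rewrite !mulr_ge0 ?ler0n// invr_ge0 ltW.
have Nn0 : N z != 0%R by rewrite gt_eqF.
rewrite (ge0_integral_affine 0 Nn0 mg g0) -ge0_integralZl//; last 1 first.
  by under eq_fun do rewrite addr0; apply/measurable_EFinP; rewrite /annulus; meas.
apply: eq_integral => b _; rewrite addr0 gtr0_norm// -EFinM; congr EFin.
rewrite pmulr_rgt0//; have [b0|b0] := ltP 0%R b; last first.
  rewrite !mul0r mulr0; suff -> : (2^-1 <= b <= 1)%R = false by rewrite mul0r.
  by apply/negbTE; rewrite negb_and -ltNge (le_lt_trans b0)// invr_gt0.
have -> : (N z / (N z * b) = b^-1)%R by field; rewrite Nn0 gt_eqF.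
have -> : (2^-1 <= b <= 1)%R = (1 <= b^-1 <= 2)%R.
  by rewrite andbC invf_ge1// -[(b^-1 <= 2)%R](@lef_pV2 R) ?posrE ?invr_gt0// invrK.
have HA (A : R) : (N z * (A / (N z * b)) = A / b)%R by field; rewrite Nn0 gt_eqF.
by rewrite /annulus mul1r HA.
Qed.

(** Insert the dilation mass, exchange the integrals, rescale the row by a under the Gaussian law,
    then substitute a = t / [N z]. Radius and direction separate without a measure on the sphere. *)
Lemma polar (H : coordT R I -> \bar R) : measurable_fun setT H ->
  (forall z, 0 <= H z) ->
  polar_const * \int[mu]_z H z =
  \int[@leb R]_t (((0 < t)%R%:R * radial t)%:E *
    \int[mu]_z (H (set_row t z) * (polar_weight z)%:E)).
Proof.
move=> mH H0; have mN := measurable_row_norm; have mr2 := measurable_row2 (R := R) (r := r) i.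
have cfin := polar_const_fin.
have c0 : 0 <= polar_const by rewrite ltW// polar_const_gt0.
pose T1 z a := H z * ((0 < a)%R%:R * annulus (N z / a) / a)%:E.
pose T2 z a := H (scale_row i a z) * (((0 < a)%R%:R * annulus (N z) / a) *
  (a ^+ r * expR (- ((a ^+ 2 - 1) * row2 i z / 2))))%:E.
pose T3 z t := (((0 < t)%R%:R * radial t)%:E *
  (H (set_row t z) * (polar_weight z)%:E)).
have pre0 z a : 0 <= ((0 < a)%R%:R * annulus (N z / a) / a)%:E.
  rewrite lee_fin; case: (ltP 0%R a) => a0; last by rewrite !mul0r.
  by rewrite !mulr_ge0 ?ler0n// invr_ge0 ltW.
have T10 z a : 0 <= T1 z a by rewrite mule_ge0.
have T20 z a : 0 <= T2 z a.
  rewrite mule_ge0// lee_fin; case: (ltP 0%R a) => a0; last by rewrite !mul0r.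
  by rewrite !mulr_ge0 ?ler0n ?expR_ge0 ?exprn_ge0 ?invr_ge0 ?ltW.
have T30 z t : 0 <= T3 z t.
  rewrite !mule_ge0 ?lee_fin ?polar_weight_ge0//.
  case: (ltP 0%R t) => t0; last by rewrite mul0r.
  by rewrite mul1r radial_ge0// ltW.
have mT1 : measurable_fun setT (fun p : coordT R I * R => T1 p.1 p.2).
  apply: emeasurable_funM; first exact: m_fst.
  by apply/measurable_EFinP; rewrite /annulus; meas.
have mr21 : measurable_fun setT (fun p : coordT R I * R => row2 i p.1).
  have := measurableT_comp mr2 (@measurable_fst _ _ (coordT R I) R).
  exact.
have mw1 : measurable_fun setT (fun p : coordT R I * R => polar_weight p.1).
  have := measurableT_comp measurable_polar_weight (@measurable_fst _ _ (coordT R I) R).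
  exact.
have mT2 : measurable_fun setT (fun p : coordT R I * R => T2 p.1 p.2).
  apply: emeasurable_funM; first exact: (measurableT_comp mH measurable_scale_row).
  by apply/measurable_EFinP; rewrite /annulus; meas.
have mT3 : measurable_fun setT (fun p : coordT R I * R => T3 p.1 p.2).
  apply: emeasurable_funM; first by apply/measurable_EFinP; rewrite /radial; meas.
  apply: emeasurable_funM; first exact: (measurableT_comp mH measurable_set_row).
  exact/measurable_EFinP.
have mHw t : measurable_fun setT (fun z => H (set_row t z) * (polar_weight z)%:E).
  apply: emeasurable_funM; last by apply/measurable_EFinP; exact: measurable_polar_weight.
  have mp : measurable_fun setT (fun z : coordT R I => (z, t) : coordT R I * R).
    exact: measurable_fun_pair.
  exact: (measurableT_comp mH (measurableT_comp measurable_set_row mp)).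
transitivity (\int[mu]_z \int[@leb R]_a T1 z a).
  have mH1 : measurable_fun setT (fun z => H z * ((0 < N z)%R)%:R%:E).
    by apply: emeasurable_funM => //; apply/measurable_EFinP; meas.
  rewrite (row_norm_neq0_ae mH H0) -(ge0_integralZl _ measurableT mH1)//; last first.
    by move=> z _; rewrite mule_ge0// lee_fin ler0n.
  apply: eq_integral => z _; rewrite /T1 ge0_integralZl//; last first.
    by apply/measurable_EFinP; rewrite /annulus; meas.
  by rewrite dilation_mass muleCA [polar_const * _]muleC.
rewrite (ge0_integral_swap T1 mT1 T10).
transitivity (\int[@leb R]_a \int[mu]_z T2 z a).
  apply: eq_integral => a _; have [a0|a0] := ltP 0%R a; last first.
    rewrite !integral0_eq// => z _.
      by rewrite /T2 ltNge a0 !mul0r mule0.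
    by rewrite /T1 ltNge a0 !mul0r mule0.
  have mT1a : measurable_fun setT (fun z => T1 z a).
    apply: emeasurable_funM => //.
    by apply/measurable_EFinP; rewrite /annulus; meas.
  rewrite (gaussian_scale_row gmu i a0 mT1a (fun=> T10 _ _)).
  apply: eq_integral => z _; rewrite /T1 /T2 -muleA -EFinM.
  by rewrite row_norm_scale_row ?ltW// [(a * N z)%R]mulrC mulfK ?gt_eqF.
rewrite -(ge0_integral_swap T2 mT2 T20).
transitivity (\int[mu]_z \int[@leb R]_t T3 z t).
  apply: eq_integral => z _.
  have [N0|] := ltP 0%R (N z); last first.
    move=> N0; have Nz : N z = 0%R by apply/eqP; rewrite eq_le N0 row_norm_ge0.
    rewrite !integral0_eq// => t _.
      by rewrite /T3 /polar_weight Nz ler10 /= !mul0r !mule0.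
    by rewrite /T2 /annulus Nz ler10 /= mulr0 !mul0r mule0.
  have mT2z : measurable_fun setT (T2 z).
    have mp : measurable_fun setT (fun t : R => (z, t) : coordT R I * R).
      exact: measurable_fun_pair.
    by have := measurableT_comp mT2 mp; exact.
  have Ni : ((N z)^-1 != 0)%R by rewrite invr_eq0 gt_eqF.
  rewrite (ge0_integral_affine 0 Ni mT2z (T20 z)) -ge0_integralZl//; last first.
    apply: (measurableT_comp mT2z); meas.
  apply: eq_integral => t _.
  rewrite addr0 /T2 /T3 /set_row [(_^-1 * t)%R]mulrC muleCA [RHS]muleCA.
  congr (_ * _); rewrite -!EFinM; congr EFin.
  rewrite gtr0_norm ?invr_gt0// pmulr_lgt0 ?invr_gt0//.
  have [t0|t0] := ltP 0%R t; last by rewrite !mul0r mulr0.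
  rewrite /radial /polar_weight /annulus -sqr_row_norm !mul1r.
  have -> : expR (- (((t / N z) ^+ 2 - 1) * N z ^+ 2 / 2)) =
      (expR (N z ^+ 2 / 2) * expR (- (t ^+ 2 / 2)))%R.
    by rewrite -expRD; congr expR; field; rewrite gt_eqF.
  have HK (x n k e1 e2 : R) l : (x != 0 -> n != 0 ->
      n^-1 * (k / (x / n) * ((x / n) ^+ l.+1 * (e1 * e2))) =
      x ^+ l * e2 * (k * e1 * n ^- l.+1))%R.
    move=> x0 n0; rewrite expr_div_n !exprS.
    have nl0 : (n ^+ l != 0)%R by rewrite expf_neq0.
    by field; rewrite x0 n0 nl0.
  have := HK t (N z) ((1 <= N z <= 2)%R)%:R (expR (N z ^+ 2 / 2))
    (expR (- (t ^+ 2 / 2))) r.-1.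
  by rewrite prednK//; apply; rewrite gt_eqF.
rewrite (ge0_integral_swap T3 mT3 T30); apply: eq_integral => t _.
by rewrite /T3 ge0_integralZl// => [z _|];
  [rewrite mule_ge0// lee_fin polar_weight_ge0
  |rewrite lee_fin; case: (ltP 0%R t) => t0; rewrite ?mul0r// mul1r radial_ge0// ltW].
Qed.

End Polar.

(** * The step on one row *)

Section Pade.
Context {R : realType}.

(** This is artanh y >= y multiplied out, which also makes sense for y >= 1. The difference of the
    sides vanishes at 0 and has derivative y (e^y - e^-y). *)
Lemma expR_pade (y : R) : 0 <= y -> (1 - y) * expR y <= (1 + y) * expR (- y).
Proof.
move=> y0.
pose f : R -> R := (cst 1 + id) * (expR \o -%R) - (cst 1 - id) * expR.
have df (x : R) : is_derive x (1 : R) f (x * (expR x - expR (- x))).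
  apply: is_derive_eq; rewrite /GRing.scale /= ?fctE /=.
  ring.
have fE z : f z = (1 + z) * expR (- z) - (1 - z) * expR z by [].
have f0 : f 0 = 0 by rewrite fE oppr0 expR0; ring.
suff : f 0 <= f y by rewrite f0 fE subr_ge0.
apply: (@ger0_derive1_le_cc _ f 0 y) => //.
- move=> x; rewrite in_itv/= => /andP[x0 _]; rewrite derive1E derive_val.
  by apply: mulr_ge0; [exact: ltW|rewrite subr_ge0 ler_expR; lra].
- apply: derivable_within_continuous => x _; exact: ex_derive.
- by rewrite in_itv/= lexx.
- by rewrite in_itv/= lexx y0.
Qed.

(** With y = (2t - h) / h the ratio (h - t) / t is (1 - y) / (1 + y), whose logarithm is -2 artanh
    y. *)
Lemma ln_ratio_le (h t : R) : 0 < h -> h <= 2 * t -> t < h ->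
  ln ((h - t) / t) <= - 2 * ((2 * t - h) / h).
Proof.
move=> h0 ht th; have t0 : 0 < t by lra.
rewrite -ler_expR lnK ?posrE ?divr_gt0 ?subr_gt0//.
set y := (2 * t - h) / h.
have y0 : 0 <= y by apply: divr_ge0; [lra|exact: ltW].
have := expR_pade y0.
have -> : 1 - y = 2 * (h - t) / h by rewrite /y; field; rewrite gt_eqF.
have -> : 1 + y = 2 * t / h by rewrite /y; field; rewrite gt_eqF.
have -> : - 2 * y = - y - y by ring.
rewrite expRD expRN => H.
have e0 := expR_gt0 y; rewrite ler_pdivrMr// mulrAC ler_pdivlMr//.
have {}H : 2 * (h - t) * expR y <= 2 * t / expR y.
  have := ler_wpM2r (ltW h0) H; rewrite [leLHS]mulrAC [leRHS]mulrAC.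
  by rewrite !divfK ?gt_eqF//; lra.
rewrite [leRHS]mulrC; lra.
Qed.

End Pade.

Section UniformThreshold.
Context {R : realType}.
Local Open Scope ereal_scope.

Lemma integral_uniform_threshold (q : R) (a b : \bar R) : (0 <= q <= 1)%R ->
  0 <= a -> 0 <= b ->
  \int[std_uniform]_u (if (u <= q)%R then a else b) = q%:E * a + (1 - q)%:E * b.
Proof.
move=> /andP[q0 q1] a0 b0.
have mI : measurable (`]-oo, q]%classic : set R) by exact: measurable_itv.
have uq : std_uniform (`]-oo, q]%classic : set R) = q%:E.
  rewrite /std_uniform /uniform_prob integral_uniform_pdf.
  have -> : `]-oo, q] `&` `[0%R, 1%R] = `[0%R, q]%classic :> set R.
    apply/seteqP; split => x /=; rewrite !in_itv/=.
      by move=> [xq /andP[-> _]].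
    by move=> /andP[x0 xq]; rewrite xq x0 (le_trans xq).
  rewrite (eq_integral (fun=> 1%E)).
    rewrite integral_cst//= mul1e lebesgue_measure_itv/= lte_fin oppr0 adde0.
    by case: ltP => // q00; have -> : q = 0%R by apply/eqP; rewrite eq_le q00.
  move=> x; rewrite inE/= in_itv/= => /andP[x0 xq].
  by rewrite /uniform_pdf x0 (le_trans xq)//= subr0 invr1.
have uqC : std_uniform (~` `]-oo, q]%classic : set R) = (1 - q)%:E.
  by have := probability_setC std_uniform mI; rewrite [X in _ = 1 - X](_ : _ = q%:E).
rewrite (eq_integral (fun u => a * (\1_(`]-oo, q]%classic : set R) u)%:E +
    b * (\1_(~` `]-oo, q]%classic : set R) u)%:E)); last first.
  move=> u _; rewrite !indicE in_setC mem_setE in_itv/=.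
  by case: ifP => _; rewrite ?mule1 ?mule0 ?adde0 ?add0e.
rewrite ge0_integralD//; last 4 first.
- by move=> u _; rewrite mule_ge0// lee_fin.
- by apply: emeasurable_funM => //; apply/measurable_EFinP; exact: measurable_indic.
- by move=> u _; rewrite mule_ge0// lee_fin.
- apply: emeasurable_funM => //; apply/measurable_EFinP; apply: measurable_indic.
  exact: measurableC.
have m1 : measurable_fun setT (fun u => (\1_(`]-oo, q]%classic : set R) u : R)%:E).
  by apply/measurable_EFinP; exact: measurable_indic.
have m2 : measurable_fun setT (fun u => (\1_(~` `]-oo, q]%classic : set R) u : R)%:E).
  by apply/measurable_EFinP; apply: measurable_indic; exact: measurableC.
rewrite (ge0_integralZl _ measurableT m1)//.
rewrite (ge0_integralZl _ measurableT m2)//.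
rewrite !integral_indic//; last exact: measurableC.
rewrite !setIT; rewrite -[q%:E]uq -[(1 - q)%:E]uqC muleC [b * _]muleC; exact: erefl.
Qed.

End UniformThreshold.

(** * The complex structure as an isometry *)

Section Jrow.
Context {R : realType} {r : nat}.
Hypothesis r_even : ~~ odd r.
Implicit Types y : 'I_r -> R.

Lemma odd_twin (j : 'I_r) : odd (twin j) = ~~ odd j.
Proof.
rewrite val_twin//; case jo: (odd j) => /=; last by rewrite jo.
have : odd j.-1.+1 by rewrite prednK ?odd_gt0.
by rewrite /= => /negbTE.
Qed.

Lemma twinK : involutive (@twin r).
Proof.
move=> j; apply: ord_inj; rewrite val_twin// odd_twin val_twin//.
by case jo: (odd j) => //=; rewrite prednK ?odd_gt0.
Qed.

(** Exchanging twins changes the sign of every term, so the sum is its own opposite. *)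
Lemma sum_mul_Jrow y : \sum_(j < r) y j * Jrow y j = 0.
Proof.
have H : \sum_(j < r) y j * Jrow y j = - \sum_(j < r) y j * Jrow y j.
  rewrite [LHS](reindex_inj (inv_inj twinK)) -sumrN; apply: eq_bigr => j _.
  by rewrite /Jrow odd_twin twinK; case: (odd j) => /=; ring.
by move: H; set S := \sum_(j < r) _; lra.
Qed.

Lemma sum_sqr_Jrow y : \sum_(j < r) Jrow y j ^+ 2 = \sum_(j < r) y j ^+ 2.
Proof.
rewrite [RHS](reindex_inj (inv_inj twinK)); apply: eq_bigr => j _.
by rewrite /Jrow; case: ifP; rewrite ?sqrrN.
Qed.

Lemma sum_sqr_mixed_Jrow y a b :
  \sum_(j < r) (a * y j + b * Jrow y j) ^+ 2 =
  (a ^+ 2 + b ^+ 2) * \sum_(j < r) y j ^+ 2.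
Proof.
transitivity (a ^+ 2 * \sum_(j < r) y j ^+ 2 +
    a * b *+ 2 * \sum_(j < r) y j * Jrow y j + b ^+ 2 * \sum_(j < r) Jrow y j ^+ 2).
  by rewrite !mulr_sumr -!big_split; apply: eq_bigr => j _ /=; ring.
by rewrite sum_mul_Jrow sum_sqr_Jrow mulr0 addr0 mulrDl.
Qed.

End Jrow.

(** * The transition of a single row *)

Section RowKernel.
Context {R : realType} {m r : nat}.
Notation I := ('I_m * 'I_r)%type.

(* [accept h t] is the ratio of the radial densities at [h - t] and [t]. *)
Definition accept (h t : R) : R :=
  expR (r.-1%:R * ln ((h - t) / t) + (t ^+ 2 - (h - t) ^+ 2) / 2).

(* A negative argument makes [Num.sqrt] return [0], which is the intended value
   for [t <= h / 2]: such points always move through the origin. *)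
Definition swing (h t u : R) : R :=
  Num.sqrt (if (t < h) && (u <= accept h t) then 0 else 1 - h ^+ 2 / (4 * t ^+ 2)).

(** [pull] and [swing] are the components of the output direction along y / |y| and J y / |y|. A
    move by h changes the squared radius to t^2 + 2 h t [pull] + h^2, so staying on the sphere means
    [pull] = - h / (2t); [swing] = 0 gives [pull] = -1, the move through the origin. *)
Definition pull (h t u : R) : R := - Num.sqrt (1 - swing h t u ^+ 2).

Lemma swing_sqr_le1 h t u : swing h t u ^+ 2 <= 1.
Proof.
rewrite /swing; case: ifP => _; first by rewrite sqrtr0 expr0n/= ler01.
have [H|H] := leP 0 (1 - h ^+ 2 / (4 * t ^+ 2)); last first.
  by rewrite ltr0_sqrtr// expr0n/= ler01.
rewrite sqr_sqrtr// gerBl; apply: divr_ge0; first exact: sqr_ge0.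
by apply: mulr_ge0; [exact: ler0n|exact: sqr_ge0].
Qed.

Lemma pull_swing h t u : pull h t u ^+ 2 + swing h t u ^+ 2 = 1.
Proof. by rewrite sqrrN sqr_sqrtr ?subr_ge0 ?swing_sqr_le1// subrK. Qed.

Lemma accept_radial (h t : R) : 0 < t -> t < h ->
  accept h t * radial (r := r) t = radial (r := r) (h - t).
Proof.
move=> t0 th; rewrite /accept expRD expRM_natl lnK ?posrE ?divr_gt0 ?subr_gt0//.
rewrite /radial expr_div_n mulrACA divfK ?expf_neq0 ?gt_eqF// -expRD.
by congr (_ * expR _); field.
Qed.

(** With y = (2t - h) / h, the logarithm of the ratio of the densities is at most - 2 (r - 1) y +
    h^2 y / 2, which the bound on h^2 makes nonpositive. *)
Lemma radial_le (h t : R) : 0 < h -> h ^+ 2 <= 4 * r.-1%:R -> h <= 2 * t -> t < h ->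
  radial (r := r) (h - t) <= radial (r := r) t.
Proof.
move=> h0 hr ht th; have t0 : 0 < t by lra.
rewrite -accept_radial//; apply: ler_piMl; first by apply: radial_ge0; exact: ltW.
rewrite -[leRHS]expR0 ler_expR.
have H := ln_ratio_le h0 ht th.
have := ler_wpM2l (ler0n R r.-1) H.
set y := (2 * t - h) / h => {}H.
have y0 : 0 <= y by apply: divr_ge0; [lra|exact: ltW].
have E : t ^+ 2 - (h - t) ^+ 2 = h ^+ 2 * y by rewrite /y; field; rewrite gt_eqF.
have := ler_wpM2r y0 hr; rewrite E; lra.
Qed.

Lemma accept_le1 (h t : R) : 0 < h -> h ^+ 2 <= 4 * r.-1%:R -> h <= 2 * t -> t < h ->
  accept h t <= 1.
Proof.
move=> h0 hr ht th; have t0 : 0 < t by lra.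
have := radial_le h0 hr ht th; rewrite -accept_radial// ger_pMl//.
by rewrite /radial mulr_gt0 ?exprn_gt0 ?expR_gt0.
Qed.

Lemma accept_ge0 h t : 0 <= accept h t.
Proof. exact: expR_ge0. Qed.

Variable i : 'I_m.
Notation N := (row_norm i).

(** Here u is the uniform sample that decides between the two moves; the direction is the quotient
    by [N z]. *)
Definition row_step (h u : R) (z : coordT R I) : coordT R I :=
  fun k => if k.1 == i
    then z k + h * ((pull h (N z) u * z k +
                     swing h (N z) u * Jrow (fun j => z (i, j)) k.2) / N z)
    else z k.

(* Mass exchanged between the radii [t] and [h - t]. *)
Definition exchange (h t : R) : R :=
  if (0 < t) && (t < h) then Num.min (radial (r := r) t) (radial (r := r) (h - t)) else 0.

Lemma exchange_sym h t : exchange h (h - t) = exchange h t.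
Proof.
have E : h - (h - t) = t by ring.
by rewrite /exchange E minC subr_gt0 gtrBl andbC.
Qed.

Lemma exchange_ge0 h t : 0 <= exchange h t.
Proof.
rewrite /exchange; case: ifP => // /andP[t0 th].
by rewrite le_min !radial_ge0// ?subr_ge0 ltW.
Qed.

Lemma exchange_le h t : exchange h t <= (0 < t)%R%:R * radial (r := r) t.
Proof.
rewrite /exchange; case: (ltP 0 t) => t0 /=; last by rewrite mul0r.
by rewrite mul1r; case: ifP => _; rewrite ?ge_min ?lexx// radial_ge0// ltW.
Qed.

(** The angle subtended by a chord of length h in a circle of radius t. For h > 2t there is no such
    chord; the identity is then a placeholder, given mass 0 in [row_step_average]. *)
Definition rot_cos (h t : R) : R := if h <= 2 * t then 1 - h ^+ 2 / (2 * t ^+ 2) else 1.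
Definition rot_sin (h t : R) : R :=
  if h <= 2 * t then h / t * Num.sqrt (1 - h ^+ 2 / (4 * t ^+ 2)) else 0.

Lemma chord_ge0 (h t : R) : 0 < h -> 0 < t -> h <= 2 * t ->
  0 <= 1 - h ^+ 2 / (4 * t ^+ 2).
Proof.
move=> h0 t0 ht; rewrite subr_ge0 ler_pdivrMr ?mul1r ?mulr_gt0 ?exprn_gt0//.
have -> : 4 * t ^+ 2 = (2 * t) ^+ 2 by ring.
by rewrite lerXn2r// ?nnegrE; lra.
Qed.

Lemma rot_cos_sin h t : 0 < h -> 0 < t -> rot_cos h t ^+ 2 + rot_sin h t ^+ 2 = 1.
Proof.
move=> h0 t0; rewrite /rot_cos /rot_sin; case: ifP => ht; last by ring.
rewrite exprMn sqr_sqrtr ?chord_ge0//.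
by field; rewrite gt_eqF.
Qed.

Lemma row2_mixed (c s : R) (z : coordT R I) : ~~ odd r ->
  row2 i (row_rot i c s z) = (c ^+ 2 + s ^+ 2) * row2 i z.
Proof.
move=> re; rewrite /row2 -(sum_sqr_mixed_Jrow re (fun j => z (i, j))).
by apply: eq_bigr => j _; rewrite /row_rot eqxx.
Qed.

Lemma set_row_rot c s t (z : coordT R I) : ~~ odd r -> c ^+ 2 + s ^+ 2 = 1 ->
  set_row i t (row_rot i c s z) = row_rot i c s (set_row i t z).
Proof.
move=> re cs; rewrite /set_row /row_norm row2_mixed// cs mul1r.
apply/funext => k; rewrite /scale_row /row_rot; case: eqP => // _.
by rewrite /Jrow /= !eqxx; case: ifP => _; ring.
Qed.

Lemma polar_weight_rot c s (z : coordT R I) : ~~ odd r -> c ^+ 2 + s ^+ 2 = 1 ->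
  polar_weight i (row_rot i c s z) = polar_weight i z.
Proof. by move=> re cs; rewrite /polar_weight /row_norm row2_mixed// cs mul1r. Qed.

Lemma row_norm_set_row t (z : coordT R I) : 0 <= t -> 0 < N z -> N (set_row i t z) = t.
Proof.
move=> t0 N0; have H : 0 <= t / N z by apply: divr_ge0; [|exact: ltW].
by rewrite /set_row row_norm_scale_row// divfK ?gt_eqF.
Qed.

Lemma row_step_reflect h u t (z : coordT R I) : 0 < t -> 0 < N z ->
  swing h t u = 0 -> row_step h u (set_row i t z) = set_row i (t - h) z.
Proof.
move=> t0 N0 sw; apply/funext => k; rewrite /row_step row_norm_set_row ?ltW//.
rewrite /pull sw /set_row /scale_row; case: eqP => // _.
by rewrite expr0n/= subr0 sqrtr1; field; rewrite !gt_eqF.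
Qed.

Lemma row_step_rotate h u t (z : coordT R I) : 0 < h -> 0 < t -> 0 < N z -> h <= 2 * t ->
  swing h t u = Num.sqrt (1 - h ^+ 2 / (4 * t ^+ 2)) ->
  row_step h u (set_row i t z) = row_rot i (rot_cos h t) (rot_sin h t) (set_row i t z).
Proof.
move=> h0 t0 N0 ht sw; apply/funext => k; rewrite /row_step row_norm_set_row ?ltW//.
have E : Num.sqrt (1 - Num.sqrt (1 - h ^+ 2 / (4 * t ^+ 2)) ^+ 2) = h / (2 * t).
  rewrite sqr_sqrtr ?chord_ge0// opprB addrC subrK.
  have -> : h ^+ 2 / (4 * t ^+ 2) = (h / (2 * t)) ^+ 2 by field; rewrite gt_eqF.
  by rewrite sqrtr_sqr ger0_norm// divr_ge0 ?mulr_ge0 ?ltW.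
rewrite /pull sw E /row_rot /rot_cos /rot_sin ht; case: eqP => // _.
by field; rewrite gt_eqF.
Qed.

End RowKernel.

(** * Invariance of the Gaussian law under the row transition *)

Section RowKernelLaw.
Context {R : realType} {m r : nat}.
Notation I := ('I_m * 'I_r)%type.
Variable mu : probability (coordT R I) R.
Hypothesis gmu : gaussian mu.
Hypotheses (r_gt0 : (0 < r)%N) (r_even : ~~ odd r).
Variable i : 'I_m.
Notation N := (row_norm i).
Notation radial := (@radial R r).
Notation exchange := (@exchange R r).
Notation swing := (@swing R r).
Notation accept := (@accept R r).
Local Open Scope ereal_scope.

Let integral_uniform_cst (x : \bar R) : \int[@std_uniform R]_u x = x.
Proof.
rewrite integral_cst//= [X in _ * X](_ : _ = 1) ?mule1//.
exact: (probability_setT (@std_uniform R)).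
Qed.

(** The mass p(t) splits into [exchange h t], sent to signed radius t - h, and the rest, which is
    rotated. The exchanged part is 0 for t >= h, p(h - t) on [h/2, h), and all of p(t) below h/2. *)
Lemma row_step_average (F : coordT R I -> \bar R) (h t : R) z :
  (forall z, 0 <= F z) ->
  (0 < h)%R -> (h ^+ 2 <= 4 * r.-1%:R)%R -> (0 < t)%R -> (0 < N z)%R ->
  (radial t)%:E * \int[@std_uniform R]_u F (row_step i h u (set_row i t z)) =
  (exchange h t)%:E * F (set_row i (t - h) z) +
  (radial t - exchange h t)%:E *
    F (row_rot i (rot_cos h t) (rot_sin h t) (set_row i t z)).
Proof.
move=> F0 h0 hr t0 N0.
have [ht|th] := leP h t.
  have h2t : (h <= 2 * t)%R by lra.
  rewrite {1 2}/exchange t0 /= ltNge ht /= mul0e add0e subr0; congr (_ * _).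
  rewrite -[RHS]integral_uniform_cst; apply: eq_integral => u _; congr F.
  by apply: row_step_rotate => //; rewrite /swing ltNge ht.
have [h2t|t2h] := leP h (2 * t)%R.
  have rle := radial_le h0 hr h2t th.
  have -> : exchange h t = radial (h - t)%R.
    by rewrite /exchange t0 th /=; exact/min_idPr.
  pose A := F (set_row i (t - h) z).
  pose B := F (row_rot i (rot_cos h t) (rot_sin h t) (set_row i t z)).
  rewrite (eq_integral (fun u : R => if (u <= accept h t)%R then A else B)); last first.
    move=> u _; case: ifP => uq.
      by congr F; apply: row_step_reflect => //; rewrite /swing th uq /= sqrtr0.
    by congr F; apply: row_step_rotate => //; rewrite /swing th uq.
  have q01 : (0 <= accept h t <= 1)%R by rewrite accept_ge0 accept_le1.
  rewrite (integral_uniform_threshold q01 (F0 _) (F0 _)) ge0_muleDr; last 2 first.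
  - by rewrite mule_ge0// lee_fin accept_ge0.
  - by rewrite mule_ge0// lee_fin subr_ge0; case/andP: q01.
  rewrite !muleA -!EFinM -accept_radial// [(radial t * accept h t)%R]mulrC.
  by rewrite mulrBr mulr1 [(radial t * accept h t)%R]mulrC.
have -> : exchange h t = radial t.
  rewrite /exchange t0 th /=; apply/min_idPl.
  (* The smaller density is now the one at t, so [radial_le] is used with h - t in the role of t. *)
  have hht : (h <= 2 * (h - t))%R by lra.
  have thh : (h - t < h)%R by lra.
  have := radial_le h0 hr hht thh.
  by have -> : (h - (h - t) = t)%R by ring.
rewrite subrr mul0e adde0; congr (_ * _).
rewrite -[RHS]integral_uniform_cst; apply: eq_integral => u _; congr F.
apply: row_step_reflect => //; rewrite /swing.
(* [swing] is 0 whatever the uniform sample: if the test fails, the radicand is negative because h >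
   2t. *)
case: ifP => _; first by rewrite sqrtr0.
apply: ltr0_sqrtr; rewrite subr_lt0 ltr_pdivlMr ?mul1r.
  have -> : (4 * t ^+ 2 = (2 * t) ^+ 2)%R by ring.
  by rewrite ltrXn2r// ?nnegrE; lra.
by rewrite mulr_gt0 ?exprn_gt0.
Qed.

Lemma set_row_neg t (z : coordT R I) :
  set_row i t (row_rot i (- 1) 0 z) = set_row i (- t) z.
Proof.
have E : ((- 1 : R) ^+ 2 + 0 ^+ 2 = 1)%R by ring.
rewrite set_row_rot//; apply/funext => k; rewrite /row_rot /set_row /scale_row.
by case: eqP => // _; ring.
Qed.

Section Flux.
Variable F : coordT R I -> \bar R.
Hypotheses (mF : measurable_fun setT F) (F0 : forall z, 0 <= F z).

(** Unnormalised average of F over the directions of row i at signed radius t. *)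
Let flux t := \int[mu]_z (F (set_row i t z) * (polar_weight i z)%:E).

Let m_flux2 :
  measurable_fun setT (fun p : coordT R I * R => F (set_row i p.2 p.1) * (polar_weight i p.1)%:E).
Proof.
apply: emeasurable_funM; first exact: (measurableT_comp mF (measurable_set_row i)).
apply/measurable_EFinP.
have := measurableT_comp (measurable_polar_weight i) (@measurable_fst _ _ (coordT R I) R).
exact.
Qed.

Let flux_ge0 t : 0 <= flux t.
Proof.
by apply: integral_ge0 => z _; rewrite mule_ge0// lee_fin polar_weight_ge0.
Qed.

Let m_flux : measurable_fun setT flux.
Proof.
pose f (t : R) (z : coordT R I) := F (set_row i t z) * (polar_weight i z)%:E.
apply: (measurable_ge0_integral2 f).
  have := measurableT_comp m_flux2 (@measurable_swap _ _ R (coordT R I)).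
  exact.
by move=> t z; rewrite mule_ge0// lee_fin polar_weight_ge0.
Qed.

Let m_flux1 t :
  measurable_fun setT (fun z => F (set_row i t z) * (polar_weight i z)%:E).
Proof.
have mp : measurable_fun setT (fun z : coordT R I => (z, t) : coordT R I * R).
  exact: measurable_fun_pair.
have := measurableT_comp m_flux2 mp; exact.
Qed.

Let flux_rot c s t : (c ^+ 2 + s ^+ 2 = 1)%R ->
  \int[mu]_z (F (row_rot i c s (set_row i t z)) * (polar_weight i z)%:E) = flux t.
Proof.
move=> cs; have [_ H] := preserves_row_rot gmu r_even i cs.
have G0 z : 0 <= F (set_row i t z) * (polar_weight i z)%:E.
  by rewrite mule_ge0// lee_fin polar_weight_ge0.
rewrite /flux -(H _ (m_flux1 t) G0); apply: eq_integral => z _.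
by rewrite set_row_rot// polar_weight_rot.
Qed.

(** Negation of a row is the rotation of cosine -1 and sine 0. *)
Let flux_neg t : flux (- t)%R = flux t.
Proof.
have E : ((- 1 : R) ^+ 2 + 0 ^+ 2 = 1)%R by ring.
rewrite -(flux_rot t E); apply: eq_integral => z _.
by rewrite -set_row_neg set_row_rot.
Qed.

Lemma measurable_exchange h : measurable_fun setT (exchange h).
Proof.
have mr := @measurable_radial R r.
rewrite /exchange; apply: measurable_fun_ifT; [by meas| |by meas].
apply: measurable_minr => //; apply: (measurableT_comp mr); by meas.
Qed.

(** K is prescribed only off the null event where row i vanishes, so that it may be [walk_step],
    whose output there is an arbitrary unit vector. Polar coordinates turn the claim into an
    identity between integrals over t. *)
Lemma row_step_preserves (h : R) (K : R -> coordT R I -> coordT R I) :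
  (0 < h)%R -> (h ^+ 2 <= 4 * r.-1%:R)%R ->
  measurable_fun setT (fun p : coordT R I * R => K p.2 p.1) ->
  (forall u z, (0 < N z)%R -> K u z = row_step i h u z) ->
  \int[mu]_z \int[@std_uniform R]_u F (K u z) = \int[mu]_z F z.
Proof.
move=> h0 hr mK HK.
pose H z := \int[@std_uniform R]_u F (K u z).
have H0 z : 0 <= H z by exact: integral_ge0.
have mH : measurable_fun setT H.
  apply: (measurable_ge0_integral2 (fun (z : coordT R I) (u : R) => F (K u z))) => //.
  exact: (measurableT_comp mF mK).
have mrad := @measurable_radial R r.
have mex := measurable_exchange h.
have posrad0 t : (0 <= (0 < t)%R%:R * radial t :> R)%R.
  by case: (ltP 0%R t) => t0; rewrite ?mul0r// mul1r radial_ge0// ltW.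
have mfh : measurable_fun setT (fun t : R => flux (t - h)%R).
  by apply: (measurableT_comp m_flux); meas.
(* After one step from radius t, the exchanged mass sits at t - h and the rotated mass contributes
   as before, since [flux] ignores rotations. *)
have E1 t : ((0 < t)%R%:R * radial t)%:E *
    \int[mu]_z (H (set_row i t z) * (polar_weight i z)%:E) =
    (exchange h t)%:E * flux (t - h)%R +
    ((0 < t)%R%:R * radial t - exchange h t)%:E * flux t.
  have [t0|t0] := ltP 0%R t; last first.
    by rewrite mul0r /exchange ltNge t0 /= subrr !mul0e adde0.
  rewrite mul1r.
  have rad0 : (0 <= radial t)%R by rewrite radial_ge0// ltW.
  have cs := rot_cos_sin h0 t0.
  have d0 : (0 <= radial t - exchange h t)%R.
    by rewrite subr_ge0; have := @exchange_le R r h t; rewrite t0 mul1r.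
  have mHt : measurable_fun setT (fun z => H (set_row i t z) * (polar_weight i z)%:E).
    apply: emeasurable_funM; last by apply/measurable_EFinP; exact: measurable_polar_weight.
    have mp : measurable_fun setT (fun z : coordT R I => (z, t) : coordT R I * R).
      exact: measurable_fun_pair.
    exact: (measurableT_comp mH (measurableT_comp (measurable_set_row i) mp)).
  have [mrot _] := preserves_row_rot gmu r_even i cs.
  have mrt : measurable_fun setT (fun z => F (row_rot i (rot_cos h t) (rot_sin h t)
      (set_row i t z)) * (polar_weight i z)%:E).
    apply: emeasurable_funM; last by apply/measurable_EFinP; exact: measurable_polar_weight.
    have mp : measurable_fun setT (fun z : coordT R I => (z, t) : coordT R I * R).
      exact: measurable_fun_pair.
    exact: (measurableT_comp mF (measurableT_comp mrot
      (measurableT_comp (measurable_set_row i) mp))).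
  rewrite -(ge0_integralZl _ measurableT mHt)//; last first.
    by move=> z _; rewrite mule_ge0// lee_fin polar_weight_ge0.
  rewrite -(flux_rot t cs) /flux.
  rewrite -(ge0_integralZl _ measurableT (m_flux1 (t - h)%R)); last 2 first.
  - by move=> z _; rewrite mule_ge0// lee_fin polar_weight_ge0.
  - by rewrite lee_fin exchange_ge0.
  rewrite -(ge0_integralZl _ measurableT mrt); last 2 first.
  - by move=> z _; rewrite mule_ge0// lee_fin polar_weight_ge0.
  - by rewrite lee_fin.
  rewrite -ge0_integralD//; last 4 first.
  - by move=> z _; rewrite !mule_ge0// lee_fin ?polar_weight_ge0 ?exchange_ge0.
  - by apply: measurable_funeM; exact: m_flux1.
  - by move=> z _; rewrite !mule_ge0// lee_fin ?polar_weight_ge0.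
  - exact: measurable_funeM.
  apply: eq_integral => z _.
  have [N0|] := ltP 0%R (N z); last first.
    move=> N0; have Nz : N z = 0%R by apply/eqP; rewrite eq_le N0 row_norm_ge0.
    by rewrite /polar_weight Nz ler10 /= !mul0r !mule0 adde0.
  rewrite !muleA -ge0_muleDl; last 2 first.
  - by rewrite mule_ge0// lee_fin exchange_ge0.
  - by rewrite mule_ge0// lee_fin.
  congr (_ * _); rewrite -row_step_average//; congr (_ * _).
  apply: eq_integral => u _; rewrite HK// row_norm_set_row//; exact: ltW.
(* Detailed balance: t -> h - t fixes [exchange] and [flux] is even, so what leaves radius t is
   replaced by what leaves h - t. *)
have E2 : \int[@leb R]_t ((exchange h t)%:E * flux (t - h)%R) =
    \int[@leb R]_t ((exchange h t)%:E * flux t).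
  have mg : measurable_fun setT (fun t : R => (exchange h t)%:E * flux t).
    by apply: emeasurable_funM; [apply/measurable_EFinP; exact: mex|exact: m_flux].
  have g0 t : 0 <= (exchange h t)%:E * flux t.
    by rewrite mule_ge0// lee_fin exchange_ge0.
  have n10 : ((- 1 : R) != 0)%R by rewrite oppr_eq0 oner_eq0.
  rewrite [RHS](ge0_integral_affine h n10 mg g0) normrN1 mul1e.
  apply: eq_integral => t _; rewrite mulN1r [(- t + h)%R]addrC exchange_sym.
  by rewrite -[flux (h - t)]flux_neg opprB.
suff : (@polar_const R) * \int[mu]_z H z = (@polar_const R) * \int[mu]_z F z.
  have cfin := polar_const_fin (R := R); have c0 := polar_const_gt0 (R := R).
  move=> E; apply/eqP; rewrite eq_le.
  by rewrite -(lee_pmul2l cfin c0) E lexx /= -(lee_pmul2l cfin c0) E lexx.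
rewrite (polar gmu r_gt0 i mH H0) (polar gmu r_gt0 i mF F0).
rewrite (eq_integral _ _ (fun t _ => E1 t)).
have mA : measurable_fun setT (fun t : R => (exchange h t)%:E * flux t).
  by apply: emeasurable_funM; [apply/measurable_EFinP; exact: mex|exact: m_flux].
have mB : measurable_fun setT (fun t : R => (exchange h t)%:E * flux (t - h)%R).
  by apply: emeasurable_funM; [apply/measurable_EFinP; exact: mex|exact: mfh].
have d0 (t : R) : (0 <= (0 < t)%R%:R * radial t - exchange h t)%R.
  by rewrite subr_ge0 exchange_le.
have mC : measurable_fun setT (fun t : R =>
    ((0 < t)%R%:R * radial t - exchange h t)%:E * flux t).
  by apply: emeasurable_funM; [apply/measurable_EFinP; meas|exact: m_flux].
have A0 t : setT t -> 0 <= (exchange h t)%:E * flux t.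
  by move=> _; apply: mule_ge0; [rewrite lee_fin exchange_ge0|exact: flux_ge0].
have B0 t : setT t -> 0 <= (exchange h t)%:E * flux (t - h)%R.
  by move=> _; apply: mule_ge0; [rewrite lee_fin exchange_ge0|exact: flux_ge0].
have C0 t : setT t -> 0 <= ((0 < t)%R%:R * radial t - exchange h t)%:E * flux t.
  by move=> _; apply: mule_ge0; [rewrite lee_fin|exact: flux_ge0].
rewrite (ge0_integralD _ measurableT B0 mB C0 mC) E2.
rewrite -(ge0_integralD _ measurableT A0 mA C0 mC).
apply: eq_integral => t _; rewrite -ge0_muleDl; last 2 first.
- by rewrite lee_fin exchange_ge0.
- by rewrite lee_fin.
by rewrite -EFinD subrKC.
Qed.

End Flux.

End RowKernelLaw.

(** * The step along an arbitrary vector *)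

Section WalkStep.
Context {R : realType} {m r : nat}.
Notation I := ('I_m * 'I_r)%type.
Implicit Types (v : 'I_m -> R) (z : coordT R I).

Definition vec_len v : R := Num.sqrt (\sum_i v i ^+ 2).
Definition combo v z (j : 'I_r) : R := \sum_i v i * z (i, j).
Definition combo_len v z : R := Num.sqrt (\sum_j combo v z j ^+ 2).

(* When the combination vanishes, the first basis vector is returned: the output
   must be a unit vector even on this null event. *)
Definition direction (b : R) v (u : R) z (j : 'I_r) : R :=
  let t := combo_len v z / vec_len v in
  let h := b * vec_len v in
  if combo_len v z <= 0 then (j == 0%N :> nat)%:R
  else (pull (r := r) h t u * combo v z j +
        swing (r := r) h t u * Jrow (combo v z) j) / combo_len v z.

Definition walk_step (b : R) v (u : R) z : coordT R I :=
  fun k => z k + b * v k.1 * direction b v u z k.2.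

Lemma measurable_direction b v j :
  measurable_fun setT (fun p : coordT R I * R => direction b v p.2 p.1 j).
Proof.
have m1 k : measurable_fun setT (fun p : coordT R I * R => p.1 k).
  have := measurableT_comp (measurable_coord k) (@measurable_fst _ _ (coordT R I) R).
  exact.
have mc l : measurable_fun setT (fun p : coordT R I * R => combo v p.1 l).
  by apply: measurable_sum => i; meas; exact: m1.
have ml : measurable_fun setT (fun p : coordT R I * R => combo_len v p.1).
  apply: measurable_fun_sqrt; apply: measurable_sum => l.
  by meas; exact: mc.
have mJ l : measurable_fun setT (fun p : coordT R I * R => Jrow (combo v p.1) l).
  by rewrite /Jrow; case: (odd l); meas; exact: mc.
have ms : measurable_fun setT (fun p : coordT R I * R =>
    swing (r := r) (b * vec_len v) (combo_len v p.1 / vec_len v) p.2).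
  rewrite /swing /accept; apply: measurable_fun_sqrt.
  by apply: measurable_fun_ifT; meas.
have mcj := mc j; have mJj := mJ j.
rewrite /direction; apply: measurable_fun_ifT; [by meas|by meas|].
rewrite /pull; meas.
Qed.

Lemma measurable_walk_step b v :
  measurable_fun setT (fun p : coordT R I * R => walk_step b v p.2 p.1).
Proof.
apply: measurable_to_coord => k; rewrite /walk_step.
apply: measurable_funD.
  have := measurableT_comp (measurable_coord k) (@measurable_fst _ _ (coordT R I) R).
  exact.
by apply: measurable_funM; [exact: measurable_cst|exact: measurable_direction].
Qed.

Lemma vec_len_eq0 v : (vec_len v == 0) = [forall i, v i == 0].
Proof.
rewrite sqrtr_eq0; apply/idP/forallP => [H i|H].
  have : \sum_i v i ^+ 2 == 0 by rewrite eq_le H sumr_ge0// => k _; exact: sqr_ge0.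
  rewrite psumr_eq0; last by move=> k _; exact: sqr_ge0.
  by move/allP => /(_ i); rewrite mem_index_enum sqrf_eq0; exact.
by rewrite big1// => i _; rewrite (eqP (H i)) expr0n.
Qed.

Definition vec_mix (a c : 'I_m) (x y : R) v (i : 'I_m) : R :=
  if i == a then x * v a - y * v c else if i == c then y * v a + x * v c else v i.

Lemma sum_pair (a c : 'I_m) (f : 'I_m -> R) : a != c ->
  \sum_i f i = f a + f c + \sum_(i | (i != a) && (i != c)) f i.
Proof.
by move=> ac; rewrite (bigD1 a)//= (bigD1 c) 1?eq_sym//= addrA.
Qed.

Lemma vec_len_mix a c x y v : a != c -> x ^+ 2 + y ^+ 2 = 1 ->
  vec_len (vec_mix a c x y v) = vec_len v.
Proof.
move=> ac xy; rewrite /vec_len !(sum_pair _ ac); congr (Num.sqrt (_ + _)).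
  rewrite /vec_mix eqxx [c == a]eq_sym (negbTE ac) eqxx.
  transitivity ((x ^+ 2 + y ^+ 2) * (v a ^+ 2 + v c ^+ 2)); first by ring.
  by rewrite xy mul1r.
by apply: eq_bigr => i /andP[ia ic]; rewrite /vec_mix (negbTE ia) (negbTE ic).
Qed.

Lemma combo_mix a c x y v z : a != c -> x ^+ 2 + y ^+ 2 = 1 ->
  combo (vec_mix a c x y v) (row_mix a c x y z) = combo v z.
Proof.
move=> ac xy; apply/funext => j; rewrite /combo !(sum_pair _ ac); congr (_ + _).
  rewrite /vec_mix /row_mix /= !eqxx [c == a]eq_sym (negbTE ac).
  transitivity ((x ^+ 2 + y ^+ 2) * (v a * z (a, j) + v c * z (c, j))); first by ring.
  by rewrite xy mul1r.
by apply: eq_bigr => i /andP[ia ic]; rewrite /vec_mix /row_mix /= (negbTE ia) (negbTE ic).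
Qed.

(** [direction] sees v and z only through |v| and v^T z, which a common rotation of the entries of v
    and the rows of z leaves unchanged. *)
Lemma walk_step_mix b a c x y v u z : a != c -> x ^+ 2 + y ^+ 2 = 1 ->
  walk_step b (vec_mix a c x y v) u (row_mix a c x y z) =
  row_mix a c x y (walk_step b v u z).
Proof.
move=> ac xy; apply/funext => k; rewrite /walk_step /direction /combo_len.
rewrite combo_mix// vec_len_mix// /row_mix /vec_mix /=.
by case: ifP => _; [|case: ifP => _]; ring.
Qed.

Lemma row_mixK a c x y z : a != c -> x ^+ 2 + y ^+ 2 = 1 ->
  row_mix a c x (- y) (row_mix a c x y z) = z.
Proof.
move=> ac xy; apply/funext => -[i j]; rewrite /row_mix /= !eqxx [c == a]eq_sym (negbTE ac).
case: eqP => [->|_]; last case: eqP => [->|//].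
  transitivity ((x ^+ 2 + y ^+ 2) * z (a, j)); first by ring.
  by rewrite xy mul1r.
transitivity ((x ^+ 2 + y ^+ 2) * z (c, j)); first by ring.
by rewrite xy mul1r.
Qed.

Variable mu : probability (coordT R I) R.
Hypothesis gmu : gaussian mu.
Hypotheses (r_gt0 : (0 < r)%N) (r_even : ~~ odd r).

(** The entry [v i0] occurs both in the update and in the direction, so its sign cancels and its
    absolute value |v| remains. *)
Lemma walk_step_single b v i0 u z : v i0 != 0 -> (forall i, i != i0 -> v i = 0) ->
  0 < row_norm i0 z -> walk_step b v u z = row_step i0 (b * vec_len v) u z.
Proof.
move=> v0 vn N0.
have cE : combo v z = fun j => v i0 * z (i0, j).
  apply/funext => j; rewrite /combo (bigD1 i0)//= big1 ?addr0// => i ii.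
  by rewrite vn// mul0r.
have lE : vec_len v = `|v i0|.
  rewrite /vec_len (bigD1 i0)//= big1 ?addr0 ?sqrtr_sqr// => i ii.
  by rewrite vn// expr0n.
have a0 : 0 < `|v i0| by rewrite normr_gt0.
have nE : combo_len v z = `|v i0| * row_norm i0 z.
  rewrite /combo_len cE -sqrtr_sqr -sqrtrM ?sqr_ge0//; congr Num.sqrt.
  by rewrite mulr_sumr; apply: eq_bigr => j _; rewrite exprMn.
have JE j : Jrow (combo v z) j = v i0 * Jrow (fun j => z (i0, j)) j.
  by rewrite cE /Jrow; case: ifP => _; rewrite ?mulrN.
have tE : `|v i0| * row_norm i0 z / `|v i0| = row_norm i0 z.
  by rewrite mulrAC divff ?mul1r// gt_eqF.
apply/funext => -[i j]; rewrite /walk_step /row_step /direction /= JE nE lE.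
rewrite leNgt mulr_gt0//= tE.
have [->|ii] := eqVneq i i0; last by rewrite vn// mulr0 mul0r addr0.
congr (_ + _); rewrite cE /=.
set A := pull _ _ _; set B := swing _ _ _.
transitivity (b * (v i0 ^+ 2 / `|v i0|) * ((A * z (i0, j) + B * Jrow (fun j => z (i0, j)) j) / row_norm i0 z)).
  by field; rewrite !gt_eqF.
by rewrite -real_normK ?num_real// expr2 mulfK ?gt_eqF.
Qed.

Local Open Scope ereal_scope.

(* Mixing two rows by a rotation is equivalent to mixing the corresponding
   entries of [v] the same way; this removes nonzero entries of [v] one by one
   until [row_step_preserves] applies. *)
Lemma walk_step_preserves b v (F : coordT R I -> \bar R) : (0 < b)%R ->
  ((b * vec_len v) ^+ 2 <= 4 * r.-1%:R)%R ->
  measurable_fun setT F -> (forall z, 0 <= F z) ->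
  \int[mu]_z \int[@std_uniform R]_u F (walk_step b v u z) = \int[mu]_z F z.
Proof.
move=> b0; move Dn : #|[pred i | v i != 0%R]| => n.
elim/ltn_ind: n v Dn F => n IH v Dn F bv mF F0.
have [/existsP[i0 vi0]|] := boolP [exists i, v i != 0%R]; last first.
  rewrite negb_exists => /forallP v0.
  apply: eq_integral => z _; have wE u : walk_step b v u z = z.
    apply/funext => k; rewrite /walk_step.
    by have := v0 k.1; rewrite negbK => /eqP ->; rewrite mulr0 mul0r addr0.
  under eq_integral do rewrite wE.
  rewrite integral_cst//= [X in _ * X](_ : _ = 1) ?mule1//.
  exact: (probability_setT (@std_uniform R)).
have [/existsP[c /andP[ci vc]]|] := boolP [exists c, (c != i0) && (v c != 0%R)]; last first.
  rewrite negb_exists => /forallP vn.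
  have {}vn i : i != i0 -> v i = 0%R.
    by move=> ii; have := vn i; rewrite ii /= negbK => /eqP.
  have l0 : (0 < vec_len v)%R.
    rewrite lt_neqAle sqrtr_ge0 andbT eq_sym vec_len_eq0 negb_forall.
    by apply/existsP; exists i0.
  apply: (row_step_preserves gmu r_gt0 r_even (i := i0) mF F0 (mulr_gt0 b0 l0) bv).
    exact: measurable_walk_step.
  by move=> u z; exact: walk_step_single.
have ac : i0 != c by rewrite eq_sym.
pose s := Num.sqrt (v i0 ^+ 2 + v c ^+ 2)%R.
have s0 : (0 < s)%R.
  by rewrite sqrtr_gt0 ltr_pwDl ?sqr_ge0// exprn_even_gt0.
have sE : (s ^+ 2 = v i0 ^+ 2 + v c ^+ 2)%R.
  by rewrite sqr_sqrtr// addr_ge0 ?sqr_ge0.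
(* The angle that makes entry c of the mixed vector vanish, moving its weight to entry i0. *)
pose x := (v i0 / s)%R; pose y := (- (v c / s))%R.
have xy : (x ^+ 2 + y ^+ 2 = 1)%R.
  by rewrite /x /y sqrrN !expr_div_n -mulrDl -sE divff// expf_neq0 ?gt_eqF.
pose v' := vec_mix i0 c x y v.
have v'c : v' c = 0%R by rewrite /v' /vec_mix eq_sym (negbTE ac) eqxx /x /y; ring.
have [mQ pQ] := preserves_row_mix gmu ac xy.
have xy' : (x ^+ 2 + (- y) ^+ 2 = 1)%R by rewrite sqrrN.
have [mQ' pQ'] := preserves_row_mix gmu ac xy'.
have lt' : (#|[pred i | v' i != 0%R]| < n)%N.
  rewrite -Dn; apply: proper_card; apply/properP; split.
    apply/fintype.subsetP => i; rewrite !inE /v' /vec_mix.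
    have [->//|_] := eqVneq i i0; by have [->|] := eqVneq i c.
  by exists c; rewrite !inE ?v'c ?eqxx.
have bv' : ((b * vec_len v') ^+ 2 <= 4 * r.-1%:R)%R by rewrite /v' vec_len_mix.
have mF' := measurableT_comp mF mQ'.
have H := IH _ lt' v' erefl _ bv' mF' (fun z => F0 _).
(* The row rotation conjugates the step for v into the step for v'; its inverse is absorbed into F,
   and both rotations disappear by invariance of [mu]. *)
transitivity (\int[mu]_z F (row_mix i0 c x (- y)%R z)); last exact: (pQ' F mF F0).
rewrite -H -[RHS]pQ.
- apply: eq_integral => z _; apply: eq_integral => u _ /=.
  by rewrite walk_step_mix// row_mixK.
- apply: (measurable_ge0_integral2 (fun (z : coordT R I) (u : R) =>
    (F \o row_mix i0 c x (- y)%R) (walk_step b v' u z))); last by move=> *; exact: F0.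
  exact: (measurableT_comp mF' (measurable_walk_step b v')).
- by move=> z; apply: integral_ge0 => u _; exact: F0.
Qed.

End WalkStep.

(** * Tail bound and choice of the rank *)

Section ChiSquareTail.
Context {R : realType} {m r : nat}.
Notation I := ('I_m * 'I_r)%type.
Variable mu : probability (coordT R I) R.
Hypothesis gmu : gaussian mu.
Local Open Scope ereal_scope.

Lemma measurable_row2_gt (i : 'I_m) (a : R) :
  measurable [set z : coordT R I | (a < row2 i z)%R].
Proof.
have m2 := measurable_row2 (R := R) (r := r) i.
have mb : measurable_fun setT (fun z : coordT R I => (a < row2 i z)%R) by meas.
have mtrue : measurable ([set true] : set bool) by [].
have := mb measurableT [set true] mtrue; rewrite setTI; congr measurable.
Qed.

(** Dilating the row by 1 + e turns the event into a squared length above r - 1, where the weight is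
    at most (1 + e)^r exp(- (2e + e^2) (r - 1) / 2); bounding (1 + e)^r by e^(r e) gives the
    claim. *)
Lemma row2_tail (i : 'I_m) (e : R) : (0 <= e)%R -> (0 < r)%N ->
  mu [set z | (r.-1%:R * (1 + e) ^+ 2 < row2 i z)%R] <=
  (expR (e - r.-1%:R * e ^+ 2 / 2))%:E.
Proof.
move=> e0 r0; set a := (r.-1%:R * (1 + e) ^+ 2)%R; set A := [set z | _].
have mA : measurable A := measurable_row2_gt i a.
have s0 : (0 < 1 + e)%R by rewrite ltr_pwDl.
pose F z : \bar R := (\1_A z)%:E.
have mF : measurable_fun setT F by apply/measurable_EFinP; exact: measurable_indic.
have F0 z : 0 <= F z by rewrite lee_fin.
have -> : mu A = \int[mu]_z F z by rewrite integral_indic// setIT.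
rewrite (gaussian_scale_row gmu i s0 mF F0).
have step z : F (scale_row i (1 + e) z) *
    ((1 + e) ^+ r * expR (- (((1 + e) ^+ 2 - 1) * row2 i z / 2)))%:E <=
    (expR (e - r.-1%:R * e ^+ 2 / 2))%:E.
  rewrite /F indicE; case: (boolP (_ \in A)) => [|_]; last by rewrite mul0e lee_fin expR_ge0.
  rewrite mul1e lee_fin in_setE /A /= row2_scale_row => az.
  have {}az : (r.-1%:R < row2 i z)%R.
    by rewrite -(@ltr_pM2l _ ((1 + e) ^+ 2)) ?exprn_gt0// [ltLHS]mulrC.
  apply: (@le_trans _ _ (expR (r%:R * e) * expR (- (((1 + e) ^+ 2 - 1) * r.-1%:R / 2)))%R).
    apply: ler_pM; rewrite ?expR_ge0 ?exprn_ge0 ?(ltW s0)//.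
      by rewrite expRM_natl lerXn2r ?nnegrE ?expR_ge0 ?(ltW s0)// expR_ge1Dx.
    rewrite ler_expR lerN2 ler_pM2r ?invr_gt0// ler_wpM2l ?(ltW az)//.
    by rewrite subr_ge0 exprn_ege1// lerDl.
  rewrite -expRD ler_expR -{1}(prednK r0) -natr1.
  by rewrite le_eqVlt; apply/orP; left; apply/eqP; field.
apply: (@le_trans _ _ (\int[mu]_z (expR (e - r.-1%:R * e ^+ 2 / 2))%:E)).
  apply: ge0_le_integral => //.
  - by move=> z _; rewrite mule_ge0// lee_fin mulr_ge0 ?expR_ge0 ?exprn_ge0 ?(ltW s0).
  - apply: emeasurable_funM.
      apply: (measurableT_comp mF).
      have mp : measurable_fun setT (fun z : coordT R I => (z, 1 + e)%R : coordT R I * R).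
        exact: measurable_fun_pair.
      have := measurableT_comp (@measurable_scale_row R m r i) mp; exact.
    apply/measurable_EFinP; have m2 := measurable_row2 (R := R) (r := r) i; meas.
rewrite integral_cst//= [X in _ * X](_ : _ = 1) ?mule1//.
exact: (probability_setT mu).
Qed.

End ChiSquareTail.

(** To be used with the rank minus one as r and m T as n; 2 n bounds the number m (T + 1) of pairs
    of a row and a time. Since n >= 2, the logarithm is at least ln 2, so its multiple in r
    outweighs both ln 2 and the constant left by the term e. *)
Lemma rank_sufficient {R : realType} (n r e d : R) : 0 < e -> 0 < d -> d < 1 -> 2 <= n ->
  8 * (e ^- 2 * ln (n / d)) + 5 <= r ->
  2 * n * expR (e - r * e ^+ 2 / 2) <= d.
Proof.
move=> e0 d0 d1 n2 rL.
have n0 : 0 < n by lra.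
have nd0 : 0 < n / d by rewrite divr_gt0.
set l := ln (n / d) in rL.
have l2 : ln 2 <= l.
  rewrite ler_ln ?posrE// ler_pdivlMr//; lra.
have ln2 : 1 / 2 <= ln 2 :> R.
  (* The bound ln(1 + x) <= x at -1/2 reads - ln 2 <= - 1/2. *)
  have := @le_ln1Dx R (- (1 / 2)); rewrite (_ : 1 + - (1 / 2) = 2^-1); last by field.
  rewrite lnV ?posrE//; lra.
have E : n = d * expR l by rewrite lnK ?posrE// mulrC divfK// gt_eqF.
have -> : 2 * n * expR (e - r * e ^+ 2 / 2) =
    d * expR (ln 2 + l + (e - r * e ^+ 2 / 2)).
  by rewrite [in RHS]expRD [expR (ln 2 + l)]expRD lnK ?posrE// {1}E; ring.
rewrite ger_pMr// -[leRHS]expR0 ler_expR.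
have e2 : 0 < e ^+ 2 by rewrite exprn_gt0.
have : (8 * (e ^- 2 * l) + 5) * e ^+ 2 <= r * e ^+ 2 by rewrite ler_wpM2r// ltW.
have -> : (8 * (e ^- 2 * l) + 5) * e ^+ 2 = 8 * l + 5 * e ^+ 2.
  by field; rewrite gt_eqF.
(* The summand 5 in the rank is there for this: e - 5 e^2 / 2 is at most 1/10, its value at 1/5. *)
have := sqr_ge0 (e - 1 / 5); nra.
Qed.

(** The doubling makes r even; the added 4 pays for the truncation and for passing to r - 1, as 2 (4
    L - 1) + 7 = 8 L + 5. *)
Lemma rank_bounds {R : realType} (L : R) : 0 <= L ->
  let r := (2 * (Num.truncn (4 * L) + 4))%N in
  [/\ 8 * L + 5 <= r.-1%:R, 8 * L <= r%:R & r%:R <= 16 * Num.max 1 L].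
Proof.
move=> L0 r; have L4 : 0 <= 4 * L by rewrite mulr_ge0.
have /andP[H1 H2] := truncn_itv L4.
have rE : r%:R = 2 * (Num.truncn (4 * L))%:R + 8 :> R.
  by rewrite /r natrM natrD mulrDr; congr (_ + _); rewrite -natrM.
have r1 : r.-1%:R = r%:R - 1 :> R.
  have -> : r%:R = (r.-1.+1)%:R :> R by rewrite prednK// /r; lia.
  by rewrite -natr1 addrK.
rewrite r1 rE; rewrite -[X in _ < X]natr1 in H2; split; [lra|lra|].
have : 1 <= Num.max 1 L by rewrite le_max lexx.
have : L <= Num.max 1 L by rewrite le_max lexx orbT.
lra.
Qed.

(** * The program *)

(* Memory layout: array 3 holds the matrix Z row by row, array 4 the combination
   v^T Z of its rows; the scalars (cell 0 of their array) are 5: the uniform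
   sample, 6: |v|, 7: |v^T Z|, 9: b = 2 sqrt(r - 1), 10: h, 11: t, 12: [swing],
   13: [pull]. Register 3 tells whether Z has been drawn. *)
Definition cell (k : nat) : rexp := RGet k (INat 0).
Definition put (k : nat) (e : rexp) : cmd := RSet k (INat 0) e.
Definition entry_index : iexp := IAdd (IMul (IReg 4) (IReg 2)) (IReg 5).

Definition draw_matrix : cmd :=
  If (ILe (IReg 3) (INat 0))
     (Seq (For 4 (IMul (IReg 0) (IReg 2)) (Draw Gauss 3 (IReg 4)))
          (ISet 3 (INat 1)))
     Skip.

Definition add_up (x q : nat) (e : iexp) (a : rexp) : cmd :=
  For x e (put q (RAdd (cell q) a)).

Definition measure_vector : cmd :=
  Seq (put 6 (RNat (INat 0)))
 (Seq (add_up 4 6 (IReg 0) (RMul (RGet 0 (IReg 4)) (RGet 0 (IReg 4))))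
      (put 6 (RSqrt (cell 6)))).

Definition combine_rows : cmd :=
  Seq (put 7 (RNat (INat 0)))
 (Seq (For 5 (IReg 2)
        (Seq (put 8 (RNat (INat 0)))
        (Seq (add_up 4 8 (IReg 0) (RMul (RGet 0 (IReg 4)) (RGet 3 entry_index)))
        (Seq (RSet 4 (IReg 5) (cell 8))
             (put 7 (RAdd (cell 7) (RMul (cell 8) (cell 8))))))))
      (put 7 (RSqrt (cell 7)))).

Definition rank_pred : rexp := RNat (ISub (IReg 2) (INat 1)).

Definition accept_exp : rexp :=
  let h := cell 10 in let t := cell 11 in
  RExp (RAdd (RMul rank_pred (RLn (RDiv (RSub h t) t)))
             (RDiv (RSub (RMul t t) (RMul (RSub h t) (RSub h t))) (RNat (INat 2)))).

Definition choose_angle : cmd :=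
  let h := cell 10 in let t := cell 11 in
  Seq (put 10 (RMul (cell 9) (cell 6)))
 (Seq (put 11 (RDiv (cell 7) (cell 6)))
 (Seq (put 12 (RSub (RNat (INat 1))
                    (RDiv (RMul h h) (RMul (RNat (INat 4)) (RMul t t)))))
 (Seq (If (RLe h t) Skip
          (If (RLe (cell 5) accept_exp) (put 12 (RNat (INat 0))) Skip))
 (Seq (put 12 (RSqrt (cell 12)))
      (put 13 (RSub (RNat (INat 0))
                    (RSqrt (RSub (RNat (INat 1)) (RMul (cell 12) (cell 12)))))))))).

(* The [l]-th iteration fills cells [2 l] and [2 l + 1]; only those below r
   matter, the surplus ones are never read. *)
Definition write_rotated : cmd :=
  let even := IMul (INat 2) (IReg 5) in let odd := IAdd even (INat 1) in
  For 5 (IReg 2)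
   (Seq (RSet 1 even (RDiv (RSub (RMul (cell 13) (RGet 4 even))
                                 (RMul (cell 12) (RGet 4 odd))) (cell 7)))
        (RSet 1 odd (RDiv (RAdd (RMul (cell 13) (RGet 4 odd))
                                (RMul (cell 12) (RGet 4 even))) (cell 7)))).

Definition choose_output : cmd :=
  If (RLe (cell 7) (RNat (INat 0)))
     (For 5 (IReg 2) (RSet 1 (IReg 5) (RNat (ISub (INat 1) (IReg 5)))))
     (Seq choose_angle write_rotated).

Definition move_matrix : cmd :=
  For 4 (IReg 0) (For 5 (IReg 2)
    (RSet 3 entry_index (RAdd (RGet 3 entry_index)
       (RMul (RMul (cell 9) (RGet 0 (IReg 4))) (RGet 1 (IReg 5)))))).

Definition walk_program : cmd :=
  Seq draw_matrix
 (Seq (Draw Unif 5 (INat 0))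
 (Seq measure_vector
 (Seq combine_rows
 (Seq (put 9 (RMul (RNat (INat 2)) (RSqrt rank_pred)))
 (Seq choose_output move_matrix))))).

(** * Running time of the program *)

Section RunningTime.
Context {R : realType}.
Implicit Types (s : state R) (w : tape R).

Fixpoint iread (x : nat) (e : iexp) : bool :=
  match e with
  | INat _ => true
  | IReg y => (y < x)%N
  | IAdd a b | ISub a b | IMul a b => iread x a && iread x b
  end.

(* Registers below 3 are read-only, and loop bounds are computed from them. *)
Fixpoint disciplined (c : cmd) : bool :=
  match c with
  | ISet x _ => (3 <= x)%N
  | Seq a b | If _ a b => disciplined a && disciplined b
  | For x e c1 => [&& (3 <= x)%N, iread 3 e & disciplined c1]
  | _ => true
  end.

Fixpoint ibound (g : nat -> nat) (e : iexp) : nat :=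
  match e with
  | INat n => n
  | IReg x => g x
  | IAdd a b => ibound g a + ibound g b
  | ISub a b => ibound g a - ibound g b
  | IMul a b => ibound g a * ibound g b
  end%N.

Fixpoint time_bound (g : nat -> nat) (c : cmd) : nat :=
  match c with
  | Skip => 1
  | ISet _ e => (isize e).+1
  | RSet _ i e => (isize i + rsize e).+1
  | Draw _ _ i => (isize i).+1
  | Seq a b => time_bound g a + time_bound g b
  | If b a1 a2 => (bsize b).+1 + maxn (time_bound g a1) (time_bound g a2)
  | For _ e c1 => (isize e).+1 + ibound g e * (time_bound g c1).+1
  end%N.

Lemma ieval_ibound (g : nat -> nat) e s : iread 3 e ->
  (forall x, (x < 3)%N -> ireg s x = g x) -> ieval s e = ibound g e.
Proof.
by move=> + H; elim: e => [//|x /= /H//|a IHa b IHb|a IHa b IHb|a IHa b IHb] /=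
  /andP[/IHa -> /IHb ->].
Qed.

Lemma exec_For_inv w x e c s (Inv : nat -> state R -> Prop) :
  Inv 0%N (tick (isize e).+1 s) ->
  (forall i s', (i < ieval s e)%N -> Inv i s' ->
     Inv i.+1 (exec w c (tick 1 (set_ireg x i s')))) ->
  Inv (ieval s e) (exec w (For x e c) s).
Proof.
rewrite /=; elim: (ieval s e) => [//|n IH] I0 step.
rewrite -addn1 iotaD foldl_cat addn1 /= add0n; apply: (step); first exact: ltnSn.
by apply: IH => // i s' i_n; apply: step; exact: ltnW.
Qed.

(** Registers and clock are treated together: the cost of the second command of a sequence depends
    on the registers left by the first. *)
Lemma clock_exec (g : nat -> nat) w c s : disciplined c ->
  (forall x, (x < 3)%N -> ireg s x = g x) ->
  (forall x, (x < 3)%N -> ireg (exec w c s) x = g x) /\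
  (clock (exec w c s) <= clock s + time_bound g c)%N.
Proof.
elim: c s => [|x e|k i e|q k i|a IHa b IHb|t a IHa b IHb|x e c IH] s /=.
- by move=> _ H; split.
- by move=> x3 H; split => // y y3 /=; case: eqP => [yx|_]; [lia|exact: H].
- by move=> _ H; split.
- by move=> _ H; split.
- move=> /andP[da db] H; have [Ha Ca] := IHa s da H.
  have [Hb Cb] := IHb _ db Ha; split => //; lia.
- move=> /andP[da db] H; case: ifP => _.
    have [] := IHa (tick (bsize t).+1 s) da H; move=> Ha /= Ca; split => //; lia.
  have [] := IHb (tick (bsize t).+1 s) db H; move=> Hb /= Cb; split => //; lia.
- move=> /and3P[x3 re dc] H; rewrite -/(exec w (For x e c) s) -(ieval_ibound re H).
  pose Inv i s' := (forall y, (y < 3)%N -> ireg s' y = g y) /\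
    (clock s' <= clock s + (isize e).+1 + i * (time_bound g c).+1)%N.
  suff [H2 C2] : Inv (ieval s e) (exec w (For x e c) s) by split => //; lia.
  apply: exec_For_inv; first by split => //=; rewrite mul0n addn0.
  move=> i s' _ [H' C'].
  have [|H2 C2] := IH (tick 1 (set_ireg x i s')) dc.
    by move=> y y3 /=; case: eqP => [yx|_]; [lia|exact: H'].
  by split => //; move: C2; rewrite /= mulSn; lia.
Qed.

Definition dimensions (m T r x : nat) : nat := nth 0%N [:: m; T; r] x.

Lemma walk_program_disciplined : disciplined walk_program.
Proof. by []. Qed.

Lemma walk_program_time_bound m T r : (0 < m)%N -> (0 < r)%N ->
  (time_bound (dimensions m T r) walk_program <= 300 * (m * r))%N.
Proof.
move=> m0 r0; rewrite /= -!/(dimensions m T r _) /dimensions /=.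
(* The bound is a combination of m r, m, r and 1, each at most m r. *)
have mr1 : (m <= m * r)%N by rewrite leq_pmulr.
have mr2 : (r <= m * r)%N by rewrite leq_pmull.
have mr3 : (1 <= m * r)%N by rewrite muln_gt0 m0.
by lia.
Qed.

End RunningTime.

(** * The program computes the walk *)

Section Correctness.
Context {R : realType}.
Implicit Types (s : state R) (w : tape R).

(** A frame condition: only registers in rs, arrays in ks and the clock may differ, and no sample is
    drawn. *)
Definition frame (rs ks : seq nat) s s' :=
  [/\ forall x, x \notin rs -> ireg s' x = ireg s x,
      forall k, k \notin ks -> arr s' k = arr s k & drawn s' = drawn s].

Lemma frame_trans rs ks rs' ks' s s' s'' :
  frame rs ks s s' -> frame rs' ks' s' s'' -> frame (rs ++ rs') (ks ++ ks') s s''.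
Proof.
move=> [r1 k1 d1] [r2 k2 d2]; split; last by rewrite d2.
- by move=> x; rewrite mem_cat negb_or => /andP[x1 x2]; rewrite r2// r1.
- by move=> x; rewrite mem_cat negb_or => /andP[x1 x2]; rewrite k2// k1.
Qed.

Lemma frame_sub rs ks rs' ks' s s' :
  all (fun x => x \in rs') rs -> all (fun k => k \in ks') ks ->
  frame rs ks s s' -> frame rs' ks' s s'.
Proof.
move=> /allP rr /allP kk [r1 k1 d1]; split => // x xr; [apply: r1|apply: k1].
  by apply: contra xr; exact: rr.
by apply: contra xr; exact: kk.
Qed.

Lemma frame_set_ireg rs ks x n s s' : x \in rs -> frame rs ks s s' ->
  frame rs ks s (tick 1 (set_ireg x n s')).
Proof.
move=> xr [r1 k1 d1]; split => // y yr /=; case: eqP => [yx|_]; last exact: r1.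
by rewrite yx xr in yr.
Qed.

Lemma frame_refl rs ks s : frame rs ks s s.
Proof. by []. Qed.

Lemma frame_tick rs ks n s s' : frame rs ks s s' -> frame rs ks s (tick n s').
Proof. by []. Qed.

Lemma frame_set_arr rs ks k i a n s s' : k \in ks -> frame rs ks s s' ->
  frame rs ks s (tick n (set_arr k i a s')).
Proof.
move=> kk [r1 k1 d1]; split => // k' kk' /=; rewrite -k1//.
by apply/funext => j; case: eqP => [E|//]; rewrite E kk in kk'.
Qed.

Lemma frame_reg rs ks s s' x : frame rs ks s s' -> x \notin rs -> ireg s' x = ireg s x.
Proof. by case=> H _ _; exact: H. Qed.

Lemma frame_arr rs ks s s' k : frame rs ks s s' -> k \notin ks -> arr s' k = arr s k.
Proof. by case=> _ H _; exact: H. Qed.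

Lemma exec_Seq w a b s : exec w (Seq a b) s = exec w b (exec w a s).
Proof. by []. Qed.

Lemma exec_put w k e s : frame [::] [:: k] s (exec w (put k e) s) /\
  arr (exec w (put k e) s) k 0 = reval s e.
Proof.
split; last by rewrite /= eqxx.
split => // k' kk /=; apply/funext => i.
by move: kk; rewrite inE => /negbTE ->.
Qed.

Lemma exec_RSet w k i e s : frame [::] [:: k] s (exec w (RSet k i e) s).
Proof.
split => // k' kk /=; apply/funext => j.
by move: kk; rewrite inE => /negbTE ->.
Qed.

Lemma exec_add_up w x q e a (f : nat -> R) s :
  (forall i s', (i < ieval s e)%N -> frame [:: x] [:: q] s s' -> ireg s' x = i ->
     reval s' a = f i) ->
  frame [:: x] [:: q] s (exec w (add_up x q e a) s) /\
  arr (exec w (add_up x q e a) s) q 0 = arr s q 0 + \sum_(i < ieval s e) f i.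
Proof.
move=> af; pose Inv i s' := frame [:: x] [:: q] s s' /\
  arr s' q 0 = arr s q 0 + \sum_(j < i) f j.
suff : Inv (ieval s e) (exec w (add_up x q e a) s) by [].
apply: exec_For_inv; first by split => //; rewrite big_ord0 addr0.
move=> i s' i_lt [Fs' As'].
have F1 : frame [:: x] [:: q] s (tick 1 (set_ireg x i s')).
  by apply: frame_set_ireg => //; rewrite inE.
have [F2 V2] := exec_put w q (RAdd (cell q) a) (tick 1 (set_ireg x i s')).
split.
  by apply: (frame_sub _ _ (frame_trans F1 F2)); rewrite /= !inE eqxx.
rewrite V2 [reval _ _]/= (af i)//=; last by rewrite eqxx.
by rewrite As' big_ord_recr /= addrA.
Qed.

Variables (m r : nat).
Notation I := ('I_m * 'I_r)%type.
Implicit Types (v : 'I_m -> R) (z : coordT R I).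

Definition input_is v s := forall i : 'I_m, arr s 0 i = v i.
Definition matrix_is z s := forall (i : 'I_m) (j : 'I_r), arr s 3 (i * r + j)%N = z (i, j).

Lemma exec_measure_vector w v s : ireg s 0 = m -> input_is v s ->
  frame [:: 4%N] [:: 6%N] s (exec w measure_vector s) /\
  arr (exec w measure_vector s) 6 0 = vec_len v.
Proof.
move=> sm sv; rewrite /measure_vector !exec_Seq.
set s1 := exec w (put 6 (RNat (INat 0))) s.
have [F1 V1] : frame [::] [:: 6%N] s s1 /\ arr s1 6 0 = _ := exec_put _ _ _ _.
(* Forgets how the state was computed, keeping its frame and value; this stops later simplifications
   from unfolding the execution. The same device recurs below. *)
move: s1 F1 V1 => s1 F1 V1.
set a := RMul (RGet 0 (IReg 4)) (RGet 0 (IReg 4)).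
set s2 := exec w (add_up 4 6 (IReg 0) a) s1.
have [F2 V2] : frame [:: 4%N] [:: 6%N] s1 s2 /\
    arr s2 6 0 = arr s1 6 0 + \sum_(i < ieval s1 (IReg 0)) arr s 0 i ^+ 2.
  apply: (@exec_add_up w 4 6 (IReg 0) a (fun i => arr s 0 i ^+ 2)) => i s' _ [_ A _] s'i.
  by rewrite /= s'i A// expr2; rewrite (frame_arr F1)//.
move: s2 F2 V2 => s2 F2 V2; have [F3 V3] := exec_put w 6 (RSqrt (cell 6)) s2.
split; first by apply: (frame_sub _ _ (frame_trans (frame_trans F1 F2) F3)).
rewrite [LHS]V3 /= V2 V1 /= add0r /vec_len; congr Num.sqrt.
rewrite (frame_reg F1)//.
by rewrite sm; apply: eq_bigr => i _; rewrite sv.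
Qed.

Lemma exec_combine_rows w v z s : ireg s 0 = m -> ireg s 2 = r ->
  input_is v s -> matrix_is z s ->
  let s' := exec w combine_rows s in
  [/\ frame [:: 4; 5]%N [:: 4; 7; 8]%N s s',
      forall j : 'I_r, arr s' 4 j = combo v z j & arr s' 7 0 = combo_len v z].
Proof.
move=> sm sr sv sz; rewrite /combine_rows !exec_Seq.
pose Y j : R := \sum_(i < m) arr s 0 i * arr s 3 (i * r + j)%N.
have YE (j : 'I_r) : Y j = combo v z j by apply: eq_bigr => i _; rewrite sv sz.
pose Inv j s' := [/\ frame [:: 4; 5]%N [:: 4; 7; 8]%N s s',
  forall j', (j' < j)%N -> arr s' 4 j' = Y j' & arr s' 7 0 = \sum_(j' < j) Y j' ^+ 2].
set s1 := exec w (put 7 _) s.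
have [F1 V1] : frame [::] [:: 7%N] s s1 /\ arr s1 7 0 = _ := exec_put _ _ _ _.
move: s1 F1 V1 => s1 F1 V1.
set loop := For _ _ _; set s2 := exec w loop s1.
suff [F2 A2 V2] : Inv (ieval s1 (IReg 2)) s2.
  have E : ieval s1 (IReg 2) = r by rewrite /=; rewrite (frame_reg F1)//.
  rewrite E in A2 V2; move: s2 F2 A2 V2 => s2 F2 A2 V2.
  have [F3 V3] := exec_put w 7 (RSqrt (cell 7)) s2.
  split.
  - by apply: (frame_sub _ _ (frame_trans F2 F3)).
  - move=> j; rewrite (frame_arr F3)//.
    by rewrite A2// YE.
  - rewrite [LHS]V3 /= V2 /combo_len; congr Num.sqrt.
    by apply: eq_bigr => j _; rewrite YE.
apply: exec_For_inv.
  split; [|by []|by rewrite big_ord0; exact: V1].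
  by apply: (frame_sub _ _ F1).
move=> j s' _ [Fs' A' V'].
set t0 := tick 1 _.
have G0 : frame [:: 4; 5]%N [:: 4; 7; 8]%N s t0 by apply: frame_set_ireg.
have t0j : ireg t0 5 = j by [].
have V0 : arr t0 7 0 = arr s' 7 0 by [].
have A0 j' : (j' < j)%N -> arr t0 4 j' = Y j' by exact: A'.
move: t0 G0 t0j V0 A0 => t0 G0 t0j V0 A0; rewrite !exec_Seq.
set t1 := exec w (put 8 _) t0.
have [G1 W1] : frame [::] [:: 8%N] t0 t1 /\ arr t1 8 0 = _ := exec_put _ _ _ _.
move: t1 G1 W1 => t1 G1 W1.
set a := RMul (RGet 0 _) _; set t2 := exec w (add_up 4 8 (IReg 0) a) t1.
have G01 := frame_trans G0 G1.
have [G2 W2] : frame [:: 4%N] [:: 8%N] t1 t2 /\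
    arr t2 8 0 = arr t1 8 0 + \sum_(i < ieval t1 (IReg 0)) arr s 0 i * arr s 3 (i * r + j)%N.
  apply: (@exec_add_up w 4 8 (IReg 0) a (fun i => arr s 0 i * arr s 3 (i * r + j)%N)) => i t' _ G ti.
  have [X1 X2 _] := frame_trans G01 G.
  rewrite /= ti !X2// X1// sr; congr (_ * arr s 3 (_ + _)).
  rewrite (frame_reg G)//.
  by rewrite (frame_reg G1)//.
move: t2 G2 W2 => t2 G2 W2; have W2' : arr t2 8 0 = Y j.
  rewrite W2 W1 /= add0r; rewrite (frame_reg G01)//.
  by rewrite sm.
set t3 := exec w (RSet 4 _ _) t2.
have G3 : frame [::] [:: 4%N] t2 t3 := exec_RSet _ _ _ _ _.
have [G4 W4] := exec_put w 7 (RAdd (cell 7) (RMul (cell 8) (cell 8))) t3.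
have t2j : ireg t2 5 = j.
  by rewrite (frame_reg G2)//; rewrite (frame_reg G1)//.
have G012 := frame_trans G01 G2.
split.
- by apply: (frame_sub _ _ (frame_trans (frame_trans G012 G3) G4)).
- move=> j' j'j; rewrite (frame_arr G4)//.
  rewrite /t3 /= t2j; case: (eqVneq j' j) => [->|ne]; first exact: W2'.
  rewrite (frame_arr G2)//; rewrite (frame_arr G1)//.
  by apply: A0; move: j'j; rewrite ltnS leq_eqVlt (negbTE ne).
- rewrite [LHS]W4 /= big_ord_recr /=.
  rewrite W2' expr2; congr (_ + _).
  rewrite (frame_arr G2)//; rewrite (frame_arr G1)//.
  by rewrite V0.
Qed.

Lemma exec_choose_angle w b l n u s : ireg s 2 = r -> arr s 5 0 = u ->
  arr s 6 0 = l -> arr s 7 0 = n -> arr s 9 0 = b ->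
  let s' := exec w choose_angle s in
  [/\ frame [::] [:: 10; 11; 12; 13]%N s s',
      arr s' 12 0 = swing (r := r) (b * l) (n / l) u &
      arr s' 13 0 = pull (r := r) (b * l) (n / l) u].
Proof.
move=> sr s5 s6 s7 s9; rewrite /choose_angle !exec_Seq.
set s1 := exec w (put 10 _) s.
have [F1 V1] : frame [::] [:: 10%N] s s1 /\ arr s1 10 0 = b * l.
  by have [F V] := exec_put w 10 (RMul (cell 9) (cell 6)) s; split => //; rewrite V /= s9 s6.
move: s1 F1 V1 => s1 F1 V1; set s2 := exec w (put 11 _) s1.
have [F2 V2] : frame [::] [:: 11%N] s1 s2 /\ arr s2 11 0 = n / l.
  have [F V] := exec_put w 11 (RDiv (cell 7) (cell 6)) s1.
  by split => //; rewrite V /= !(frame_arr F1)// s7 s6.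
move: s2 F2 V2 => s2 F2 V2.
have {}V1 : arr s2 10 0 = b * l by rewrite (frame_arr F2).
have {s1 F1} F2 := frame_trans F1 F2.
set chord := RSub _ (RDiv (RMul (cell 10) (cell 10)) _).
set s3 := exec w (put 12 chord) s2.
have [F3 V3] : frame [::] [:: 12%N] s2 s3 /\
    arr s3 12 0 = 1 - (b * l) ^+ 2 / (4 * (n / l) ^+ 2).
  have [F V] := exec_put w 12 chord s2.
  by split => //; rewrite V /= V1 V2 -!expr2.
move: s3 F3 V3 => s3 F3 V3.
have {}V1 : arr s3 10 0 = b * l by rewrite (frame_arr F3).
have {}V2 : arr s3 11 0 = n / l by rewrite (frame_arr F3).
have {s2 F2} F3 := frame_trans F2 F3.
set test := If _ _ _; set s4 := exec w test s3.
have [F4 V4] : frame [::] [:: 12%N] s3 s4 /\ arr s4 12 0 =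
    if (n / l < b * l) && (u <= accept (r := r) (b * l) (n / l)) then 0
    else 1 - (b * l) ^+ 2 / (4 * (n / l) ^+ 2).
  have aE : reval s3 accept_exp = accept (r := r) (b * l) (n / l).
    by rewrite /= V1 V2 (frame_reg F3)// sr subn1 -!expr2.
  have -> : s4 = let t := tick (bsize (RLe (cell 10) (cell 11))).+1 s3 in
    if b * l <= n / l then exec w Skip t else
    exec w (If (RLe (cell 5) accept_exp) (put 12 (RNat (INat 0))) Skip) t.
    by rewrite -V1 -V2.
  rewrite ltNge; case: (b * l <= n / l) => /=.
    by split=> //; do 2 apply: frame_tick; exact: frame_refl.
  rewrite (_ : arr s3 5 0 = u); last by rewrite (frame_arr F3).
  move: aE => /= ->; case: ifP => _; split=> //.
    by apply: frame_set_arr => //; do 2 apply: frame_tick; exact: frame_refl.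
move: s4 F4 V4 => s4 F4 V4; have {s3 F3 V1 V2 V3} F4 := frame_trans F3 F4.
set s5' := exec w (put 12 _) s4.
have [F5 V5] : frame [::] [:: 12%N] s4 s5' /\
    arr s5' 12 0 = swing (r := r) (b * l) (n / l) u.
  by have [F V] := exec_put w 12 (RSqrt (cell 12)) s4; split => //; rewrite V /= V4.
move: s5' F5 V5 => s5' F5 V5.
set last_exp := RSub _ _; have [F6 V6] := exec_put w 13 last_exp s5'.
split; first by apply: (frame_sub _ _ (frame_trans F4 (frame_trans F5 F6))).
  by rewrite (frame_arr F6).
by rewrite V6 /= V5 sub0r -expr2.
Qed.

Lemma exec_write_rotated w s :
  frame [:: 5%N] [:: 1%N] s (exec w write_rotated s) /\
  forall j, (j < 2 * ireg s 2)%N -> arr (exec w write_rotated s) 1 j =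
    (arr s 13 0 * arr s 4 j +
     arr s 12 0 * (if odd j then arr s 4 j.-1 else - arr s 4 j.+1)) / arr s 7 0.
Proof.
pose g (j : nat) := (arr s 13 0 * arr s 4 j +
  arr s 12 0 * (if odd j then arr s 4 j.-1 else - arr s 4 j.+1)) / arr s 7 0.
pose Inv l s' := frame [:: 5%N] [:: 1%N] s s' /\
  forall j, (j < 2 * l)%N -> arr s' 1 j = g j.
suff : Inv (ieval s (IReg 2)) (exec w write_rotated s) by [].
apply: exec_For_inv; first by split => // j; rewrite muln0.
move=> l s' _ [F A]; rewrite exec_Seq; split.
  by do 2 (apply: frame_set_arr => //); apply: frame_set_ireg.
have E4 : arr s' 4 = arr s 4 by rewrite (frame_arr F).
have E7 : arr s' 7 = arr s 7 by rewrite (frame_arr F).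
have E12 : arr s' 12 = arr s 12 by rewrite (frame_arr F).
have E13 : arr s' 13 = arr s 13 by rewrite (frame_arr F).
move=> j jl /=; rewrite !E4 !E7 !E12 !E13.
have od : odd (2 * l) = false by rewrite oddM.
case: eqP => [->|j1]; first by rewrite /g addn1 /= od.
case: eqP => [->|j2]; first by rewrite /g od mulrN addn1.
by apply: A; lia.
Qed.

Lemma exec_choose_output w b v u z s : ~~ odd r -> ireg s 2 = r ->
  arr s 5 0 = u -> arr s 6 0 = vec_len v -> arr s 7 0 = combo_len v z -> arr s 9 0 = b ->
  (forall j : 'I_r, arr s 4 j = combo v z j) ->
  let s' := exec w choose_output s in
  frame [:: 5%N] [:: 1; 10; 11; 12; 13]%N s s' /\
  forall j : 'I_r, arr s' 1 j = direction b v u z j.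
Proof.
move=> re sr s5 s6 s7 s9 s4 s'.
have -> : s' = let t := tick (bsize (RLe (cell 7) (RNat (INat 0)))).+1 s in
  if combo_len v z <= 0
  then exec w (For 5 (IReg 2) (RSet 1 (IReg 5) (RNat (ISub (INat 1) (IReg 5))))) t
  else exec w (Seq choose_angle write_rotated) t.
  by rewrite -s7.
move=> {s'}; set t := tick _ s; lazy zeta.
have t_r : ireg t 2 = r by [].
have t5 : arr t 5 0 = u by []. have t6 : arr t 6 0 = vec_len v by [].
have t7 : arr t 7 0 = combo_len v z by []. have t9 : arr t 9 0 = b by [].
have t4 (j : 'I_r) : arr t 4 j = combo v z j by exact: s4.
have Ft : frame [::] [::] s t by [].
move: t t_r t5 t6 t7 t9 t4 Ft => t t_r t5 t6 t7 t9 t4 Ft.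
rewrite /direction; case: ifP => _.
  pose Inv n s' := frame [:: 5%N] [:: 1%N] t s' /\
    forall j, (j < n)%N -> arr s' 1 j = (j == 0%N)%:R.
  suff [F A] : Inv (ieval t (IReg 2))
      (exec w (For 5 (IReg 2) (RSet 1 (IReg 5) (RNat (ISub (INat 1) (IReg 5))))) t).
    split; first by apply: (frame_sub _ _ (frame_trans Ft F)).
    by move=> j; apply: A; rewrite /= t_r.
  apply: exec_For_inv; first by split.
  move=> n s' _ [F A]; split; first by apply: frame_set_arr => //; apply: frame_set_ireg.
  (* Truncated subtraction: 1 - n is 1 for n = 0 and 0 otherwise, the entries of the first basis
     vector. *)
  move=> j jn /=; case: eqP => [->|ne]; first by case: n {A jn F}.
  by apply: A; lia.
rewrite exec_Seq.
have [F1 A12 A13] := exec_choose_angle w t_r t5 t6 t7 t9.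
move: (exec w choose_angle t) F1 A12 A13 => t1 F1 A12 A13.
have [F2 A2] := exec_write_rotated w t1.
split; first by apply: (frame_sub _ _ (frame_trans Ft (frame_trans F1 F2))).
move=> j; rewrite A2; last first.
  by rewrite (frame_reg F1)// t_r; have := ltn_ord j; lia.
rewrite A12 A13 (frame_arr (k := 4) F1)// (frame_arr (k := 7) F1)// t7 t4 /Jrow.
congr ((_ + _ * _) / _); rewrite -t4 val_twin//.
by case: (odd j).
Qed.

Lemma exec_move_matrix w s : ireg s 0 = m -> ireg s 2 = r ->
  frame [:: 4; 5]%N [:: 3%N] s (exec w move_matrix s) /\
  forall i j, (i < m)%N -> (j < r)%N -> arr (exec w move_matrix s) 3 (i * r + j)%N =
    arr s 3 (i * r + j)%N + arr s 9 0 * arr s 0 i * arr s 1 j.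
Proof.
move=> sm sr; pose new (i j : nat) :=
  arr s 3 (i * r + j)%N + arr s 9 0 * arr s 0 i * arr s 1 j.
have index_inj i j i' j' : (j < r)%N -> (j' < r)%N ->
    (i * r + j)%N = (i' * r + j')%N -> i = i' /\ j = j'.
  move=> jr jr' E; have r0 : (0 < r)%N by case: (r) jr.
  have := congr1 (fun k => k %/ r)%N E; have := congr1 (fun k => k %% r)%N E.
  by rewrite !modnMDl !modn_small// !divnMDl// !divn_small// !addn0.
(* Entries updated before (i, j), in lexicographic order. An inner loop ends at (i, r), which for
   column indices below r means the same as (i + 1, 0). *)
pose done i j i' j' := (i' < i)%N || (i' == i) && (j' < j)%N.
pose Inv i j s' := frame [:: 4; 5]%N [:: 3%N] s s' /\
  forall i' j', (j' < r)%N -> arr s' 3 (i' * r + j')%N =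
    if done i j i' j' then new i' j' else arr s 3 (i' * r + j')%N.
suff [F A] : Inv (ieval s (IReg 0)) 0%N (exec w move_matrix s).
  split => // i j im jr; rewrite A// /done /= sm im //.
have InvE i j i' j' s' : (forall k l, (l < r)%N -> done i j k l = done i' j' k l) ->
    Inv i j s' -> Inv i' j' s'.
  by move=> H [F A]; split => // k l lr; rewrite A// H.
apply: (@exec_For_inv _ w 4 (IReg 0) _ s (fun i => Inv i 0%N)).
  by split => // i' j' jr; rewrite /done ltn0 andbF.
move=> i s' _ [F A].
set t := tick 1 _.
have [Ft At] : Inv i 0%N t /\ ireg t 4 = i.
  by split => //; split; [apply: frame_set_ireg|exact: A].
have tr : ireg t 2 = r by rewrite (frame_reg Ft.1).
apply: (InvE i r); last first.
  rewrite -tr -[ireg t 2]/(ieval t (IReg 2)).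
  set c := RSet _ _ _.
  suff : Inv i (ieval t (IReg 2)) (exec w (For 5 (IReg 2) c) t) /\
      ireg (exec w (For 5 (IReg 2) c) t) 4 = i by case.
  apply: (@exec_For_inv _ w 5 (IReg 2) c t (fun j s' => Inv i j s' /\ ireg s' 4 = i)).
    by split.
  move=> j t' jr [[Ft' At'] t'4]; rewrite [ieval _ _]tr in jr; split=> //; split.
    by apply: frame_set_arr => //; apply: frame_set_ireg.
  move=> i' j' jr' /=; rewrite t'4 (frame_reg Ft')// sr.
  rewrite (frame_arr (k := 9) Ft')// (frame_arr (k := 0) Ft')// (frame_arr (k := 1) Ft')//.
  case: eqP => [/(index_inj _ _ _ _ jr' jr)[-> ->]|ne].
    by rewrite /done eqxx ltnSn orbT At'// /done eqxx !ltnn.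
  rewrite At'// /done ltnS; case: (ltngtP i' i) => //= E.
  by rewrite [(j' <= j)%N]leq_eqVlt; case: eqP => // jj; rewrite E jj in ne.
move=> k l lr; rewrite /done lr ltn0 andbT andbF orbF ltnS.
by rewrite orbC -leq_eqVlt.
Qed.

Definition initial_matrix w : coordT R I := fun k => w Gauss (k.1 * r + k.2)%N.

Lemma exec_draw_matrix_first w s : ireg s 0 = m -> ireg s 2 = r -> ireg s 3 = 0%N ->
  drawn s Gauss = 0%N ->
  let s' := exec w draw_matrix s in
  [/\ forall x, (x < 3)%N -> ireg s' x = ireg s x, ireg s' 3 = 1%N,
      arr s' 0 = arr s 0, drawn s' Unif = drawn s Unif & matrix_is (initial_matrix w) s'].
Proof.
move=> sm sr s3 sG; rewrite /= s3 /=.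
set t := tick _ s.
pose Inv n s' := [/\ forall x, (x < 3)%N -> ireg s' x = ireg s x, arr s' 0 = arr s 0,
  drawn s' Unif = drawn s Unif, drawn s' Gauss = n &
  forall k, (k < n)%N -> arr s' 3 k = w Gauss k].
have : Inv (ieval t (IMul (IReg 0) (IReg 2)))
    (exec w (For 4 (IMul (IReg 0) (IReg 2)) (Draw Gauss 3 (IReg 4))) t).
  apply: exec_For_inv; first by split.
  move=> n s' _ [H0 H1 H2 H3 H4]; split => //=.
  - move=> x x3; case: eqP => [xE|_]; last exact: H0.
    by rewrite xE in x3.
  - by rewrite H3.
  - move=> k kn; case: eqP => [->|ne]; first by rewrite H3.
    by apply: H4; lia.
rewrite /=; move: (foldl _ _ _) => s' [H0 H1 H2 H3 H4].
rewrite sm sr in H3 H4; split => //.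
  by move=> x x3 /=; case: eqP => [xE|_]; [rewrite xE in x3|exact: H0].
move=> i j /=; rewrite H4//.
have := ltn_ord i; have := ltn_ord j; nia.
Qed.

Lemma exec_draw_matrix_later w s : ireg s 3 = 1%N ->
  exec w draw_matrix s = tick 1 (tick 4 s).
Proof. by rewrite /= => ->. Qed.

(** Stated relative to the state after [draw_matrix], so that the first round and the later ones
    share one proof. *)
Lemma exec_walk_program w b v z s s0 : ~~ odd r -> b = 2 * Num.sqrt r.-1%:R ->
  ireg s0 0 = m -> ireg s0 2 = r -> input_is v s0 -> matrix_is z s0 ->
  exec w draw_matrix s = s0 ->
  let s' := exec w walk_program s in
  let u := w Unif (drawn s0 Unif) in
  [/\ forall x, (x < 4)%N -> ireg s' x = ireg s0 x,
      drawn s' Unif = (drawn s0 Unif).+1,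
      forall j : 'I_r, arr s' 1 j = direction b v u z j &
      matrix_is (walk_step b v u z) s'].
Proof.
move=> re bE sm sr sv sz s0E s' u; 
have {s' s0E} -> : s' = exec w move_matrix (exec w choose_output
    (exec w (put 9 (RMul (RNat (INat 2)) (RSqrt rank_pred)))
    (exec w combine_rows (exec w measure_vector
    (exec w (Draw Unif 5 (INat 0)) s0))))).
  rewrite /s' /walk_program (exec_Seq w draw_matrix) s0E (exec_Seq w (Draw Unif 5 _)).
  rewrite (exec_Seq w measure_vector) (exec_Seq w combine_rows).
  by rewrite (exec_Seq w (put 9 _)) (exec_Seq w choose_output).
set s1 := exec w (Draw Unif 5 (INat 0)) s0.
have A1 k : k \notin [:: 5%N] -> arr s1 k = arr s0 k.
  rewrite inE => k5; apply/funext => j /=; by rewrite (negbTE k5).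
have [r1 d1 U1] : [/\ ireg s1 = ireg s0, drawn s1 Unif = (drawn s0 Unif).+1 &
  arr s1 5 0 = u] by [].
move: s1 A1 r1 d1 U1 => s1 A1 r1 d1 U1.
have v1 : input_is v s1 by move=> i; rewrite A1.
have z1 : matrix_is z s1 by move=> i j; rewrite A1.
rewrite -r1 in sm sr.
have [F2 V2] := exec_measure_vector w sm v1.
move: (exec w measure_vector s1) F2 V2 => s2 F2 V2.
have m2 : ireg s2 0 = m by rewrite (frame_reg F2).
have r2 : ireg s2 2 = r by rewrite (frame_reg F2).
have v2 : input_is v s2 by move=> i; rewrite (frame_arr F2).
have z2 : matrix_is z s2 by move=> i j; rewrite (frame_arr F2).
have [F3 C3 V3] := exec_combine_rows w m2 r2 v2 z2.
move: (exec w combine_rows s2) F3 C3 V3 => s3 F3 C3 V3.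
set e9 := RMul _ _; have [F4 V4] := exec_put w 9 e9 s3.
move: (exec w (put 9 e9) s3) F4 V4 => s4 F4 V4.
have {}V4 : arr s4 9 0 = b.
  by rewrite V4 bE /= (frame_reg F3)// r2 subn1.
have F14 := frame_trans F2 (frame_trans F3 F4).
have m4 : ireg s4 0 = m by rewrite (frame_reg F14).
have r4 : ireg s4 2 = r by rewrite (frame_reg F14).
have U4 : arr s4 5 0 = u by rewrite (frame_arr F14).
have l4 : arr s4 6 0 = vec_len v by rewrite (frame_arr F4)// (frame_arr F3).
have n4 : arr s4 7 0 = combo_len v z by rewrite (frame_arr F4).
have c4 (j : 'I_r) : arr s4 4 j = combo v z j by rewrite (frame_arr F4).
have [F5 O5] := exec_choose_output w re r4 U4 l4 n4 V4 c4.
move: (exec w choose_output s4) F5 O5 => s5 F5 O5.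
have F15 := frame_trans F14 F5.
have m5 : ireg s5 0 = m by rewrite (frame_reg F15).
have r5 : ireg s5 2 = r by rewrite (frame_reg F15).
have [F6 M6] := exec_move_matrix w m5 r5.
have F16 := frame_trans F15 F6.
split.
- move=> x x4; rewrite -r1 (frame_reg F16)//.
  by move: x4; do 4 (case: x => [//|x]).
- by case: F16 => _ _ ->.
- by move=> j; rewrite (frame_arr F6)// O5.
- move=> i j; rewrite M6// /walk_step /= O5 (frame_arr (k := 3) F15)// z1.
  by rewrite (frame_arr (k := 9) F5)// V4 (frame_arr (k := 0) F15)// v1.
Qed.

End Correctness.

(** * The online process *)

Section Online.
Context {R : realType} {m r : nat}.
Hypotheses (r_gt0 : (0 < r)%N) (r_even : ~~ odd r).
Notation I := ('I_m * 'I_r)%type.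
Implicit Types (w : tape R) (z : coordT R I) (x : 'rV[R]_m).

Definition gain : R := 2 * Num.sqrt r.-1%:R.

Lemma sum_sqr_direction b (v : 'I_m -> R) u z : \sum_j direction b v u z j ^+ 2 = 1.
Proof.
rewrite /direction; case: (boolP (combo_len v z <= 0)) => [_|n0].
  rewrite (bigD1 (Ordinal r_gt0))//= expr1n big1 ?addr0// => j.
  by rewrite -val_eqE /= => /negbTE ->; rewrite expr0n.
under eq_bigr do rewrite expr_div_n.
rewrite -mulr_suml sum_sqr_mixed_Jrow// pull_swing mul1r.
have c0 : 0 < combo_len v z by rewrite ltNge n0.
rewrite -[X in X / _]sqr_sqrtr ?divff ?expf_neq0 ?gt_eqF//.
by apply: sumr_ge0 => j _; exact: sqr_ge0.
Qed.

Variables (T : nat) (eps delta : R).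

(** Before the first round the matrix is not in memory yet, but the tape already determines it. *)
Definition ready w t z (s : state R) :=
  [/\ forall k, (k < 3)%N -> ireg s k = dimensions m T r k, drawn s Unif = t &
   (ireg s 3 = 0%N /\ drawn s Gauss = 0%N /\ z = initial_matrix w) \/
   (ireg s 3 = 1%N /\ matrix_is z s)].

Lemma play_round_walk w t z s x : (0 < m)%N -> ready w t z s ->
  let s' := play_round w walk_program s x in
  [/\ ready w t.+1 (walk_step gain (x 0) (w Unif t) z) s',
      forall j : 'I_r, arr s' 1 j = direction gain (x 0) (w Unif t) z j &
      (clock s' <= 300 * (m * r))%N].
Proof.
move=> m0 [sd su sz] s'.
have xs : input_is (x 0) (receive x s).
  by move=> i; rewrite /= (_ : insub (i : nat) = Some i)//; exact: valK.
have [m_s r_s] : ireg (receive x s) 0 = m /\ ireg (receive x s) 2 = r.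
  by split; [rewrite (sd 0%N)|rewrite (sd 2)].
set s0 := exec w draw_matrix (receive x s).
have [d0 k0 u0 v0 z0] : [/\ forall k, (k < 3)%N -> ireg s0 k = dimensions m T r k,
    ireg s0 3 = 1%N, drawn s0 Unif = t, input_is (x 0) s0 & matrix_is z s0].
  case: sz => [[s3 [sg ->]]|[s3 zs]].
    have [h0 h1 h2 h3 h4] := exec_draw_matrix_first w m_s r_s s3 sg.
    split => //; first by move=> k k3; rewrite h0// sd.
    - by rewrite -su; exact: h3.
    - by move=> i; rewrite h2.
  have E : s0 = tick 1 (tick 4 (receive x s)) by exact: exec_draw_matrix_later.
  by rewrite E; split.
have m_s0 : ireg s0 0 = m by rewrite d0.
have r_s0 : ireg s0 2 = r by rewrite d0.
have [H1 H2 H3 H4] := exec_walk_program r_even erefl m_s0 r_s0 v0 z0 erefl.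
rewrite u0 in H2 H3 H4.
split.
- split => //; first by move=> k k3; rewrite H1 ?d0// ltnW.
  by right; split => //; rewrite H1.
- exact: H3.
have [_ C] := @clock_exec R (dimensions m T r) w _ (receive x s) walk_program_disciplined sd.
exact: leq_trans C (walk_program_time_bound T m0 r_gt0).
Qed.

Variable v : T.-tuple 'rV[R]_m.
Hypothesis m_gt0 : (0 < m)%N.

Definition vec (t : nat) : 'I_m -> R := (nth 0 v t) 0.

(** The matrices Z_t as functions of the tape, free of the program. *)
Fixpoint walk w t : coordT R I :=
  if t is t'.+1 then walk_step gain (vec t') (w Unif t') (walk w t')
  else initial_matrix w.

Lemma final_state_take w t : (t < T)%N ->
  final_state walk_program T r eps delta w (take t.+1 v) =
  play_round w walk_program (final_state walk_program T r eps delta w (take t v)) (nth 0 v t).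
Proof.
by move=> tT; rewrite (take_nth 0) ?size_tuple// /final_state foldl_rcons.
Qed.

Lemma ready_final_state w t : (t <= T)%N ->
  ready w t (walk w t) (final_state walk_program T r eps delta w (take t v)).
Proof.
elim: t => [_|t IH tT].
  rewrite take0; split => //; by left.
rewrite final_state_take//.
by have [] := play_round_walk (nth 0 v t) m_gt0 (IH (ltnW tT)).
Qed.

Lemma output_walk w (t : 'I_T) :
  output walk_program r eps delta w v t =
  \row_j direction gain (vec t) (w Unif t) (walk w t) j.
Proof.
apply/rowP => j; rewrite !mxE final_state_take//.
by have [_ -> _] := play_round_walk (nth 0 v t) m_gt0 (ready_final_state w (ltnW (ltn_ord t))).
Qed.

Lemma l2norm_output w (t : 'I_T) : l2norm (output walk_program r eps delta w v t) = 1.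
Proof.
rewrite output_walk /l2norm; under eq_bigr do rewrite mxE.
by rewrite sum_sqr_direction sqrtr1.
Qed.

Lemma round_time_walk w (t : 'I_T) :
  (round_time walk_program r eps delta w v t <= 300 * (m * r))%N.
Proof.
rewrite /round_time /last_round_time final_state_take//.
by have [] := play_round_walk (nth 0 v t) m_gt0 (ready_final_state w (ltnW (ltn_ord t))).
Qed.

Lemma walk_sum w t (i : 'I_m) (j : 'I_r) : walk w t (i, j) - walk w 0 (i, j) =
  gain * \sum_(s < t) vec s i * direction gain (vec s) (w Unif s) (walk w s) j.
Proof.
elim: t => [|t IH]; first by rewrite subrr big_ord0 mulr0.
rewrite big_ord_recr mulrDr -IH /= [X in X - _]/walk_step /=; ring.
Qed.

Lemma prefix_sum w (t : 'I_T) (i : 'I_m) :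
  \sum_(s < T | (s <= t)%N) tnth v s 0 i *: output walk_program r eps delta w v s =
  \row_j \sum_(s < t.+1) vec s i * direction gain (vec s) (w Unif s) (walk w s) j.
Proof.
apply/rowP => j; rewrite summxE mxE.
rewrite (big_ord_widen_cond T xpredT
  (fun s => vec s i * direction gain (vec s) (w Unif s) (walk w s) j))//.
apply: eq_big => [s|s _]; first by rewrite ltnS.
by rewrite output_walk !mxE /vec (tnth_nth 0).
Qed.

Lemma discrepancy_le w : 0 <= eps -> (1 < r)%N ->
  (forall t (i : 'I_m), (t <= T)%N -> row2 i (walk w t) <= r.-1%:R * (1 + eps) ^+ 2) ->
  discrepancy walk_program r eps delta w v <= 1 + eps.
Proof.
move=> e0 r1 H.
have e1 : 0 <= 1 + eps by rewrite addr_ge0.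
apply: bigmax_le => // t _; apply: bigmax_le => // i _; rewrite prefix_sum.
rewrite -(ger0_norm e1) -sqrtr_sqr ler_wsqrtr//.
have p0 : 0 < r.-1%:R :> R by rewrite ltr0n -subn1 subn_gt0.
have g2 : gain ^+ 2 = 4 * r.-1%:R.
  by rewrite exprMn sqr_sqrtr ?ler0n//; congr (_ * _); ring.
rewrite -(@ler_pM2l _ (4 * r.-1%:R)) ?mulr_gt0//.
have -> : 4 * r.-1%:R * \sum_j ((\row_j \sum_(s < t.+1) vec s i *
      direction gain (vec s) (w Unif s) (walk w s) j) 0 j : R) ^+ 2 =
    \sum_j (walk w t.+1 (i, j) - walk w 0 (i, j)) ^+ 2.
  rewrite -g2 mulr_sumr; apply: eq_bigr => j _.
  by rewrite walk_sum mxE [RHS]exprMn.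
(* Each of the two rows has squared length at most (r - 1) (1 + eps)^2, so the sum is at most
   [gain]^2 (1 + eps)^2. *)
apply: (@le_trans _ _ (2 * row2 i (walk w t.+1) + 2 * row2 i (walk w 0%N))).
  rewrite /row2 !mulr_sumr -big_split /=; apply: ler_sum => j _.
  have sqr_sub_le (a b : R) : (a - b) ^+ 2 <= 2 * a ^+ 2 + 2 * b ^+ 2.
    by have := sqr_ge0 (a + b); nra.
  exact: sqr_sub_le.
have := H t.+1 i (ltn_ord t); have := H 0%N i (leq0n T).
set A := row2 _ _; set B := row2 _ _; set C := (1 + eps) ^+ 2; lra.
Qed.

(* With T = 1 the logarithm in the rank may be too small for the union bound. *)
Lemma discrepancy_le1 w : T = 1%N -> (forall t, l2norm (tnth v t) <= 1) ->
  discrepancy walk_program r eps delta w v <= 1.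
Proof.
move=> T1 v1; apply: bigmax_le => // t _; apply: bigmax_le => // i _.
have -> : \sum_(s < T | (s <= t)%N) tnth v s 0 i *: output walk_program r eps delta w v s =
    tnth v t 0 i *: output walk_program r eps delta w v t.
  have all_t (s : 'I_T) : s = t.
    by apply: val_inj => /=; have := ltn_ord s; have := ltn_ord t; lia.
  rewrite (bigD1 t)//= big1 ?addr0// => s /andP[_]; by rewrite (all_t s) eqxx.
have -> : l2norm (tnth v t 0 i *: output walk_program r eps delta w v t) = `|tnth v t 0 i|.
  rewrite -[RHS]mulr1 -(l2norm_output w t) /l2norm -sqrtr_sqr -sqrtrM ?sqr_ge0//.
  by congr Num.sqrt; rewrite mulr_sumr; apply: eq_bigr => j _; rewrite mxE exprMn.
apply: le_trans (v1 t); rewrite -sqrtr_sqr ler_wsqrtr//.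
by rewrite (bigD1 i)//= lerDl sumr_ge0// => k _; exact: sqr_ge0.
Qed.

End Online.

(** * Law of the walk and union bound *)

Section Law.
Context {R : realType} {m r : nat}.
Notation I := ('I_m * 'I_r)%type.
Notation W := (coordT R (source * nat)%type).
Hypotheses (r_gt0 : (0 < r)%N) (r_even : ~~ odd r).
Context {d : measure_display} {Omega : measurableType d} {P : probability Omega R}.
Variable X : source -> nat -> {RV P >-> R}.
Hypothesis hX : random_source X.
Variables (T : nat) (v : T.-tuple 'rV[R]_m).
Hypothesis v_le1 : forall t, l2norm (tnth v t) <= 1.

Let Y (qk : source * nat) := X qk.1 qk.2.
Let samples (o : Omega) : W := jointly Y o.

Definition tape_at (w : W) : tape R := fun q k => w (q, k).
Definition walk_at (t : nat) (w : W) : coordT R I := walk v (tape_at w) t.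

Local Open Scope ereal_scope.

Lemma measurable_walk_at t : measurable_fun setT (walk_at t).
Proof.
elim: t => [|t IH].
  by apply: measurable_to_coord => k; exact: measurable_coord.
have mp : measurable_fun setT (fun w : W => (walk_at t w, w (Unif, t)) : coordT R I * R).
  by apply: measurable_fun_pair => //; exact: measurable_coord.
exact: (measurableT_comp (measurable_walk_step (gain (r := r)) (vec v t)) mp).
Qed.

(** Z_s reads only uniform samples of index below s, so sample t is still fresh at time t. *)
Lemma walk_at_upd s t u (w : W) : (s <= t)%N ->
  walk_at s (upd w (Unif, t) u) = walk_at s w.
Proof.
elim: s => [_|s IH st].
  by apply/funext => k; rewrite /walk_at /= /initial_matrix /tape_at /upd xpair_eqE.
have := IH (ltnW st); rewrite /walk_at /= => ->; congr walk_step.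
by rewrite /tape_at /upd xpair_eqE ltn_eqF// andbF.
Qed.

Lemma measurable_samples : measurable_fun setT samples.
Proof. exact: measurable_jointly. Qed.

Let m_walk t : measurable_fun setT (fun o => walk_at t (samples o)).
Proof. exact: measurableT_comp (measurable_walk_at t) measurable_samples. Qed.

Let Z0 : {RV P >-> coordT R I} :=
  HB.pack (fun o => walk_at 0 (samples o)) (isMeasurableFun.Build _ _ _ _ _ (m_walk 0)).

Let mu := distribution P Z0.

Let integral_mu (F : coordT R I -> \bar R) : measurable_fun setT F -> (forall z, 0 <= F z) ->
  \int[mu]_z F z = \int[P]_o F (walk_at 0 (samples o)).
Proof. by move=> mF F0; rewrite (ge0_integral_pushT (m_walk 0) _ mF F0). Qed.

Let resample_gauss k (G : W -> \bar R) : measurable_fun setT G -> (forall w, 0 <= G w) ->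
  \int[P]_o G (samples o) = \int[P]_o \int[@std_normal R]_x G (upd (samples o) (Gauss, k) x).
Proof.
move=> mG G0; rewrite /samples (jointly_resample (source_indep hX) (Gauss, k) mG G0).
apply: eq_integral => o _.
apply: eq_measure_integral => A mA _; exact: (gauss_law hX).
Qed.

Let resample_unif k (G : W -> \bar R) : measurable_fun setT G -> (forall w, 0 <= G w) ->
  \int[P]_o G (samples o) = \int[P]_o \int[@std_uniform R]_x G (upd (samples o) (Unif, k) x).
Proof.
move=> mG G0; rewrite /samples (jointly_resample (source_indep hX) (Unif, k) mG G0).
apply: eq_integral => o _.
apply: eq_measure_integral => A mA _; exact: (unif_law hX).
Qed.

(** Row-major indexing is injective, so resampling an entry of the matrix amounts to resampling one
    cell of the tape. *)
Lemma gaussian_initial : gaussian mu.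
Proof.
move=> k F mF F0; rewrite (integral_mu mF F0).
pose G w := F (walk_at 0 w).
have mG : measurable_fun setT G := measurableT_comp mF (measurable_walk_at 0).
rewrite -[LHS]/(\int[P]_o G (samples o)).
rewrite (resample_gauss (k.1 * r + k.2)%N mG (fun=> F0 _)) /=.
rewrite integral_mu; last 2 first.
- apply: (measurable_ge0_integral2 (fun (z : coordT R I) (x : R) => F (upd z k x))) => //.
  exact: (measurableT_comp mF (measurable_upd k)).
- by move=> z; apply: integral_ge0 => x _; exact: F0.
apply: eq_integral => o _; apply: eq_integral => x _; congr F.
apply/funext => l; rewrite /walk_at /= /initial_matrix /tape_at /upd xpair_eqE /=.
suff -> : (l.1 * r + l.2 == k.1 * r + k.2)%N = (l == k) by [].
case: l k => [i j] [i' j']; apply/eqP/eqP => [|[-> ->]//].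
move=> /= E; congr pair; apply: val_inj.
  have := congr1 (fun n => n %/ r)%N E.
  by rewrite !divnMDl// !divn_small// !addn0.
have := congr1 (fun n => n %% r)%N E.
by rewrite !modnMDl !modn_small.
Qed.

Lemma vec_len_le1 t : (t < T)%N -> (vec_len (vec v t) <= 1)%R.
Proof.
by move=> tT; have := v_le1 (Ordinal tT); rewrite (tnth_nth 0%R).
Qed.

(** Resampling the fresh uniform sample replaces F by its average over one step, a function of Z_t
    to which the induction hypothesis applies; [walk_step_preserves] then removes the average. *)
Lemma walk_at_law t (F : coordT R I -> \bar R) : (1 < r)%N -> (t <= T)%N ->
  measurable_fun setT F -> (forall z, 0 <= F z) ->
  \int[P]_o F (walk_at t (samples o)) = \int[mu]_z F z.
Proof.
move=> r1; elim: t F => [|t IH] F tT mF F0; first by rewrite (integral_mu mF F0).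
pose G w := F (walk_at t.+1 w).
have mG : measurable_fun setT G := measurableT_comp mF (measurable_walk_at t.+1).
rewrite -[LHS]/(\int[P]_o G (samples o)).
rewrite (resample_unif t mG (fun=> F0 _)) /=.
pose H (z : coordT R I) := \int[@std_uniform R]_u F (walk_step (gain (r := r)) (vec v t) u z).
have mH : measurable_fun setT H.
  apply: (measurable_ge0_integral2
    (fun (z : coordT R I) (u : R) => F (walk_step (gain (r := r)) (vec v t) u z))) => //.
  exact: (measurableT_comp mF (measurable_walk_step (gain (r := r)) (vec v t))).
have H0 z : 0 <= H z by apply: integral_ge0 => u _; exact: F0.
have p0 : (0 < r.-1%:R :> R)%R by rewrite ltr0n -subn1 subn_gt0.
have g0 : (0 < gain (r := r) :> R)%R by rewrite mulr_gt0 ?sqrtr_gt0.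
have g2 : ((gain (r := r) * vec_len (vec v t)) ^+ 2 <= 4 * r.-1%:R :> R)%R.
  have -> : (4 * r.-1%:R = gain (r := r) ^+ 2 :> R)%R.
    by rewrite exprMn sqr_sqrtr ?ler0n//; congr (_ * _)%R; ring.
  rewrite exprMn ler_piMr ?sqr_ge0// exprn_ile1 ?sqrtr_ge0//.
  exact: vec_len_le1.
rewrite -(walk_step_preserves gaussian_initial r_gt0 r_even g0 g2 mF F0).
rewrite -[RHS](IH H (ltnW tT) mH H0).
apply: eq_integral => o _; apply: eq_integral => u _; rewrite /G.
have := walk_at_upd u (samples o) (leqnn t); rewrite /walk_at /= => ->.
by rewrite /tape_at /upd eqxx.
Qed.

Lemma walk_at_tail t (i : 'I_m) (e : R) : (1 < r)%N -> (t <= T)%N -> (0 <= e)%R ->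
  let A := [set o | (r.-1%:R * (1 + e) ^+ 2 < row2 i (walk_at t (samples o)))%R] in
  measurable A /\ P A <= (expR (e - r.-1%:R * e ^+ 2 / 2))%:E.
Proof.
move=> r1 tT e0 A; pose B := [set z : coordT R I | (r.-1%:R * (1 + e) ^+ 2 < row2 i z)%R].
have mB : measurable B := measurable_row2_gt i _.
have mA : measurable A.
  by have := m_walk t measurableT mB; rewrite setTI; exact.
split => //; apply: le_trans (row2_tail gaussian_initial i e0 r_gt0).
have mF : measurable_fun setT (fun z => (\1_B z)%:E : \bar R).
  by apply/measurable_EFinP; exact: measurable_indic.
have F0 z : 0 <= (\1_B z)%:E :> \bar R by rewrite lee_fin.
have -> : P A = \int[P]_o (\1_B (walk_at t (samples o)))%:E.
  transitivity (\int[P]_o (\1_A o)%:E); first by rewrite integral_indic// setIT.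
  apply: eq_integral => o _; congr EFin; rewrite !indicE.
by rewrite (walk_at_law r1 tT mF F0) integral_indic// setIT.
Qed.

Lemma union_bound n (A : nat -> set Omega) (q : R) :
  (forall k, (k < n)%N -> measurable (A k)) -> (forall k, (k < n)%N -> P (A k) <= q%:E) ->
  measurable (\big[setU/set0]_(k < n) A k) /\
  P (\big[setU/set0]_(k < n) A k) <= (n%:R * q)%:E.
Proof.
move=> mA qA; split; first by apply: bigsetU_measurable => k _; exact: mA.
apply: le_trans (Boole_inequality P mA) _.
apply: (@le_trans _ _ (\sum_(k < n) q%:E)).
  by apply: lee_sum => k _; exact: qA.
by rewrite sumEFin sumr_const card_ord mulr_natl.
Qed.

Lemma measurable_bigmax n (f : 'I_n -> Omega -> R) :
  (forall k, measurable_fun setT (f k)) ->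
  measurable_fun setT (fun o => \big[Num.max/0%R]_(k < n) f k o).
Proof.
move=> mf; elim: (index_enum _) => [|k s IH].
  by under eq_fun do rewrite big_nil; exact: measurable_cst.
by under eq_fun do rewrite big_cons; apply: measurable_maxr.
Qed.

Lemma measurable_discrepancy (eps delta : R) : (0 < m)%N ->
  measurable_fun setT (fun o => discrepancy walk_program r eps delta (tape_of X o) v).
Proof.
move=> m0; rewrite /discrepancy.
apply: measurable_bigmax => t; apply: measurable_bigmax => i.
under eq_fun do rewrite prefix_sum//.
rewrite /l2norm; apply: measurable_fun_sqrt; apply: measurable_sum => j.
apply: measurable_funX; under eq_fun do rewrite mxE.
apply: measurable_sum => s; apply: measurable_funM; first exact: measurable_cst.
have mp : measurable_fun setT (fun o =>
    (walk_at s (samples o), samples o (Unif, s : nat)) : coordT R I * R).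
  apply: measurable_fun_pair; first exact: m_walk.
  exact: (measurableT_comp (measurable_coord _) measurable_samples).
exact: (measurableT_comp (measurable_direction gain (vec v s) j) mp).
Qed.

Lemma discrepancy_probability (eps delta : R) : (1 < r)%N -> (0 < m)%N -> (0 <= eps)%R ->
  ((m * T.+1)%:R * expR (eps - r.-1%:R * eps ^+ 2 / 2) <= delta)%R ->
  (1 - delta)%:E <=
  P [set o | (discrepancy walk_program r eps delta (tape_of X o) v <= 1 + eps)%R].
Proof.
move=> r1 m0 e0; set q := expR _ => q_le.
pose bad t i := [set o | (r.-1%:R * (1 + eps) ^+ 2 < row2 i (walk_at t (samples o)))%R].
pose bad_t t := \big[setU/set0]_(k < m) (if insub (k : nat) is Some i then bad t i else set0).
(* There are T + 1 times: Z_0 counts as well, since the partial sums are differences from it. *)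
pose bad_all := \big[setU/set0]_(t < T.+1) bad_t t.
have tail t (tT : (t < T.+1)%N) : measurable (bad_t t) /\ P (bad_t t) <= (m%:R * q)%:E.
  apply: (@union_bound m (fun k => if insub k is Some i then bad t i else set0)) => k km.
    by rewrite (insubT (fun k => k < m)%N km); have [] := walk_at_tail (Sub k km) r1 tT e0.
  by rewrite (insubT (fun k => k < m)%N km); have [] := walk_at_tail (Sub k km) r1 tT e0.
have [mbad Pbad] : measurable bad_all /\ P bad_all <= (T.+1%:R * (m%:R * q))%:E.
  by apply: union_bound => t tT; have [] := tail t tT.
have mE : measurable [set o |
    (discrepancy walk_program r eps delta (tape_of X o) v <= 1 + eps)%R].
  have mD := measurable_discrepancy eps delta m0.
  have mb : measurable_fun setT (fun o =>
    (discrepancy walk_program r eps delta (tape_of X o) v <= 1 + eps)%R) by meas.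
  have mtrue : measurable ([set true] : set bool) by [].
  have := mb measurableT [set true] mtrue; rewrite setTI; exact.
apply: (@le_trans _ _ (P (~` bad_all))).
  rewrite probability_setC// EFinB leeB//; apply: le_trans Pbad _.
  by rewrite lee_fin mulrA -natrM mulnC.
apply: le_measure; rewrite ?inE//; first exact: measurableC.
move=> o /= good; apply: discrepancy_le => // t i tT.
rewrite leNgt; apply/negP => badi; apply: good.
rewrite /bad_all (bigD1 (Ordinal (n := T.+1) tT))//=; left.
rewrite /bad_t (bigD1 i)//= valK; by left.
Qed.

End Law.

Theorem theorem11 (R : realType) :
  exists (c1 c2 K : R) (A : cmd),
    [/\ 0 < c1, 0 < c2, 0 < K &
    forall (eps delta : R) (m T : nat),
      0 < eps -> 0 < delta -> delta < 1 -> (0 < m)%N -> (0 < T)%N ->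
      exists r : nat,
      let L := rank_scale m T eps delta in
      [/\ (* r = Theta(eps^-2 log(mT/delta)), rounded to a positive integer *)
          (0 < r)%N,
          c1 * L <= r%:R,
          r%:R <= c2 * Num.max 1 L,
          (* unit vectors, and running time, for every outcome *)
          (forall (w : tape R) (v : T.-tuple 'rV[R]_m),
            (forall t, l2norm (tnth v t) <= 1) ->
            forall t : 'I_T,
              l2norm (output A r eps delta w v t) = 1 /\
              (round_time A r eps delta w v t)%:R <= K * m%:R * Num.max 1 L) &
          (* the bound with probability at least 1 - delta *)
          (forall (d : measure_display) (Omega : measurableType d)
                  (P : probability Omega R) (X : source -> nat -> {RV P >-> R}),
            random_source X ->
            forall v : T.-tuple 'rV[R]_m,
            (forall t, l2norm (tnth v t) <= 1) ->
            let E := [set o | discrepancy A r eps delta (tape_of X o) v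
                              <= 1 + eps] in
            measurable E /\ ((1 - delta)%:E <= P E)%E)]].
Proof.
(* The first two constants come from [rank_bounds]; the third combines a round time of at most 300 m
   r with the upper bound on r. *)
exists 8, 16, (300 * 16), walk_program; split; [lra|lra|lra|].
move=> eps delta m T e0 d0 d1 m0 T0.
pose L := rank_scale m T eps delta.
have mT0 : 1 <= (m * T)%:R :> R by rewrite ler1n muln_gt0 m0.
have L0 : 0 <= L.
  rewrite mulr_ge0 ?invr_ge0 ?exprn_ge0 ?(ltW e0)// ln_ge0// ler_pdivlMr//; lra.
have [rL rL8 rL16] := rank_bounds L0.
set r := (2 * _)%N in rL rL8 rL16.
have r_even : ~~ odd r by rewrite oddM.
have r1 : (1 < r)%N by rewrite /r; lia.
move: (r) rL rL8 rL16 r_even r1 => {}r rL rL8 rL16 r_even r1.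
have r0 : (0 < r)%N := ltnW r1.
exists r; split=> [//|//|//|w v v1 t|d Omega P X hX v v1 E].
  split; first exact: l2norm_output.
  apply: (@le_trans _ _ (300 * (m * r))%:R).
    by rewrite ler_nat; exact: round_time_walk.
  have m0R : 0 <= 300 * m%:R :> R by apply: mulr_ge0; exact: ler0n.
  have := ler_wpM2l m0R rL16; rewrite !natrM -/L; set M := Num.max 1 L; lra.
have mE : measurable E.
  have mD := @measurable_discrepancy R m r r0 r_even d Omega P X T v eps delta m0.
  have mb : measurable_fun setT (fun o =>
    discrepancy walk_program r eps delta (tape_of X o) v <= 1 + eps) by meas.
  have mtrue : measurable ([set true] : set bool) by [].
  have := mb measurableT [set true] mtrue; rewrite setTI; exact.
split => //.
have [T1|T2] := leqP T 1.
  have TE : T = 1%N by apply/eqP; rewrite eqn_leq T1.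
  have -> : E = setT.
    apply/seteqP; split => // o _; rewrite /E /=.
    apply: (@le_trans _ _ 1); last by rewrite lerDl ltW.
    exact: discrepancy_le1.
  by rewrite probability_setT lee_fin gerBl ltW.
apply: discrepancy_probability => //; first exact: ltW.
have n2 : 2 <= (m * T)%:R :> R.
  by rewrite ler_nat (leq_trans T2)// leq_pmull.
apply: le_trans (rank_sufficient e0 d0 d1 n2 rL).
(* What remains is m (T + 1) <= 2 m T. *)
rewrite ler_wpM2r ?expR_ge0// -natrM ler_nat.
by rewrite mulnCA leq_mul2l; apply/orP; right; lia.
Qed.
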